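(* Let $\alpha\in\mathbb{R}$, $\omega>\omega_\alpha$, $\tilde\omega>0$. If $0 \le \beta <\beta^*$, then any minimizer $(u_0,v_0)$ for $c_\beta$ is scalar. If, in addition, $d(\omega) > d^0(\tilde{\omega})$, then $u_0 = 0$ and so $(u_0,v_0)$ is scalar and regular; while if $d(\omega) < d^0(\tilde{\omega})$, then $v_0 = 0$ and $(u_0,v_0)$ is scalar and singular. If $d(\omega) = d^0(\tilde{\omega})$, then it follows that $u_0 = 0$ or $v_0 = 0$.
   Context: Functions are complex-valued on $\mathbb{R}^2$ and $\|\cdot\|_p$ is the $L^p(\mathbb{R}^2)$ norm. For $\lambda>0$, $\mathcal{G}_\lambda$ is the Green's function of $-\Delta+\lambda$ on $\mathbb{R}^2$, i.e. the $L^2$ solution of $(-\Delta+\lambda)\mathcal{G}_\lambda=\delta_0$. Put $\theta_\lambda:=\frac{\log(\sqrt{\lambda}/2)+\gamma}{2\pi}$ ($\gamma$ the Euler–Mascheroni constant) and $\omega_\alpha:=4e^{-4\pi\alpha-2\gamma}$, so $\alpha+\theta_\lambda>0$ for $\lambda>\omega_\alpha$. Let $$H^1_\alpha(\mathbb{R}^2):=\{u\in L^2(\mathbb{R}^2): \exists\, q\in\mathbb{C},\ \lambda>0 \text{ with } \phi_\lambda:=u-q\mathcal{G}_\lambda\in H^1(\mathbb{R}^2)\};$$ the charge $q=q(u)$ is uniquely determined by $u$ and independent of $\lambda$. For $\omega>\omega_\alpha$ and $u=\phi_\lambda+q\mathcal{G}_\lambda\in H^1_\alpha(\mathbb{R}^2)$,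 $$\langle(-\Delta_\alpha+\omega)u,u\rangle:=\|\nabla\phi_\lambda\|_2^2+\lambda\|\phi_\lambda\|_2^2+(\omega-\lambda)\|u\|_2^2+(\alpha+\theta_\lambda)|q|^2,$$ which does not depend on $\lambda$ (one fixes $\omega_\alpha<\lambda\le\omega$). Let $\mathbb{H}_\alpha:=H^1_\alpha(\mathbb{R}^2)\times H^1(\mathbb{R}^2)$ and, for $(u,v)\in\mathbb{H}_\alpha$, $\beta\ge0$, $$I_\beta(u,v):=\tfrac12\big(\langle(-\Delta_\alpha+\omega)u,u\rangle+\|\nabla v\|_2^2+\tilde\omega\|v\|_2^2\big)-\tfrac14(\|u\|_4^4+\|v\|_4^4)-\tfrac\beta2\int_{\mathbb{R}^2}|uv|^2,$$ $$G_\beta(u,v):=\langle(-\Delta_\alpha+\omega)u,u\rangle+\|\nabla v\|_2^2+\tilde\omega\|v\|_2^2-(\|u\|_4^4+\|v\|_4^4)-2\beta\int_{\mathbb{R}^2}|uv|^2,$$ $\mathcal{N}_\beta:=\{(u,v)\in\mathbb{H}_\alpha\setminus\{(0,0)\}: G_\beta(u,v)=0\}$, $c_\beta:=\inf_{\mathcal{N}_\beta}I_\beta$. A minimizer for $c_\beta$ is $(u,v)\in\mathcal N_\beta$ with $I_\beta(u,v)=c_\beta$. Put $\beta^*:=\beta^*(\omega,\tilde\omega):=\max\{\beta\ge0:c_\beta=c_0\}$ (the maximum exists). A pair $(u,v)$ is scalar if $u=0$ or $v=0$; regular if $q(u)=0$; singular if $q(u)\neq0$. Single-equation levels: $S_\omega(u):=\frac12\langle(-\Delta_\alpha+\omega)u,u\rangle-\frac14\|u\|_4^4$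 on $H^1_\alpha(\mathbb{R}^2)$, $\mathcal{M}_\omega:=\{u\in H^1_\alpha(\mathbb{R}^2)\setminus\{0\}:\langle(-\Delta_\alpha+\omega)u,u\rangle=\|u\|_4^4\}$, $d(\omega):=\inf_{\mathcal{M}_\omega}S_\omega$; and $S^0_{\tilde\omega}(v):=\frac12(\|\nabla v\|_2^2+\tilde\omega\|v\|_2^2)-\frac14\|v\|_4^4$ on $H^1(\mathbb{R}^2)$, $\mathcal{M}^0_{\tilde\omega}:=\{v\in H^1(\mathbb{R}^2)\setminus\{0\}:\|\nabla v\|_2^2+\tilde\omega\|v\|_2^2=\|v\|_4^4\}$, $d^0(\tilde\omega):=\inf_{\mathcal{M}^0_{\tilde\omega}}S^0_{\tilde\omega}$. *)

(* Defs.v *)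
From HB Require Import structures.
From mathcomp Require Import all_boot all_order all_algebra.
From mathcomp Require Import all_classical all_reals all_analysis.
From mathcomp.real_closed Require Import complex.

Set Implicit Arguments.
Unset Strict Implicit.
Unset Printing Implicit Defensive.

Import Order.TTheory GRing.Theory Num.Theory.
Import numFieldNormedType.Exports.

Local Open Scope classical_set_scope.
Local Open Scope ring_scope.
Local Open Scope complex_scope.

(* Elements of L^p and Sobolev spaces are represented by functions; equality of
   such elements is equality almost everywhere. *)

(* R * R with the Borel sigma-algebra in the form in which the library equips it
   with the product measure. *)
Notation mplane R := (measurableTypeR R * measurableTypeR R)%type.

Definition leb2 (R : realType) : {measure set (mplane R) -> \bar R} :=
  (@lebesgue_measure R \x @lebesgue_measure R)%E.

Definition ae0 (R : realType) (u : R * R -> R[i]) : Prop :=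
  u = cst 0 %[ae leb2 R].

Definition modulus (R : realType) (u : R * R -> R[i]) (x : R * R) : R :=
  ComplexField.Normc.normc (u x).

Definition lp_norm (R : realType) (p : R) (u : R * R -> R[i]) : R :=
  fine ('N[leb2 R]_(p%:E)[EFin \o modulus u])%E.

Definition Lp (R : realType) (p : R) (u : R * R -> R[i]) : Prop :=
  [/\ measurable_fun [set: mplane R] (fun x => complex.Re (u x)),
      measurable_fun [set: mplane R] (fun x => complex.Im (u x)) &
      finite_norm (leb2 R) p%:E (modulus u)].

Definition cintegral (R : realType) (f : R * R -> R[i]) : R[i] :=
  Complex (\int[leb2 R]_x complex.Re (f x)) (\int[leb2 R]_x complex.Im (f x)).

Definition basis_dir (R : realType) (i : 'I_2) : R * R :=
  if i == ord0 then (1, 0) else (0, 1).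

Definition partial_derivative (R : realType) (i : 'I_2) (f : R * R -> R) : R * R -> R :=
  'D_(basis_dir R i) f.

Fixpoint Ck (R : realType) (k : nat) (f : R * R -> R) : Prop :=
  continuous f /\
  if k is k'.+1 then
    forall i : 'I_2, (forall x, derivable f x (basis_dir R i)) /\ Ck k' (partial_derivative i f)
  else True.

Definition test_function (R : realType) (f : R * R -> R) : Prop :=
  (forall k, Ck k f) /\ compact (closure [set x | f x != 0]).

Definition laplacian (R : realType) (f : R * R -> R) (x : R * R) : R :=
  \sum_(i < 2) partial_derivative i (partial_derivative i f) x.

Definition weak_derivative (R : realType) (i : 'I_2) (u g : R * R -> R[i]) :=
  forall f, test_function f ->
    cintegral (fun x => u x * (partial_derivative i f x)%:C) =
    - cintegral (fun x => g x * (f x)%:C).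

Definition H1 (R : realType) (u : R * R -> R[i]) : Prop :=
  Lp 2 u /\ forall i : 'I_2, exists2 g, Lp 2 g & weak_derivative i u g.

(* For u in H^1, a representative of the weak derivative, which is unique up to
   null sets. *)
Definition wpartial (R : realType) (i : 'I_2) (u : R * R -> R[i]) :
    R * R -> R[i] :=
  xget (cst 0) [set g | Lp 2 g /\ weak_derivative i u g].

Definition grad2 (R : realType) (u : R * R -> R[i]) : R :=
  \sum_(i < 2) lp_norm 2 (wpartial i u) ^+ 2.

(* (- Delta + lam) G = delta_0 in the sense of distributions, with G in L^2 *)
Definition is_green (R : realType) (lam : R) (G : R * R -> R[i]) : Prop :=
  Lp 2 G /\
  forall f, test_function f ->
    cintegral (fun x => G x * (- laplacian f x + lam * f x)%:C) = (f 0)%:C.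

(* A representative of the L^2 solution, which exists and is unique up to null
   sets when 0 < lam. *)
Definition green (R : realType) (lam : R) : R * R -> R[i] :=
  xget (cst 0) [set G | is_green lam G].

Definition euler_gamma (R : realType) : R :=
  limn (fun n : nat => \sum_(1 <= k < n.+1) k%:R^-1 - ln n%:R).

Definition theta (R : realType) (lam : R) : R :=
  (ln (Num.sqrt lam / 2) + euler_gamma R) / (2 * pi).

Definition omega_ (R : realType) (alpha : R) : R :=
  4 * expR (- 4 * pi * alpha - 2 * euler_gamma R).

Definition regular_part (R : realType) (lam : R) (q : R[i])
    (u : R * R -> R[i]) : R * R -> R[i] :=
  fun x => u x - q * green lam x.

(* The space does not depend on alpha, only its quadratic form does. *)
Definition H1alpha (R : realType) (u : R * R -> R[i]) : Prop :=
  Lp 2 u /\ exists q lam, 0 < lam /\ H1 (regular_part lam q u).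

Definition charge (R : realType) (u : R * R -> R[i]) : R[i] :=
  xget 0 [set q | exists2 lam, 0 < lam & H1 (regular_part lam q u)].

Section functionals.
Context (R : realType).
(* lam is the auxiliary parameter of the decomposition u = phi_lam + q G_lam;
   the form [Qalpha] does not depend on its choice in ]omega_ alpha, omega]. *)
Variables (alpha omega tomega lam : R).
Implicit Types (u v : R * R -> R[i]) (w : (R * R -> R[i]) * (R * R -> R[i])).

(* < (- Delta_alpha + omega) u, u > *)
Definition Qalpha u : R :=
  let q := charge u in
  let phi := regular_part lam q u in
  grad2 phi + lam * lp_norm 2 phi ^+ 2 + (omega - lam) * lp_norm 2 u ^+ 2
  + (alpha + theta lam) * ComplexField.Normc.normc q ^+ 2.

Definition Q0 v : R := grad2 v + tomega * lp_norm 2 v ^+ 2.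

Definition coupling u v : R :=
  \int[leb2 R]_x modulus (fun y => u y * v y) x ^+ 2.

Definition I_ (beta : R) w : R :=
  2^-1 * (Qalpha w.1 + Q0 w.2) - 4^-1 * (lp_norm 4 w.1 ^+ 4 + lp_norm 4 w.2 ^+ 4)
  - beta / 2 * coupling w.1 w.2.

Definition G_ (beta : R) w : R :=
  Qalpha w.1 + Q0 w.2 - (lp_norm 4 w.1 ^+ 4 + lp_norm 4 w.2 ^+ 4)
  - 2 * beta * coupling w.1 w.2.

Definition nehari (beta : R) :=
  [set w | [/\ H1alpha w.1, H1 w.2, ~ (ae0 w.1 /\ ae0 w.2) & G_ beta w = 0]].

Definition c_ (beta : R) : \bar R :=
  ereal_inf [set (I_ beta w)%:E | w in nehari beta].

Definition minimizer (beta : R) w : Prop :=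
  nehari beta w /\ (I_ beta w)%:E = c_ beta.

(* The maximum of the set, which is attained; the supremum in \bar R agrees
   with it and is meaningful without knowing this beforehand. *)
Definition beta_star : \bar R :=
  ereal_sup [set beta%:E | beta in [set beta | 0 <= beta /\ c_ beta = c_ 0]].

Definition S_ u : R := 2^-1 * Qalpha u - 4^-1 * lp_norm 4 u ^+ 4.

Definition nehari_S := [set u | [/\ H1alpha u, ~ ae0 u & Qalpha u = lp_norm 4 u ^+ 4]].

Definition d_ : \bar R := ereal_inf [set (S_ u)%:E | u in nehari_S].

Definition S0 v : R := 2^-1 * Q0 v - 4^-1 * lp_norm 4 v ^+ 4.

Definition nehari_S0 := [set v | [/\ H1 v, ~ ae0 v & Q0 v = lp_norm 4 v ^+ 4]].

Definition d0 : \bar R := ereal_inf [set (S0 v)%:E | v in nehari_S0].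

End functionals.

Definition scalar_pair (R : realType) (w : (R * R -> R[i]) * (R * R -> R[i])) : Prop :=
  ae0 w.1 \/ ae0 w.2.

Definition regular_pair (R : realType) (w : (R * R -> R[i]) * (R * R -> R[i])) : Prop :=
  charge w.1 = 0.

Definition singular_pair (R : realType) (w : (R * R -> R[i]) * (R * R -> R[i])) : Prop :=
  charge w.1 <> 0.

(* Main.v *)
(* For [beta < beta'] with [c_ beta' = c_ 0], a minimizer [(u, v)] for [beta] with
   both components nonzero is impossible: if the coupling is positive, rescaling
   [(u, v)] onto the Nehari set of [beta'] gives a level below [c_ beta]; if it
   vanishes, one of [(u, 0)], [(0, v)] rescales to a smaller level.  Comparing
   [c_ beta] with [d_] and [d0] then decides which component vanishes.

   A minimizer [u] of [d_] without charge would lie in [H^1].  Optimality against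
   adding a small charge [e zeta] to a translate [w] of [u] gives
   [int ((omega - lam) - |w|^2) w G_lam = 0] for all translates [w], hence
   [(omega - lam) u = |u|^2 u], contradicting [Q(u) = ||u||_4^4].

   This needs the Green's function: it is the Laplace transform of the heat
   kernel; uniqueness follows from a maximum principle, and the uniqueness of
   the charge from testing with functions concentrating at the origin. *)
From HB Require Import structures.
Require Import Defs.
From mathcomp Require Import all_boot all_order all_algebra.
From mathcomp Require Import all_classical all_reals all_analysis measurable_realfun.
From mathcomp.real_closed Require Import complex.
From mathcomp Require Import ring lra.
Set Implicit Arguments.
Unset Strict Implicit.
Unset Printing Implicit Defensive.
Import Order.TTheory GRing.Theory Num.Theory.
Import numFieldNormedType.Exports.
Local Open Scope classical_set_scope.
Local Open Scope ring_scope.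

(** * Test functions *)

(** All norms are [fine] values of possibly infinite integrals, and no embedding of H^1 into L^4 is
    proved. Integrability of [|u|^4] is read off instead from the Nehari identity: a positive value
    of [fine] comes from a finite integral. The choice operators behind [green], [charge] and
    [wpartial] return a default when nothing qualifies, so existence and uniqueness come before any
    evaluation of [Qalpha] along a perturbation.

    The substitution t = r^4 in the heat-kernel integral is dictated by the fourth power. Against
    the weight [e^(- k r^4) dr], Jensen's inequality bounds the n-th power of the Green's function,
    and integrating over the plane leaves [r^(4 - n)], harmless up to n = 4.

    Stationarity at [u] in the charge direction is a single scalar identity. Translates supply one
    for each point of the plane, because the form restricted to H^1 is translation invariant.
    Together they say that the convolution of the residual with the Green's function vanishes, and -
    Delta + lam undoes the convolution. The perturbation leaves the regular part unchanged, so no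
    gradient enters the first variation. *)

Section smooth.
Context {R : realType}.
Implicit Types (f g h : R -> R) (F : R * R -> R).

Fixpoint diffn (k : nat) f : Prop :=
  if k is k'.+1 then
    exists2 f', (forall x : R, is_derive x 1 f (f' x)) & diffn k' f'
  else True.

Lemma diffnW k f : diffn k.+1 f -> diffn k f.
Proof.
elim: k f => [//|k IH] f [f' df sf].
by exists f' => //; exact: IH.
Qed.

Lemma diffnD k f g : diffn k f -> diffn k g -> diffn k (f \+ g).
Proof.
elim: k f g => [//|k IH] f g [f' df sf] [g' dg sg].
exists (f' \+ g'); last exact: IH.
by move=> x; have := df x; have := dg x => ? ?; apply: is_deriveD.
Qed.

Lemma diffnZ k (c : R) f : diffn k f -> diffn k (c \*o f).
Proof.
elim: k f => [//|k IH] f [f' df sf].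
exists (c \*o f'); last exact: IH.
by move=> x; have := df x => ?; apply: is_deriveZ.
Qed.

Lemma diffnM k f g : diffn k f -> diffn k g -> diffn k (f \* g).
Proof.
elim: k f g => [//|k IH] f g kf kg.
have := diffnW kf; have := diffnW kg.
case: kf kg => [f' df sf] [g' dg sg] kg kf.
exists ((f \* g') \+ (g \* f')); last by apply: diffnD; exact: IH.
by move=> x; have := df x; have := dg x => ? ?; apply: is_deriveM.
Qed.

Lemma diffn_affine k f (a b : R) : diffn k f -> diffn k (fun x => f (a * x + b)).
Proof.
elim: k f => [//|k IH] f [f' df sf].
exists (a \*o (fun x => f' (a * x + b))); last by apply: diffnZ; exact: IH.
move=> x /=; rewrite mulrC.
apply: (@is_derive1_comp R f (fun x => a * x + b)).
have : is_derive x 1 ((a \*: (id : R -> R)) + cst b) (a%:A + 0).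
  by apply: is_deriveD.
by rewrite addr0 /GRing.scale /= mulr1.
Qed.

(* [bumpn n] is the n-th monomial factor of the derivatives of [bumpn 0] *)
Definition bumpn (n : nat) (x : R) : R :=
  if 0 < x then x^-1 ^+ n * expR (- x^-1) else 0.

(** The exponential series at [y = x^-1] gives [y^(n+2) <= (n+2)! e^y], which trades [n + 2] powers
    of [x^-1] for a square. A quadratic bound is what makes the derivative at the origin 0. *)
Lemma bumpn_le n (x : R) : `|bumpn n x| <= (n.+2)`!%:R * x ^+ 2.
Proof.
rewrite /bumpn; case: ifPn => [x0|_]; last first.
  by rewrite normr0 mulr_ge0// ?ler0n ?sqr_ge0.
rewrite ger0_norm; last by rewrite mulr_ge0 ?exprn_ge0 ?invr_ge0 ?(ltW x0)// expR_ge0.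
have y0 : 0 < x^-1 by rewrite invr_gt0.
have := @expR_ge1Dxn R x^-1 n.+1 (ltW y0).
set F : R := (n.+2)`!%:R; have F0 : 0 < F by rewrite ltr0n fact_gt0.
rewrite expRN => H.
have {}H : x^-1 ^+ n.+2 / F <= expR x^-1 by rewrite (le_trans _ H)// lerDr.
rewrite ler_pdivrMr ?expR_gt0// -ler_pdivrMl; last first.
  by rewrite mulr_gt0// exprn_gt0.
by apply: le_trans H; rewrite invfM -exprVn -(addn2 n) exprD; rewrite le_eqVlt; apply/orP; left; apply/eqP; ring.
Qed.

Lemma is_derive_lim {V : normedModType R} (f : V -> R) (x v : V) (l : R) :
  h^-1 *: (f (h *: v + x) - f x) @[h --> 0^'] --> l -> is_derive x v f l.
Proof.
move=> H; apply: DeriveDef; first by apply/cvg_ex; exists l.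
exact: cvg_lim.
Qed.

Lemma is_derive_cvg {V : normedModType R} (f : V -> R) (x v : V) (l : R) :
  is_derive x v f l -> h^-1 *: (f (h *: v + x) - f x) @[h --> 0^'] --> l.
Proof. by move=> [df <-]; exact: df. Qed.

Lemma is_derive_line {V : normedModType R} (f : V -> R) (x v : V) (t l : R) :
  is_derive (x + t *: v) v f l -> is_derive t (1 : R) (fun s => f (x + s *: v)) l.
Proof.
move=> /is_derive_cvg H; apply: is_derive_lim.
rewrite (_ : (fun h : R => _) = (fun h : R => h^-1 *: (f (h *: v + (x + t *: v)) - f (x + t *: v))))//.
apply/funext => h; rewrite (_ : h *: (1 : R) = h) ?scalerDl 1?addrCA//.
by rewrite /GRing.scale /= mulr1.
Qed.

Lemma is_derive_of_line {V : normedModType R} (f : V -> R) (x v : V) (l : R) :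
  is_derive (0 : R) (1 : R) (fun s => f (x + s *: v)) l -> is_derive x v f l.
Proof.
move=> /is_derive_cvg H; apply: is_derive_lim; move: H.
rewrite (_ : (fun h : R => _) = (fun h : R => h^-1 *: (f (h *: v + x) - f x)))//.
apply/funext => h; rewrite (_ : h *: (1 : R) + 0 = h) ?scale0r ?addr0 1?[x + _]addrC//.
by rewrite /GRing.scale /= mulr1.
Qed.

Lemma is_derive_cmul (c : R) (h h' : R -> R) : (forall x : R, is_derive x 1 h (h' x)) ->
  forall x : R, is_derive x 1 (fun t => c * h t) (c * h' x).
Proof. by move=> dh x; have dx := dh x; exact: is_deriveZ. Qed.

Lemma is_derive_affine {V : normedModType R} (f : V -> R) (c s : R) (a x v : V) (l : R) :
  is_derive (s *: x + a) v f l -> is_derive x v (fun y => c * f (s *: y + a)) (c * s * l).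
Proof.
move=> H; apply: is_derive_of_line.
have H1 : is_derive (s * 0) (1 : R) (fun t => f (s *: x + a + t *: v)) l.
  by apply: is_derive_line; rewrite mulr0 scale0r addr0.
have H2 : is_derive (0 : R) (1 : R) (fun t => s * t) (s * 1).
  exact: (is_derive_cmul s (fun x => is_derive_id x (1 : R))).
have := is_derive1_comp H1 H2; rewrite mulr1 => H3.
have : is_derive (0 : R) (1 : R) (c \*: ((fun t => f (s *: x + a + t *: v)) \o (fun t : R => s * t))) (c *: (l * s)).
  exact: is_deriveZ.
rewrite (_ : c *: (l * s) = c * s * l); last by rewrite /GRing.scale /= (mulrC l) mulrA.
move=> H4.
have -> : (fun t => c * f (s *: (x + t *: v) + a)) =
    c \*: ((fun t => f (s *: x + a + t *: v)) \o (fun t : R => s * t)); last exact: H4.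
by apply/funext => t /=; rewrite scalerDr scalerA addrAC.
Qed.

Lemma sq_bound_is_derive0 f (C : R) :
  (forall x, `|f x| <= C * x ^+ 2) -> is_derive (0 : R) 1 f 0.
Proof.
move=> H.
have C0 : 0 <= C by have := H 1; rewrite expr1n mulr1; exact: le_trans.
have f0 : f 0 = 0.
  by apply/eqP; rewrite -normr_le0; have := H 0; rewrite expr0n /= mulr0.
apply: is_derive_lim; apply/cvgr0Pnorm_lt => e e0.
exists (e / (C + 1)); first by rewrite /= divr_gt0// ltr_wpDl.
move=> h /= + h0.
rewrite sub0r normrN /= f0 subr0 addr0 /GRing.scale /= mulr1 => he.
rewrite normrM normfV mulrC ltr_pdivrMr ?normr_gt0//.
apply: le_lt_trans (H h) _.
rewrite -real_normK ?num_real// expr2 mulrA ltr_pM2r ?normr_gt0//.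
move: he; rewrite ltr_pdivlMr ?ltr_wpDl// => he; apply: le_lt_trans he.
by rewrite mulrC ler_wpM2l// lerDl.
Qed.

(** The derivative stays in the linear span of the family, so [diffn_bumpn] becomes an induction
    over all [n] at once. *)
Lemma is_derive_bumpn n (x : R) :
  is_derive x 1 (bumpn n) (- n%:R * bumpn n.+1 x + bumpn n.+2 x).
Proof.
have [x0|x0|->] := ltgtP x 0; last first.
- rewrite /bumpn ltxx mulr0 addr0.
  exact: sq_bound_is_derive0 (@bumpn_le n).
- have dV : is_derive x (1 : R) (fun y => y^-1) (- x^-1 ^+ 2).
    apply: is_derive_eq; first by apply: (@is_deriveV _ id) => //; rewrite gt_eqF.
    by rewrite /GRing.scale /= mulr1 exprVn.
  have dE : is_derive x (1 : R) (fun y => expR (- y^-1)) (expR (- x^-1) * x^-1 ^+ 2).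
    apply: (@is_derive1_comp R expR (fun y => - y^-1)).
    by apply: is_derive_eq; rewrite opprK.
  have -> : - n%:R * bumpn n.+1 x + bumpn n.+2 x =
     x^-1 ^+ n * (expR (- x^-1) * x^-1 ^+ 2) + expR (- x^-1) * (n%:R * x^-1 ^+ n.-1 * (- x^-1 ^+ 2)).
    rewrite /bumpn x0; case: n => [|n]; rewrite ?exprS /=; ring.
  have : is_derive x (1 : R) ((fun y => y^-1 ^+ n) * (fun y => expR (- y^-1)))
    (x^-1 ^+ n * (expR (- x^-1) * x^-1 ^+ 2) + expR (- x^-1) * (n%:R * x^-1 ^+ n.-1 * (- x^-1 ^+ 2))).
    have -> : (fun y : R => y^-1 ^+ n) = (fun y => y^-1) ^+ n.
      by apply/funext => y; rewrite !fctE.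
    have H := is_deriveM (is_deriveX n dV) dE; apply: is_derive_eq.
    by rewrite !fctE.
  apply: near_eq_is_derive; near=> y; rewrite /bumpn ifT//.
  by near: y; exact: lt_nbhsr.
- rewrite /bumpn ltNge (ltW x0) /= mulr0 addr0.
  apply: (near_eq_is_derive (f := cst 0)).
  near=> y; rewrite ltNge ifN// negbK; apply: ltW.
  by near: y; exact: lt_nbhsl.
Unshelve. all: by end_near. Qed.

Lemma diffn_bumpn k n : diffn k (bumpn n).
Proof.
elim: k n => [//|k IH] n.
exists ((- n%:R) \*o bumpn n.+1 \+ bumpn n.+2); first exact: is_derive_bumpn.
by apply: diffnD => //; exact: diffnZ.
Qed.

Definition smooth f := forall k, diffn k f.

Lemma smooth_derive f : smooth f -> forall x : R, is_derive x 1 f (derive1 f x).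
Proof.
move=> sf x; have [f' df _] := sf 1%N.
by have := df x => dfx; rewrite derive1E derive_val; exact: dfx.
Qed.

Lemma smooth_derive1 f : smooth f -> smooth (derive1 f).
Proof.
move=> sf k; have [f' df sf'] := sf k.+1.
suff -> : derive1 f = f' by [].
by apply/funext => x; have := df x => dfx; rewrite derive1E derive_val.
Qed.

Lemma smooth_continuous f : smooth f -> continuous f.
Proof.
move=> sf x; apply: differentiable_continuous; apply/derivable1_diffP.
by have [] := smooth_derive sf x.
Qed.

Lemma bumpn0_itv01 x : 0 <= bumpn 0 x <= 1.
Proof.
rewrite /bumpn; case: ifPn => x0; last by rewrite lexx ler01.
by rewrite expr0 mul1r expR_ge0 /= -expR0 ler_expR oppr_le0 invr_ge0 ltW.
Qed.

Lemma is_derive_dir0 F x l :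
  is_derive x.1 (1 : R) (fun s => F (s, x.2)) l <-> is_derive x (basis_dir R ord0) F l.
Proof.
have E : (fun h : R => h^-1 *: (F (h *: basis_dir R ord0 + x) - F x)) =
   (fun h : R => h^-1 *: (F (h *: (1 : R) + x.1, x.2) - F (x.1, x.2))).
  apply/funext => h; rewrite -surjective_pairing; congr (_ *: (F _ - _)).
  rewrite /basis_dir eqxx; case: x => a b /=; congr (_, _).
  by rewrite /= scaler0 add0r.
by split=> -[]; rewrite /derivable /derive /= => D1 D2; split; rewrite /derivable /derive/= ?E// -E.
Qed.

Lemma is_derive_dir1 F x l :
  is_derive x.2 (1 : R) (fun s => F (x.1, s)) l <-> is_derive x (basis_dir R (lift ord0 ord0)) F l.
Proof.
have E : (fun h : R => h^-1 *: (F (h *: basis_dir R (lift ord0 ord0) + x) - F x)) =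
   (fun h : R => h^-1 *: (F (x.1, h *: (1 : R) + x.2) - F (x.1, x.2))).
  apply/funext => h; rewrite -surjective_pairing; congr (_ *: (F _ - _)).
  rewrite /basis_dir /=; case: x => a b /=; congr (_, _).
  by rewrite /= scaler0 add0r.
by split=> -[]; rewrite /derivable /derive /= => D1 D2; split; rewrite /derivable /derive/= ?E// -E.
Qed.
End smooth.

Section test_functions.
Context {R : realType}.
Implicit Types (h k : R -> R) (F f : R * R -> R).

Definition tens h k : R * R -> R := fun p => h p.1 * k p.2.

Definition dir0 : 'I_2 := ord0.
Definition dir1 : 'I_2 := lift ord0 ord0.

Lemma ord2P (P : 'I_2 -> Prop) : P dir0 -> P dir1 -> forall i, P i.
Proof.
move=> P0 P1 i; case: (unliftP ord0 i) => [j ->|->//].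
by rewrite (ord1 j).
Qed.

Lemma is_derive_partial i F (x : R * R) l :
  is_derive x (basis_dir R i) F l -> partial_derivative i F x = l.
Proof. by move=> H; rewrite /partial_derivative derive_val. Qed.

Lemma is_derive_tens0 h k x : smooth h ->
  is_derive x (basis_dir R dir0) (tens h k) (tens (derive1 h) k x).
Proof.
move=> sh; apply/is_derive_dir0; have dh := smooth_derive sh x.1.
rewrite (_ : (fun s => _) = k x.2 \*: h); last first.
  by apply/funext => s; rewrite /tens /= mulrC.
by rewrite /tens mulrC; exact: is_deriveZ.
Qed.

Lemma is_derive_tens1 h k x : smooth k ->
  is_derive x (basis_dir R dir1) (tens h k) (tens h (derive1 k) x).
Proof.
move=> sh; apply/is_derive_dir1; have dh := smooth_derive sh x.2.
rewrite (_ : (fun s => _) = h x.1 \*: k)//; exact: is_deriveZ.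
Qed.

Lemma partial_tens0 h k : smooth h ->
  partial_derivative dir0 (tens h k) = tens (derive1 h) k.
Proof. by move=> sh; apply/funext => x; exact/is_derive_partial/is_derive_tens0. Qed.

Lemma partial_tens1 h k : smooth k ->
  partial_derivative dir1 (tens h k) = tens h (derive1 k).
Proof. by move=> sh; apply/funext => x; exact/is_derive_partial/is_derive_tens1. Qed.

Lemma continuous_tens h k : continuous h -> continuous k -> continuous (tens h k).
Proof.
move=> ch ck x.
have c1 : {for x, continuous (fst : R * R -> R)} by apply: cvg_fst.
have c2 : {for x, continuous (snd : R * R -> R)} by apply: cvg_snd.
by apply: cvgM; [exact: continuous_comp c1 (ch _)|exact: continuous_comp c2 (ck _)].
Qed.

Lemma Ck_tens n h k : smooth h -> smooth k -> Ck n (tens h k).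
Proof.
elim: n h k => [|n IH] h k sh sk.
  by split => //; apply: continuous_tens; exact: smooth_continuous.
split; first by apply: continuous_tens; exact: smooth_continuous.
apply: ord2P; split.
- by move=> x; have [] := is_derive_tens0 k x sh.
- by rewrite partial_tens0//; apply: IH => //; exact: smooth_derive1.
- by move=> x; have [] := is_derive_tens1 h x sk.
- by rewrite partial_tens1//; apply: IH => //; exact: smooth_derive1.
Qed.

Definition bsupp {V : normedModType R} (M : R) (f : V -> R) :=
  forall x, M < `|x| -> f x = 0.

Lemma compact_supp M f : bsupp M f -> compact (closure [set x | f x != 0]).
Proof.
move=> H.
have cS : compact (`[- M, M]%classic `*` `[- M, M]%classic : set (R * R)).
  by apply: compact_setX; exact: segment_compact.
apply: (subclosed_compact _ cS); first exact: closed_closure.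
rewrite [X in _ `<=` X](closure_id _).1; last first.
  exact: (compact_closed (@norm_hausdorff _ _) cS).
apply: closure_subset => x /= fx.
have : `|x| <= M by rewrite leNgt; apply/negP => /H /eqP; exact/negP.
by rewrite prod_normE ge_max !in_itv /= !ler_norml => /andP[].
Qed.

Lemma test_tens M h k : smooth h -> smooth k -> bsupp M h -> bsupp M k ->
  test_function (tens h k).
Proof.
move=> sh sk Hh Hk; split; first by move=> n; exact: Ck_tens.
apply: (@compact_supp M) => x; rewrite prod_normE lt_max /tens => /orP[H|H].
  by rewrite Hh// mul0r.
by rewrite Hk// mulr0.
Qed.

Lemma test_partial i f : test_function f -> test_function (partial_derivative i f).
Proof.
move=> [Cf Sf]; split.
  by move=> k; have [_ /(_ i)[]] := Cf k.+1.
apply: (subclosed_compact _ Sf); first exact: closed_closure.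
rewrite [X in _ `<=` X](closure_id _).1; last exact: closed_closure.
(* Off its closed support [f] vanishes on a whole neighbourhood, and so does its derivative. *)
apply: closure_subset => x /= /eqP dfx; apply: contrapT => nx; apply: dfx.
rewrite /partial_derivative (@near_eq_derive _ _ _ _ (cst 0)); first exact: derive_cst.
have : nbhs x (~` closure [set y | f y != 0]).
  by apply: open_nbhs_nbhs; split => //; apply: closed_openC; exact: closed_closure.
apply: filterS => y ny; apply/eqP/negPn/negP => fy; apply: ny.
exact: subset_closure.
Qed.

Lemma test_bsupp f : test_function f -> exists2 M : R, 0 < M & bsupp M f.
Proof.
move=> [_ Sf]; have [M [Mr HM]] := compact_bounded Sf.
have {}HM := HM (`|M| + 1) (ltr_pwDr ltr01 (ler_norm M)).
exists (`|M| + 1); first by rewrite ltr_wpDl.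
move=> x nx; apply/eqP/negPn/negP => fx.
have /= : `|x| <= `|M| + 1 by apply: HM; apply: subset_closure.
by rewrite leNgt nx.
Qed.

Lemma test_continuous f : test_function f -> continuous f.
Proof. by move=> [/(_ 0)[]]. Qed.

Lemma test_bounded f : test_function f -> exists2 M : R, 0 < M & forall x, `|f x| <= M.
Proof.
move=> tf; have [_ Sf] := tf.
have cA : {within closure [set x | f x != 0], continuous f}.
  by apply: continuous_subspaceT; exact: test_continuous.
have [M [Mr HM]] := compact_bounded (continuous_compact cA Sf).
have {}HM := HM (`|M| + 1) (ltr_pwDr ltr01 (ler_norm M)).
exists (`|M| + 1); first by rewrite ltr_wpDl.
move=> x; have [->|fx] := eqVneq (f x) 0; first by rewrite normr0 addr_ge0.
by apply: HM; exists x => //; exact: subset_closure.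
Qed.

Lemma test_derivable i f x : test_function f -> derivable f x (basis_dir R i).
Proof. by move=> [/(_ 1%N)[_ /(_ i)[]]]. Qed.

Lemma test_is_derive i f x : test_function f ->
  is_derive x (basis_dir R i) f (partial_derivative i f x).
Proof. by move=> tf; split => //; exact: test_derivable. Qed.

Lemma partial_affine i (f : R * R -> R) (c s : R) (a : R * R) : test_function f ->
  partial_derivative i (fun x => c * f (s *: x + a)) =
  fun x => c * s * partial_derivative i f (s *: x + a).
Proof.
move=> tf; apply/funext => x; apply: is_derive_partial.
exact/is_derive_affine/test_is_derive.
Qed.

Lemma test_affine (f : R * R -> R) (c s : R) (a : R * R) : s != 0 -> test_function f ->
  test_function (fun x => c * f (s *: x + a)).
Proof.
move=> s0 tf; split.
  have cont c' g : test_function g -> continuous (fun x : R * R => c' * g (s *: x + a)).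
    move=> tg x; apply: cvgMl_tmp; apply: (@continuous_comp _ _ _ (fun x : R * R => s *: x + a) g).
      by apply: cvgD; [exact: scaler_continuous|exact: cvg_cst].
    exact: test_continuous.
  move=> k; elim: k c f tf => [|k IH] c f tf; (split; first exact: cont) => //.
  move=> i; split.
    by move=> x; have [] := is_derive_affine c (test_is_derive i (s *: x + a) tf).
  by rewrite partial_affine//; apply: IH; exact: test_partial.
have [M M0 HM] := test_bsupp tf.
apply: (@compact_supp ((M + `|a|) / `|s|)) => x; rewrite ltr_pdivrMr ?normr_gt0// => Mx.
rewrite HM ?mulr0//.
have := lerB_dist (s *: x) (- a); rewrite opprK normrN normrZ (mulrC `|s|) => H.
by rewrite (lt_le_trans _ H)// ltrBrDr.
Qed.

Lemma affine_shift f (a : R * R) : (fun x => f (x + a)) = (fun x => 1 * f (1 *: x + a)).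
Proof. by apply/funext => x; rewrite mul1r scale1r. Qed.

Lemma partial_shift i f (a : R * R) : test_function f ->
  partial_derivative i (fun x => f (x + a)) = fun x => partial_derivative i f (x + a).
Proof.
by move=> tf; rewrite affine_shift partial_affine//; apply/funext => x; rewrite scale1r !mul1r.
Qed.

Lemma test_shift f (a : R * R) : test_function f -> test_function (fun x => f (x + a)).
Proof. by move=> tf; rewrite affine_shift; apply: test_affine. Qed.
End test_functions.

Section cutoff.
Context {R : realType}.

(* The factors are scaled so that these functions converge to the indicator of
   the half-open interval, including its right end point. *)
Definition ocbump (a b : R) (n : nat) (x : R) : R :=
  bumpn 0 (n.+1%:R * (x - a)) * bumpn 0 (n.+1%:R * (n.+1%:R * (b - x) + 1)).

Lemma smooth_ocbump a b n : smooth (ocbump a b n).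
Proof.
move=> k.
rewrite (_ : ocbump a b n = (fun x => bumpn 0 (n.+1%:R * x + - n.+1%:R * a)) \*
   (fun x => bumpn 0 (- n.+1%:R ^+ 2 * x + (n.+1%:R ^+ 2 * b + n.+1%:R)))).
  by apply: diffnM; apply: diffn_affine; exact: diffn_bumpn.
by apply/funext => x; rewrite /ocbump /=; congr (bumpn _ _ * bumpn _ _); ring.
Qed.

Lemma ocbump_itv01 a b n x : 0 <= ocbump a b n x <= 1.
Proof.
have /andP[h0 h1] := bumpn0_itv01 (n.+1%:R * (x - a)).
have /andP[k0 k1] := bumpn0_itv01 (n.+1%:R * (n.+1%:R * (b - x) + 1)).
by rewrite /ocbump mulr_ge0 //= mulr_ile1.
Qed.

Lemma bumpn0_le0 (x : R) : x <= 0 -> bumpn 0 x = 0.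
Proof. by move=> x0; rewrite /bumpn ltNge x0. Qed.

Lemma bumpn0_ge (x : R) : 0 < x -> 1 - x^-1 <= bumpn 0 x.
Proof. by move=> x0; rewrite /bumpn x0 expr0 mul1r expR_ge1Dx. Qed.

Lemma ocbump_le a b n x : x <= a -> ocbump a b n x = 0.
Proof. by move=> xa; rewrite /ocbump bumpn0_le0 ?mul0r// pmulr_rle0 ?ltr0n// subr_le0. Qed.

Lemma ocbump_ge a b n x : b + n.+1%:R^-1 <= x -> ocbump a b n x = 0.
Proof.
move=> xb; rewrite /ocbump [X in _ * X]bumpn0_le0 ?mulr0// pmulr_rle0 ?ltr0n//.
rewrite -lerBrDr sub0r -ler_pdivlMl ?ltr0n// mulrN1.
by move: xb; move: (n.+1%:R^-1) => t; lra.
Qed.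

Lemma bsupp_ocbump a b n : bsupp (`|a| + `|b| + 1) (ocbump a b n).
Proof.
move=> x; have [xa _|ax] := leP x a; first exact: ocbump_le.
have [bx _|xb Hx] := leP (b + n.+1%:R^-1) x; first exact: ocbump_ge.
have n1 : n.+1%:R^-1 <= 1 :> R by rewrite invf_le1 ?ltr0n// ler1n.
exfalso; move: Hx; apply/negP; rewrite -leNgt ler_norml.
have := ler_norm a; have := ler_norm b; have := ler_norm (- a); have := ler_norm (- b).
move: n1 xb; move: (n.+1%:R^-1) => t n1 xb.
rewrite !normrN => h1 h2 h3 h4; apply/andP; split; lra.
Qed.

Lemma bumpn0_cvg (u : nat -> R) (c : R) :
  (forall n, 0 < u n) -> (forall n, (u n)^-1 <= c / n.+1%:R) ->
  bumpn 0 (u n) @[n --> \oo] --> (1 : R).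
Proof.
move=> u0 uc.
apply: (@squeeze_cvgr _ _ _ _ (fun n => 1 - c / n.+1%:R) (cst 1)); last first.
- exact: cvg_cst.
- rewrite -[X in _ --> X](subr0 1); apply: cvgB; first exact: cvg_cst.
  by rewrite -(mulr0 c); apply: cvgM; [exact: cvg_cst|exact: cvg_harmonic].
apply: nearW => n; have /andP[_ ->] := bumpn0_itv01 (u n); rewrite andbT.
by apply: le_trans (bumpn0_ge (u0 n)); rewrite lerB.
Qed.

(** Half-open intervals form the intersection-stable generator [ocitv] of the Borel sets, so exactly
    their indicators are wanted as limits. At [x = b] the second factor has argument [n.+1], thanks
    to the [+ 1] in its definition. *)
Lemma ocbump_cvg a b x : ocbump a b n x @[n --> \oo] --> (\1_(`]a, b]%classic) x : R).
Proof.
rewrite indicE mem_setE in_itv /=; have [xa|ax] := leP x a => /=.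
  by under eq_fun do rewrite ocbump_le//; exact: cvg_cst.
have [xb|bx] := leP x b => /=.
  rewrite -[X in _ --> X](mulr1 (1 : R)); apply: cvgM.
    apply: (@bumpn0_cvg _ (x - a)^-1) => n.
      by rewrite mulr_gt0 ?ltr0n// subr_gt0.
    by rewrite invfM mulrC.
  apply: (@bumpn0_cvg _ 1) => n; first by rewrite mulr_gt0 ?ltr0n// ltr_wpDl// mulr_ge0 ?ler0n// subr_ge0.
  rewrite invfM mulrC ler_pM2r ?invr_gt0 ?ltr0n// invf_le1 ?ltr_wpDl// ?lerDr mulr_ge0 ?ler0n// subr_ge0//.
apply: cvg_near_cst.
have := @cvg_harmonic R; move/cvgr_lt => /(_ (x - b)).
rewrite subr_gt0 => /(_ bx); apply: filterS => n /ltW nb.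
by rewrite ocbump_ge// -lerBrDl.
Qed.

Lemma ocbump_gt0 a b n x : a < x <= b -> 0 < ocbump a b n x.
Proof.
move=> /andP[ax xb].
have H y : 0 < y -> 0 < bumpn 0 y.
  by move=> y0; rewrite /bumpn y0 expr0 mul1r expR_gt0.
apply: mulr_gt0; apply: H; rewrite mulr_gt0 ?ltr0n ?subr_gt0//.
by rewrite ltr_wpDl// mulr_ge0 ?ler0n// subr_ge0.
Qed.

End cutoff.

(** * Integrability on the plane *)

Section square_integrable.
Context d {T : measurableType d} {R : realType} (mu : {measure set T -> \bar R}).
Implicit Types f g : T -> R.

Definition itg f := mu.-integrable setT (EFin \o f).

Lemma itg_measurable f : itg f -> measurable_fun setT f.
Proof. by move=> /measurable_int /measurable_EFinP. Qed.

Lemma itgP f : itg f <-> measurable_fun setT f /\ (\int[mu]_x (`|f x|)%:E < +oo)%E.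
Proof.
split=> [/integrableP[/measurable_EFinP mf fi]|[mf fi]] //.
by apply/integrableP; split => //; exact/measurable_EFinP.
Qed.

Lemma itgD f g : itg f -> itg g -> itg (fun x => f x + g x).
Proof. exact: integrableD. Qed.

Lemma itgB f g : itg f -> itg g -> itg (fun x => f x - g x).
Proof. exact: integrableB. Qed.

Lemma itgZ c f : itg f -> itg (fun x => c * f x).
Proof. exact: integrableZl. Qed.

Lemma itgZr c f : itg f -> itg (fun x => f x * c).
Proof. by move=> /(itgZ c); apply: eq_integrable => // x _ /=; rewrite mulrC. Qed.

Lemma itgN f : itg f -> itg (fun x => - f x).
Proof. by move=> /(itgZ (-1)); apply: eq_integrable => // x _ /=; rewrite mulN1r. Qed.

Lemma itg_norm f : itg f -> itg (fun x => `|f x|).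
Proof. exact: integrable_norm. Qed.

Lemma itg_le f g : measurable_fun setT f -> (forall x, `|f x| <= g x) -> itg g -> itg f.
Proof.
move=> mf fg; apply: le_integrable => //; first exact/measurable_EFinP.
by move=> x _ /=; rewrite lee_fin (le_trans (fg x))// ler_norm.
Qed.

Definition sqi f := measurable_fun setT f /\ itg (fun x => f x ^+ 2).

Lemma sqiM f g : sqi f -> sqi g -> itg (fun x => f x * g x).
Proof.
move=> [mf f2] [mg g2].
apply: (@itg_le _ (fun x => f x ^+ 2 + g x ^+ 2)); last exact: itgD.
  exact: measurable_funM.
move=> x; rewrite normrM -(real_normK (num_real (f x))) -(real_normK (num_real (g x))).
have := sqr_ge0 (`|f x| - `|g x|); have := mulr_ge0 (normr_ge0 (f x)) (normr_ge0 (g x)).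
by rewrite sqrrB => ? ?; lra.
Qed.

Lemma sqi_le f g : measurable_fun setT f -> (forall x, `|f x| <= g x) -> sqi g -> sqi f.
Proof.
move=> mf fg [mg g2]; split => //; apply: itg_le g2; first exact: measurable_funX.
by move=> x; rewrite normrX lerXn2r ?nnegrE// (le_trans _ (fg x)).
Qed.

Lemma sqiZ c f : sqi f -> sqi (fun x => c * f x).
Proof.
move=> [mf f2]; split; first exact: measurable_funM.
by apply: eq_integrable (itgZ (c ^+ 2) f2) => // x _ /=; rewrite exprMn.
Qed.

Lemma sqiD f g : sqi f -> sqi g -> sqi (fun x => f x + g x).
Proof.
move=> Lf Lg; split; first by apply: measurable_funD; [case: Lf|case: Lg].
have fg := sqiM Lf Lg; case: Lf Lg => [mf f2] [mg g2].
apply: eq_integrable (itgD (itgD f2 g2) (itgZ 2 fg)) => // x _ /=.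
by congr (_%:E); ring.
Qed.

Lemma sqiN f : sqi f -> sqi (fun x => - f x).
Proof. by move=> /(sqiZ (-1)) [mf f2]; split;
  [apply: eq_measurable_fun mf => x _ /=; rewrite mulN1r|apply: eq_integrable f2 => // x _ /=; rewrite mulN1r]. Qed.

Lemma sqiB f g : sqi f -> sqi g -> sqi (fun x => f x - g x).
Proof. by move=> Lf Lg; apply: sqiD => //; exact: sqiN. Qed.

Lemma RintD f g : itg f -> itg g ->
  \int[mu]_x (f x + g x) = \int[mu]_x f x + \int[mu]_x g x.
Proof. exact: RintegralD. Qed.

Lemma RintB f g : itg f -> itg g ->
  \int[mu]_x (f x - g x) = \int[mu]_x f x - \int[mu]_x g x.
Proof. exact: RintegralB. Qed.

Lemma RintZ c f : itg f -> \int[mu]_x (c * f x) = c * \int[mu]_x f x.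
Proof. exact: RintegralZl. Qed.

Lemma eq_Rint f g : f =1 g -> \int[mu]_x f x = \int[mu]_x g x.
Proof. by move=> fg; apply: eq_Rintegral => x _; exact: fg. Qed.

Lemma Rint_fin f : itg f -> (\int[mu]_x f x)%:E = (\int[mu]_x (f x)%:E)%E.
Proof. by move=> fi; rewrite /Rintegral fineK// integrable_fin_num. Qed.

Lemma Rint_dom (f_ : nat -> T -> R) (f g : T -> R) : (forall n, measurable_fun setT (f_ n)) ->
  (forall x, f_ ^~ x @ \oo --> f x) -> (forall n x, `|f_ n x| <= g x) -> itg g ->
  itg f /\ (\int[mu]_x f_ n x @[n --> \oo] --> \int[mu]_x f x).
Proof.
move=> mf_ ff fg gi.
have mf : measurable_fun setT f by apply: (measurable_fun_cvg mf_) => x _; exact: ff.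
have [||||//|fi _ H] := @dominated_convergence _ _ _ mu setT measurableT
  (fun n => EFin \o f_ n) (EFin \o f) (EFin \o g).
- by move=> n; exact/measurable_EFinP.
- exact/measurable_EFinP.
- by apply/aeW => x _; apply/fine_cvgP; split; [exact: nearW|exact: ff].
- by apply: gi.
- by apply/aeW => x n _; rewrite lee_fin.
split => //; apply: fine_cvg.
by rewrite Rint_fin.
Qed.

End square_integrable.

Section null_integral.
Context d d' {T : measurableType d} {U : measurableType d'} {R : realType}.
Variable mu : {measure set T -> \bar R}.

(** Integrability of [h] makes the sets with null integral over their preimage a Dynkin system, so
    the pi-lambda theorem applies. The factor [D] allows one coordinate to vary while the other is
    held in a fixed set. *)
Lemma dynkin_null_integral (h : T -> R) (phi : T -> U) (D : set T) (G : set (set U)) :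
  itg mu h -> measurable_fun setT phi -> measurable D ->
  @measurable _ U = <<s G >> -> setI_closed G ->
  (\int[mu]_(x in D) (h x)%:E = 0)%E ->
  (forall A, G A -> (\int[mu]_(x in phi @^-1` A `&` D) (h x)%:E = 0)%E) ->
  forall A, measurable A -> (\int[mu]_(x in phi @^-1` A `&` D) (h x)%:E = 0)%E.
Proof.
move=> hi mphi mD mG GI hD hG A mA.
pose H := [set A : set U | measurable A /\ (\int[mu]_(x in phi @^-1` A `&` D) (h x)%:E = 0)%E].
have mpre B : measurable B -> measurable (phi @^-1` B).
  by move=> mB; rewrite -[X in measurable X]setTI; exact: mphi.
have hS B : measurable B -> mu.-integrable B (EFin \o h).
  by move=> mB; apply: integrableS hi.
suff : <<s G >> `<=` H by move=> /(_ A); rewrite -mG => /(_ mA)[].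
rewrite -(setI_closed_g_dynkin_g_sigma_algebra GI); apply: smallest_sub; last first.
  move=> B GB; split; last exact: hG.
  by rewrite mG; exact: sub_sigma_algebra.
split.
- by split; [exact: measurableT|rewrite preimage_setT setTI].
- move=> B [mB hB]; split; first exact: measurableC.
  have : (\int[mu]_(x in (phi @^-1` B `&` D) `|` (phi @^-1` (~` B) `&` D)) (h x)%:E = 0)%E.
    by rewrite -setIUl -preimage_setU setUv preimage_setT setTI.
  rewrite integral_setU ?hB ?add0e//.
  + by apply: measurableI => //; exact: mpre.
  + by apply: measurableI => //; apply: mpre; exact: measurableC.
  + by apply: measurable_funTS; exact/measurable_EFinP/(itg_measurable hi).
  + apply/disj_set2P; rewrite setIACA -preimage_setI setICr preimage_set0.
    exact: set0I.
- move=> F tF HF; split; first by apply: bigcup_measurable => k _; case: (HF k).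
  rewrite preimage_bigcup setI_bigcupl integral_bigcup.
  + by apply: eseries0 => k _ _; case: (HF k).
  + move=> i j _ _ [x [[Fi _] [Fj _]]]; apply: tF => //.
    by exists (phi x).
  + by move=> k; apply: measurableI => //; apply: mpre; case: (HF k).
  + by apply: hS; apply: bigcup_measurable => k _; apply: measurableI => //; apply: mpre; case: (HF k).
Qed.
End null_integral.

(** * The fundamental lemma of the calculus of variations on the plane *)

Section fundamental_lemma.
Context {R : realType}.
Local Notation mu := (leb2 R).

Definition ocrect (a b c d : R) : set (mplane R) := `]a, b]%classic `*` `]c, d]%classic.

Lemma measurable_ocrect a b c d : measurable (ocrect a b c d).
Proof. by apply: measurableX; exact: measurable_itv. Qed.

Lemma leb2_ocrect_fin a b c d : (mu (ocrect a b c d) < +oo)%E.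
Proof.
rewrite (_ : mu _ = lebesgue_measure `]a, b]%classic * lebesgue_measure `]c, d]%classic)%E;
  last by rewrite -product_measure1E//; exact: measurable_itv.
by rewrite !lebesgue_measure_itv /=; case: ifP => _; case: ifP => _; rewrite ?mule0 ?mul0e ?ltry// -!EFinB -EFinM ltry.
Qed.

Definition loc_itg (g : mplane R -> R) :=
  forall M, mu.-integrable (ocrect (- M) M (- M) M) (EFin \o g).

(** Three Dynkin arguments: the first coordinate, the second one, then the product sigma-algebra.
    The whole line is no half-open interval, so the total integrals are computed over [J], which the
    vanishing of [g] off the square allows. *)
Lemma null_rectangles_ae0 M (g : mplane R -> R) : itg mu g ->
  (forall x, ~ ocrect (- M) M (- M) M x -> g x = 0) ->
  (forall a b c d, (\int[mu]_(x in ocrect a b c d) (g x)%:E = 0)%E) ->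
  ae_eq mu setT (EFin \o g) (cst 0%E).
Proof.
move=> gi gM g0.
have ocG : setI_closed (@ocitv R) by exact: ocitvI.
have mG : @measurable _ (measurableTypeR R) = <<s @ocitv R >> by [].
have same (D1 D2 : set (mplane R)) :
    (forall x, ocrect (- M) M (- M) M x -> D1 x = D2 x) ->
    (\int[mu]_(x in D1) (g x)%:E = \int[mu]_(x in D2) (g x)%:E)%E.
  move=> D12; rewrite integral_mkcond [RHS]integral_mkcond; apply: eq_integral => x _.
  rewrite !patchE; have [/D12 e|/gM ->] := pselect (ocrect (- M) M (- M) M x); last by rewrite !if_same.
  by rewrite (_ : (x \in D1) = (x \in D2))//; apply/idP/idP; rewrite !inE e.
pose J : set (measurableTypeR R) := `]-M, M]%classic.
have mJ : measurable J by exact: measurable_itv.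
have oJ : ocitv J by exact: is_ocitv.
have s1 (A B : set (measurableTypeR R)) : measurable A -> ocitv B ->
    (\int[mu]_(x in A `*` B) (g x)%:E = 0)%E.
  move=> mA oB.
  have mB : measurable B by rewrite mG; exact: sub_sigma_algebra.
  rewrite (_ : A `*` B = fst @^-1` A `&` (setT `*` B)); last first.
    by apply/seteqP; split => x /= []; [move=> ? ?|move=> ? [_ ?]]; split.
  apply: (dynkin_null_integral gi _ _ mG ocG) => //.
  - exact: measurableX.
  - rewrite (@same _ (J `*` B)); last by move=> x [xJ _]; apply/propext; split => -[_ ?].
    by case: oB => -[c d] _ <-; exact: g0.
  - move=> _ [[a b] _ <-]; case: oB => -[c d] _ <-.
    rewrite (_ : _ `&` _ = ocrect a b c d) ?g0//.
    by apply/seteqP; split => x /= []; [move=> ? [_ ?]|move=> ? ?]; split.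
have s2 (A B : set (measurableTypeR R)) : measurable A -> measurable B ->
    (\int[mu]_(x in A `*` B) (g x)%:E = 0)%E.
  move=> mA mB.
  rewrite (_ : A `*` B = snd @^-1` B `&` (A `*` setT)); last first.
    by apply/seteqP; split => x /= []; [move=> ? ?|move=> ? [? _]]; split.
  apply: (dynkin_null_integral gi _ _ mG ocG) => //.
  - exact: measurableX.
  - rewrite (@same _ (A `*` J)); last by move=> x [_ xJ]; apply/propext; split => -[? _].
    exact: s1.
  - move=> C oC; rewrite (_ : _ `&` _ = A `*` C) ?s1//.
    by apply/seteqP; split => x /= []; [move=> ? [? _]|move=> ? ?]; split.
apply: integral_ae_eq => //.
move=> E _ mE; rewrite integral_cst// mul0e.
rewrite -[E]setIT; apply: (@dynkin_null_integral _ _ _ (mplane R) _ _ _ id _ _ gi _ _ (@measurable_prod_measurableType _ _ _ _)) => //.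
- move=> _ _ [A mA [B mB <-]] [C mC [D mD <-]]; rewrite -setXI.
  by exists (A `&` C); [exact: measurableI|exists (B `&` D) => //; exact: measurableI].
- rewrite (@same _ (J `*` J)) ?s2//.
  by move=> x Jx; apply/propext.
- by move=> _ [A mA [B mB <-]]; rewrite preimage_id setIT s2.
Qed.

Lemma loc_itg_indic (g : mplane R -> R) a b c d : loc_itg g ->
  itg mu (fun x => g x * \1_(ocrect a b c d) x).
Proof.
move=> lg; pose M := `|a| + `|b| + `|c| + `|d|.
have h : ocrect a b c d `<=` ocrect (- M) M (- M) M.
  move=> x [] /=; rewrite !in_itv /= => /andP[h1 h2] /andP[h3 h4].
  have := ler_norm (- a); have := ler_norm b; have := ler_norm (- c); have := ler_norm d.
  have := normr_ge0 a; have := normr_ge0 b; have := normr_ge0 c; have := normr_ge0 d.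
  rewrite !normrN /M => *; split; rewrite /= in_itv /=; apply/andP; split; lra.
have := integrableS (measurable_ocrect _ _ _ _) (measurable_ocrect _ _ _ _) h (lg M).
move/(integrable_mkcond _ (measurable_ocrect a b c d)).
apply: eq_integrable => // x _ /=; rewrite patchE indicE.
by case: ifP => _; rewrite ?mulr1 ?mulr0.
Qed.

Lemma measurable_tens (h k : R -> R) : measurable_fun setT h -> measurable_fun setT k ->
  measurable_fun [set: mplane R] (tens h k).
Proof.
by move=> mh mk; apply: measurable_funM;
   [exact: (measurableT_comp mh measurable_fst)|exact: (measurableT_comp mk measurable_snd)].
Qed.

Lemma test_orthogonal_ae0 (g : mplane R -> R) : measurable_fun setT g -> loc_itg g ->
  (forall f, test_function f -> \int[mu]_x (g x * f x) = 0) ->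
  ae_eq mu setT (EFin \o g) (cst 0%E).
Proof.
move=> mg lg g0.
have rect0 a b c d : (\int[mu]_(x in ocrect a b c d) (g x)%:E = 0)%E.
  pose f n := tens (ocbump a b n) (ocbump c d n).
  pose M := `|a| + `|b| + 1 + (`|c| + `|d| + 1).
  (* The cutoffs overshoot the right end points by at most [n.+1%:R^-1], so the rectangle enlarged
     by 1 dominates all of them. *)
  have fM n x : ~ ocrect a (b + 1) c (d + 1) x -> f n x = 0.
    move=> nx; rewrite /f /tens; have n1 : n.+1%:R^-1 <= 1 :> R by rewrite invf_le1 ?ltr0n// ler1n.
    have [xa|ax] := leP x.1 a; first by rewrite ocbump_le// mul0r.
    have [xb|bx] := leP (b + 1) x.1; first by rewrite ocbump_ge ?mul0r// (le_trans _ xb)// lerD2l.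
    have [xc|cx] := leP x.2 c; first by rewrite [X in _ * X]ocbump_le// mulr0.
    have [xd|dx] := leP (d + 1) x.2; first by rewrite [X in _ * X]ocbump_ge ?mulr0// (le_trans _ xd)// lerD2l.
    by exfalso; apply: nx; split; rewrite /= in_itv /= ?ax ?cx ltW.
  have f01 n x : 0 <= f n x <= 1.
    have /andP[h0 h1] := ocbump_itv01 a b n x.1.
    have /andP[k0 k1] := ocbump_itv01 c d n x.2.
    by rewrite /f /tens mulr_ge0 //= mulr_ile1.
  have mf n : measurable_fun [set: mplane R] (f n).
    by apply: measurable_tens; apply: continuous_measurable_fun; apply: smooth_continuous; exact: smooth_ocbump.
  have [||||fi] := @Rint_dom _ _ _ mu (fun n x => g x * f n x) (fun x => g x * \1_(ocrect a b c d) x)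
     (fun x => `|g x * \1_(ocrect a (b + 1) c (d + 1)) x|).
  - by move=> n; exact: measurable_funM.
  - move=> x; apply: cvgM; first exact: cvg_cst.
    rewrite (_ : \1_(ocrect a b c d) x = \1_(`]a, b]%classic) x.1 * \1_(`]c, d]%classic) x.2 :> R).
      by apply: cvgM; exact: ocbump_cvg.
    by rewrite !indicE in_setX /=; case: (_ \in _); case: (_ \in _); rewrite /= ?mulr1 ?mulr0.
  - move=> n x; rewrite indicE; case: (boolP (x \in _)); last first.
      by move/negP => nx; rewrite fM ?mulr0// => xr; apply: nx; rewrite inE.
    move=> _; rewrite mulr1 normrM ler_piMr//.
    by have /andP[? ?] := f01 n x; rewrite ger0_norm.
  - exact/itg_norm/loc_itg_indic.
  have -> : (fun n => \int[mu]_x (g x * f n x)) = cst 0.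
    apply/funext => n; apply: g0; apply: (@test_tens _ M); try exact: smooth_ocbump.
      by move=> x Mx; apply: (@bsupp_ocbump _ a b n); apply: le_lt_trans Mx; rewrite /M lerDl ?addr_ge0.
    by move=> x Mx; apply: (@bsupp_ocbump _ c d n); apply: le_lt_trans Mx; rewrite /M lerDr ?addr_ge0.
  move=> H; have {H} := cvg_unique _ (cvg_cst (0 : R)) H => /(_ (@norm_hausdorff _ _)) H.
  transitivity (\int[mu]_x (g x * \1_(ocrect a b c d) x)%:E)%E; last by rewrite -Rint_fin// -H.
  rewrite integral_mkcond; apply: eq_integral => x _; rewrite patchE indicE.
  by case: ifP => _ /=; rewrite ?mulr1 ?mulr0.
(* A globally integrable function is required next, so [g] is cut off to squares of integer size,
   which exhaust the plane. *)
have : forall n : nat, ae_eq mu setT (EFin \o (fun x => g x * \1_(ocrect (- n%:R) n%:R (- n%:R) n%:R) x)) (cst 0%E).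
  move=> n; apply: (@null_rectangles_ae0 n%:R).
  - exact: loc_itg_indic.
  - by move=> x nx; rewrite indicE memNset ?mulr0.
  - move=> a b c d.
    (* A rectangle meets the square in another rectangle, whose end points are these maxima and
       minima. *)
    set N : R := n%:R; rewrite -[RHS](rect0 (Num.max a (- N)) (Num.min b N) (Num.max c (- N)) (Num.min d N)).
    rewrite integral_mkcond [RHS]integral_mkcond; apply: eq_integral => x _; rewrite !patchE indicE.
    rewrite /ocrect !in_setX !mem_setE !in_itv /= !gt_max !le_min.
    case: (a < x.1); case: (x.1 <= b); case: (c < x.2); case: (x.2 <= d);
    case: (- N < x.1); case: (x.1 <= N); case: (- N < x.2); case: (x.2 <= N) => /=;
    by rewrite ?mulr1 ?mulr0.
move/ae_foralln; apply: filterS => x H _.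
have := H (Num.trunc `|x|).+1 I; rewrite /= indicE mem_set ?mulr1//.
have := truncnS_gt `|x|; set n := _%:R; rewrite prod_normE gt_max !ltr_norml.
by move=> /andP[/andP[? ?] /andP[? ?]]; split; rewrite /= in_itv /=; apply/andP; split => //; exact: ltW.
Qed.
End fundamental_lemma.

Section plane_functions.
Context {R : realType}.
Local Notation mu := (leb2 R).

(** [mplane] carries the product sigma-algebra, not the one generated by the plane topology. An open
    set is the union of the countably many squares with rational centre and half-side [n.+1%:R^-1]
    that it contains. *)
Lemma open_measurable_plane (O : set (R * R)) : open O -> measurable (O : set (mplane R)).
Proof.
move=> oO.
pose r (n : nat) : R := n.+1%:R^-1.
pose S (q : rat * rat) (n : nat) : set (mplane R) :=
  `]ratr q.1 - r n, ratr q.1 + r n[%classic `*`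
  `]ratr q.2 - r n, ratr q.2 + r n[%classic.
pose S' q n : set (mplane R) := if `[< S q n `<=` O >] then S q n else set0.
have -> : O = \bigcup_p \bigcup_q \bigcup_n S' (p, q) n.
  apply/seteqP; split => [x Ox|x [p _ [q _ [n _]]]]; last first.
    by rewrite /S'; case: asboolP => // H /H.
  have /nbhs_ballP[e /= e0 He] : nbhs x O by exact: open_nbhs_nbhs.
  have [n _ Hn] := near_infty_natSinv_lt (PosNum (divr_gt0 e0 (ltr0n _ 2))).
  have {}Hn : r n < e / 2 by have := Hn n (leqnn n).
  have i0 : 0 < r n by rewrite /r invr_gt0 ltr0n.
  have hS (t : rat) (y : R) : ratr t \in `]y - r n, y + r n[ ->
      ratr t - r n < y < ratr t + r n.
    by rewrite in_itv /= => /andP[h1 h2]; apply/andP; split; lra.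
  have lt (y : R) : y - r n < y + r n by rewrite ltrD2l gtrN.
  have [p hp] := rat_in_itvoo (lt x.1); have [q hq] := rat_in_itvoo (lt x.2).
  exists p => //; exists q => //; exists n => //; rewrite /S' asboolT.
    by split; rewrite /= in_itv /=; exact: hS.
  move=> y [/= + +]; move: hp hq; rewrite !in_itv /= => /andP[? ?] /andP[? ?] /andP[? ?] /andP[? ?].
  apply: He; rewrite -ball_normE /ball_ /= prod_normE gt_max !ltr_norml /=.
  by apply/andP; split; apply/andP; split; move: Hn; rewrite ltr_pdivlMr//; lra.
apply: bigcupT_measurable_rat => p; apply: bigcupT_measurable_rat => q.
apply: bigcupT_measurable => n; rewrite /S'; case: ifP => _; last exact: measurable0.
by apply: measurableX; exact: measurable_itv.
Qed.

Lemma continuous_measurable_plane (f : R * R -> R) : continuous f ->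
  measurable_fun [set: mplane R] f.
Proof.
move=> /continuousP cf; apply: (measurability _ (RGenOpens.measurableE R)).
move=> _ [_ [a [b ->]] <-]; rewrite setTI; apply: open_measurable_plane.
by apply: cf; exact: interval_open.
Qed.

End plane_functions.

Section test_integrability.
Context {R : realType}.
Local Notation mu := (leb2 R).
Implicit Types (f : R * R -> R) (g : mplane R -> R).

Lemma sqi_indic (A : set (mplane R)) : measurable A -> (mu A < +oo)%E ->
  sqi mu (\1_A : mplane R -> R).
Proof.
move=> mA Afin; split; first exact: measurable_indic.
have : itg mu (\1_A : mplane R -> R).
  apply/itgP; split; first exact: measurable_indic.
  under eq_integral do rewrite ger0_norm//.
  by rewrite integral_indic// setIT.
apply: eq_integrable => // x _ /=; rewrite indicE.
by case: (_ \in _); rewrite ?expr1n ?expr0n.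
Qed.

Lemma sqi_loc_itg g : sqi mu g -> loc_itg g.
Proof.
move=> Lg M; have mr := measurable_ocrect (- M) M (- M) M.
have := sqiM Lg (sqi_indic mr (leb2_ocrect_fin _ _ _ _)).
move=> H; apply/integrable_mkcond => //; apply: eq_integrable H => // x _ /=.
by rewrite patchE indicE; case: ifP => _; rewrite ?mulr1 ?mulr0.
Qed.

Lemma test_measurable f : test_function f -> measurable_fun [set: mplane R] f.
Proof. by move=> tf; apply: continuous_measurable_plane; exact: test_continuous. Qed.

Lemma test_sqi f : test_function f -> sqi mu f.
Proof.
move=> tf; have [B B0 HB] := test_bounded tf; have [M M0 HM] := test_bsupp tf.
(* [M + 1] rather than [M], because the half-open square of half-side [M] misses points with a
   coordinate [- M]. *)
apply: (@sqi_le _ _ _ _ _ (fun x => B * \1_(ocrect (- (M + 1)) (M + 1) (- (M + 1)) (M + 1)) x)).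
- exact: test_measurable.
- move=> x; rewrite indicE; have [Mx|xM] := ltP M `|x|.
    by rewrite HM// normr0 mulr_ge0// ltW.
  rewrite mem_set ?mulr1//.
  move: xM; rewrite prod_normE ge_max !ler_norml => /andP[/andP[? ?] /andP[? ?]].
  by split; rewrite /= in_itv /=; apply/andP; split; lra.
- apply: sqiZ; apply: sqi_indic; [exact: measurable_ocrect|exact: leb2_ocrect_fin].
Qed.

Lemma sqi_test_orthogonal_ae0 g : sqi mu g ->
  (forall f, test_function f -> \int[mu]_x (g x * f x) = 0) ->
  ae_eq mu setT (EFin \o g) (cst 0%E).
Proof.
by move=> Lg; apply: test_orthogonal_ae0; [case: Lg|exact: sqi_loc_itg].
Qed.

End test_integrability.

Section Lp_complex.
Context {R : realType}.
Local Notation mu := (leb2 R).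
Implicit Types u v : R * R -> R[i].

Definition reu u : mplane R -> R := fun x => complex.Re (u x).
Definition imu u : mplane R -> R := fun x => complex.Im (u x).

Lemma modulus_ge0 u x : 0 <= modulus u x.
Proof. by rewrite /modulus; case: (u x) => a b /=; rewrite sqrtr_ge0. Qed.

Lemma modulus_sqr u x : modulus u x ^+ 2 = reu u x ^+ 2 + imu u x ^+ 2.
Proof.
rewrite /modulus /reu /imu; case: (u x) => a b /=.
by rewrite sqr_sqrtr// addr_ge0// sqr_ge0.
Qed.

Lemma integral_modulusX (n : nat) u : (0 < n)%N ->
  ('N[mu]_(n%:R%:E)[EFin \o modulus u] `^ n%:R = \int[mu]_x (modulus u x ^+ n)%:E)%E.
Proof.
move=> n0.
have nn0 : (n%:R : R) != 0 by rewrite pnatr_eq0 -lt0n.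
rewrite (poweR_Lnorm mu (EFin \o modulus u) nn0).
apply: eq_integral => x _ /=; rewrite ger0_norm ?modulus_ge0//.
by rewrite powR_mulrn ?modulus_ge0.
Qed.

(** Holds without integrability: when the norm is infinite, [fine] makes both sides 0. *)
Lemma lp_normX (n : nat) u : (0 < n)%N ->
  lp_norm n%:R u ^+ n = \int[mu]_x (modulus u x ^+ n).
Proof.
move=> n0.
have nn0 : (n%:R : R) != 0 by rewrite pnatr_eq0 -lt0n.
rewrite /lp_norm /Rintegral -(integral_modulusX _ n0).
have := Lnorm_ge0 mu n%:R%:E (EFin \o modulus u).
case: (Lnorm _ _ _) => [r|_|//] /=; first by rewrite lee_fin => r0; rewrite powR_mulrn.
by rewrite (negbTE nn0) -[n]prednK// exprS mul0r.
Qed.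

Lemma lp_norm2 u : lp_norm 2 u ^+ 2 = \int[mu]_x (modulus u x ^+ 2).
Proof. exact: (@lp_normX 2). Qed.

Lemma lp_norm4 u : lp_norm 4 u ^+ 4 = \int[mu]_x (modulus u x ^+ 4).
Proof. exact: (@lp_normX 4). Qed.

Lemma Lp2P u : Lp 2 u <-> sqi mu (reu u) /\ sqi mu (imu u).
Proof.
have fin : finite_norm mu 2%:E (modulus u) <-> (\int[mu]_x (modulus u x ^+ 2)%:E < +oo)%E.
  have := @integral_modulusX 2 u isT; rewrite /finite_norm => <-.
  split; first exact: poweR_lty.
  by apply: lty_poweRy; rewrite pnatr_eq0.
have abs2 (a : R) : `|a ^+ 2| = a ^+ 2 by rewrite ger0_norm// sqr_ge0.
split=> [[mr mi /fin ufin]|[[mr ir] [mi ii]]].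
  have iu : itg mu (fun x => modulus u x ^+ 2).
    apply/itgP; split; last by under eq_integral do rewrite abs2.
    apply: (eq_measurable_fun (fun x => reu u x ^+ 2 + imu u x ^+ 2)).
      by move=> x _; rewrite modulus_sqr.
    by apply: measurable_funD; exact: measurable_funX.
  split; split => //; apply: (itg_le _ _ iu); try exact: measurable_funX.
    by move=> x; rewrite abs2 modulus_sqr lerDl sqr_ge0.
  by move=> x; rewrite abs2 modulus_sqr lerDr sqr_ge0.
split=> //; apply/fin.
have /itgP[_] : itg mu (fun x => modulus u x ^+ 2).
  by apply: eq_integrable (itgD ir ii) => // x _ /=; rewrite modulus_sqr.
by under eq_integral do rewrite abs2.
Qed.

Lemma Lp2_itg u : Lp 2 u -> itg mu (fun x => modulus u x ^+ 2).
Proof.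
move=> /Lp2P[[_ ir] [_ ii]].
by apply: eq_integrable (itgD ir ii) => // x _ /=; rewrite modulus_sqr.
Qed.

End Lp_complex.
Lemma ae_plane_imp (R : realType) (P Q : R * R -> Prop) :
  (forall x, P x -> Q x) ->
  (\forall x \ae leb2 R, P x) -> \forall x \ae leb2 R, Q x.
Proof. exact: (@filterS _ _ (ae_filter_ringOfSetsType (leb2 R))). Qed.

Lemma ae_plane_imp2 (R : realType) (P Q S : R * R -> Prop) :
  (forall x, P x -> Q x -> S x) ->
  (\forall x \ae leb2 R, P x) -> (\forall x \ae leb2 R, Q x) ->
  \forall x \ae leb2 R, S x.
Proof. exact: (@filterS2 _ _ (ae_filter_ringOfSetsType (leb2 R))). Qed.

Section Lp_complex2.
Context {R : realType}.
Local Notation mu := (leb2 R).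
Implicit Types u v : R * R -> R[i].

Lemma ae0P u : ae0 u <-> \forall x \ae mu, u x = 0.
Proof. by split; apply: ae_plane_imp => x //; apply. Qed.

Lemma ae0_parts u : ae0 u <->
  (\forall x \ae mu, reu u x = 0) /\ (\forall x \ae mu, imu u x = 0).
Proof.
split=> [/ae0P u0|[ur ui]].
  by split; apply: ae_plane_imp u0 => x; rewrite ?/reu ?/imu => ->.
apply/ae0P; apply: ae_plane_imp2 ur ui => x; rewrite /reu /imu.
by case: (u x) => a b /= -> ->.
Qed.

Lemma Lp2_measurable_modulusX2 u : Lp 2 u ->
  measurable_fun setT (fun x : mplane R => modulus u x ^+ 2).
Proof. by move=> /Lp2_itg /itg_measurable. Qed.

Lemma modulus_eq0 u x : modulus u x = 0 <-> u x = 0.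
Proof.
split; first exact: ComplexField.Normc.eq0_normc.
by rewrite /modulus => ->; rewrite ComplexField.Normc.normc0.
Qed.

Lemma integral_ae0 (f : mplane R -> R) : (\forall x \ae mu, f x = 0) ->
  measurable_fun setT f -> \int[mu]_x f x = 0.
Proof.
move=> f0 mf; rewrite /Rintegral (ae_eq_integral (cst 0%E)) ?integral0//.
  exact/measurable_EFinP.
by apply: ae_plane_imp f0 => x /= ->.
Qed.

Lemma nneg_integral_eq0 (f : mplane R -> R) : (forall x, 0 <= f x) -> itg mu f ->
  \int[mu]_x f x = 0 -> \forall x \ae mu, f x = 0.
Proof.
move=> f0 fi If.
have : (\int[mu]_x `|(f x)%:E| = 0)%E.
  under eq_integral do rewrite gee0_abs ?lee_fin//.
  by rewrite -Rint_fin// If.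
move/ae_eq_integral_abs => H; have {}H := H measurableT (measurable_int _ fi).
by apply: ae_plane_imp H => x /(_ I)[].
Qed.

Lemma lp_norm2_eq0 u : Lp 2 u -> lp_norm 2 u ^+ 2 = 0 -> ae0 u.
Proof.
move=> Lu; rewrite lp_norm2 => u0; apply/ae0P.
apply: ae_plane_imp (nneg_integral_eq0 _ (Lp2_itg Lu) u0).
  by move=> x /eqP; rewrite expf_eq0 /= => /eqP; exact: (modulus_eq0 u x).1.
by move=> x; exact: sqr_ge0.
Qed.

Lemma ae0_modulus4 u : Lp 2 u -> ae0 u -> \int[mu]_x (modulus u x ^+ 4) = 0.
Proof.
move=> Lu /ae0P u0; apply: integral_ae0.
  by apply: ae_plane_imp u0 => x /modulus_eq0 ->; rewrite expr0n.
rewrite (_ : (fun x => _) = (fun x => (modulus u x ^+ 2) ^+ 2)).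
  by apply: measurable_funX; exact: Lp2_measurable_modulusX2.
by apply/funext => x; rewrite -exprM.
Qed.

Lemma ae0_lp_norm4 u : Lp 2 u -> ae0 u -> lp_norm 4 u ^+ 4 = 0.
Proof. by move=> Lu u0; rewrite lp_norm4 ae0_modulus4. Qed.

Lemma ae0_lp_norm2 u : Lp 2 u -> ae0 u -> lp_norm 2 u ^+ 2 = 0.
Proof.
move=> Lu /ae0P u0; rewrite lp_norm2; apply: integral_ae0.
  by apply: ae_plane_imp u0 => x /modulus_eq0 ->; rewrite expr0n.
exact: Lp2_measurable_modulusX2.
Qed.

End Lp_complex2.

(** * Weak derivatives *)

Section weak_derivatives.
Context {R : realType}.
Local Notation mu := (leb2 R).
Implicit Types (u v g : R * R -> R[i]) (a b : mplane R -> R).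

Definition rweak i a b := forall f, test_function f ->
  \int[mu]_x (a x * partial_derivative i f x) = - \int[mu]_x (b x * f x).

Definition rH1 a := sqi mu a /\ forall i, exists2 b, sqi mu b & rweak i a b.

Lemma weakP i u g : weak_derivative i u g <->
  rweak i (reu u) (reu g) /\ rweak i (imu u) (imu g).
Proof.
have reM (w : R * R -> R[i]) (f : R * R -> R) :
    \int[mu]_x complex.Re (w x * (f x)%:C%C) = \int[mu]_x (reu w x * f x).
  by apply: eq_Rint => x; rewrite /reu; case: (w x) => p q /=; rewrite mulr0 subr0.
have imM (w : R * R -> R[i]) (f : R * R -> R) :
    \int[mu]_x complex.Im (w x * (f x)%:C%C) = \int[mu]_x (imu w x * f x).
  by apply: eq_Rint => x; rewrite /imu; case: (w x) => p q /=; rewrite mulr0 add0r.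
split=> [H|[Hr Hi]].
  by split=> f /H; rewrite /cintegral => -[]; rewrite reM imM reM imM.
by move=> f tf; rewrite /cintegral reM imM reM imM Hr// Hi.
Qed.

Lemma H1P u : H1 u <-> rH1 (reu u) /\ rH1 (imu u).
Proof.
split=> [[/Lp2P[Lr Li] H]|[[Lr Hr] [Li Hi]]].
  by split; split=> // i; have [g /Lp2P[gr gi] /weakP[wr wi]] := H i; [exists (reu g)|exists (imu g)].
split; first exact/Lp2P.
move=> i; have [b Lb wb] := Hr i; have [c Lc wc] := Hi i.
by exists (fun x => (b x +i* c x)%C); [exact/Lp2P|exact/weakP].
Qed.

Lemma itg_test a f : sqi mu a -> test_function f -> itg mu (fun x => a x * f x).
Proof. by move=> La tf; apply: sqiM => //; exact: test_sqi. Qed.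

Lemma rweakD i a b a' b' : sqi mu a -> sqi mu b -> sqi mu a' -> sqi mu b' ->
  rweak i a b -> rweak i a' b' -> rweak i (fun x => a x + a' x) (fun x => b x + b' x).
Proof.
move=> La Lb La' Lb' w w' f tf; have tdf := test_partial i tf.
have -> : \int[mu]_x ((a x + a' x) * partial_derivative i f x) =
   \int[mu]_x (a x * partial_derivative i f x + a' x * partial_derivative i f x).
  by apply: eq_Rint => x; rewrite mulrDl.
have -> : \int[mu]_x ((b x + b' x) * f x) = \int[mu]_x (b x * f x + b' x * f x).
  by apply: eq_Rint => x; rewrite mulrDl.
by rewrite !RintD ?w// ?w'// ?opprD//; exact: itg_test.
Qed.

Lemma rweakZ i (c : R) a b : sqi mu a -> sqi mu b ->
  rweak i a b -> rweak i (fun x => c * a x) (fun x => c * b x).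
Proof.
move=> La Lb w f tf; have tdf := test_partial i tf.
have -> : \int[mu]_x ((c * a x) * partial_derivative i f x) =
   \int[mu]_x (c * (a x * partial_derivative i f x)).
  by apply: eq_Rint => x; rewrite mulrA.
have -> : \int[mu]_x ((c * b x) * f x) = \int[mu]_x (c * (b x * f x)).
  by apply: eq_Rint => x; rewrite mulrA.
by rewrite !RintZ ?w ?mulrN//; exact: itg_test.
Qed.

Lemma rweak_unique i a b b' : sqi mu b -> sqi mu b' -> rweak i a b -> rweak i a b' ->
  \forall x \ae mu, b x = b' x.
Proof.
move=> Lb Lb' w w'.
have : ae_eq mu setT (EFin \o (fun x => b x - b' x)) (cst 0%E).
  apply: sqi_test_orthogonal_ae0; first exact: sqiB.
  move=> f tf; have : \int[mu]_x (b x * f x - b' x * f x) = 0.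
    rewrite RintB; [|exact: itg_test|exact: itg_test].
    by apply/eqP; rewrite subr_eq0 -eqr_opp -w// -w'.
  by move=> <-; apply: eq_Rint => x; rewrite mulrBl.
by apply: ae_plane_imp => x /(_ I)[/eqP]; rewrite subr_eq0 => /eqP.
Qed.

Lemma rweak_ae i a a' b : sqi mu a -> sqi mu a' -> (\forall x \ae mu, a x = a' x) ->
  rweak i a b -> rweak i a' b.
Proof.
move=> La La' aa' w f tf; rewrite -w//; apply/eqP; rewrite -subr_eq0; apply/eqP.
have tdf := test_partial i tf.
rewrite -RintB; [|exact: itg_test|exact: itg_test].
apply: integral_ae0; first by apply: ae_plane_imp aa' => x ->; rewrite subrr.
by apply: itg_measurable; apply: itgB; exact: itg_test.
Qed.

Lemma rH1D a a' : rH1 a -> rH1 a' -> rH1 (fun x => a x + a' x).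
Proof.
move=> [La Ha] [La' Ha']; split; first exact: sqiD.
move=> i; have [b Lb wb] := Ha i; have [b' Lb' wb'] := Ha' i.
by exists (fun x => b x + b' x); [exact: sqiD|exact: rweakD].
Qed.

Lemma rH1Z c a : rH1 a -> rH1 (fun x => c * a x).
Proof.
move=> [La Ha]; split; first exact: sqiZ.
move=> i; have [b Lb wb] := Ha i.
by exists (fun x => c * b x); [exact: sqiZ|exact: rweakZ].
Qed.

Lemma rH1B a a' : rH1 a -> rH1 a' -> rH1 (fun x => a x - a' x).
Proof.
move=> Ha /(rH1Z (-1)) Ha'.
rewrite (_ : (fun x => _) = (fun x => a x + -1 * a' x)); first exact: rH1D.
by apply/funext => x; rewrite mulN1r.
Qed.

Lemma sqi_ae0 a : measurable_fun setT a -> (\forall x \ae mu, a x = 0) -> sqi mu a.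
Proof.
move=> ma a0; split => //; apply/itgP; split; first exact: measurable_funX.
rewrite (ae_eq_integral (cst 0%E)) ?integral0//.
  apply/measurable_EFinP; apply: measurableT_comp => //; exact: measurable_funX.
by apply: ae_plane_imp a0 => x /= -> _; rewrite expr0n normr0.
Qed.

Lemma sqi0 : sqi mu (cst 0).
Proof. by apply: sqi_ae0 => //; apply: (ae_plane_imp _ (aeW _ _)) => [x H|x]; [exact: H|]. Qed.

Lemma rweak0 i : rweak i (cst 0) (cst 0).
Proof.
by move=> f _; rewrite !(eq_Rint _ (g := cst 0)) ?Rintegral_cst// ?mul0r ?oppr0// => x; rewrite mul0r.
Qed.

Lemma rH1_ae0 a : measurable_fun setT a -> (\forall x \ae mu, a x = 0) -> rH1 a.
Proof.
move=> ma a0; have La := sqi_ae0 ma a0; split => // i.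
exists (cst 0); first exact: sqi0.
apply: rweak_ae (rweak0 i) => //; first exact: sqi0.
by apply: ae_plane_imp a0 => x ->.
Qed.

End weak_derivatives.

(** * Lebesgue measure under dilations and translations *)

Section affine_change.
Context {R : realType}.
Local Notation lambda := (@lebesgue_measure R).
Local Notation mu := (leb2 R).

Definition aff1 (s y : R) (x : measurableTypeR R) : measurableTypeR R := s * x + y.
Definition aff2 (s : R) (y : R * R) (x : mplane R) : mplane R :=
  (s * x.1 + y.1, s * x.2 + y.2).

Lemma measurable_aff1 s y : measurable_fun setT (aff1 s y).
Proof. by apply: measurable_funD => //; apply: measurable_funM. Qed.

Lemma measurable_aff2 s y : measurable_fun setT (aff2 s y).
Proof.
by apply: measurable_fun_pair; apply: measurableT_comp (measurable_aff1 _ _) _.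
Qed.

Lemma preimage_measurable d d' (T : measurableType d) (U : measurableType d') (phi : T -> U) A :
  measurable_fun setT phi -> measurable A -> measurable (phi @^-1` A).
Proof. by move=> mphi mA; rewrite -[X in measurable X]setTI; exact: mphi. Qed.

(** The pushforward under [aff1], multiplied by [s], agrees with Lebesgue measure on half-open
    intervals, and these determine the measure. [leb2_aff2] repeats the argument with products of
    measurable sets. *)
Lemma lebesgue_aff1 s y (A : set (measurableTypeR R)) : 0 < s -> measurable A ->
  (lambda A = s%:E * lambda (aff1 s y @^-1` A))%E.
Proof.
move=> s0 mA.
have s0' : 0 <= s by exact: ltW.
pose m1 := measure_function_pushforward__canonical__measure_function_Measure lambda (measurable_aff1 s y).
pose m2 : {measure set _ -> \bar R} := mscale (NngNum s0') m1.
apply: (@lebesgue_measure_unique _ m2) => // _ [[a b] _ <-].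
rewrite /m2 /= /mscale /= /pushforward.
have -> : aff1 s y @^-1` `]a, b]%classic = `](a - y) / s, (b - y) / s]%classic.
  apply/seteqP; split => x /=; rewrite !in_itv /= /aff1 ltr_pdivrMr// ler_pdivlMr//;
  by rewrite ltrBlDr lerBrDr mulrC.
rewrite !lebesgue_measure_itv /= !lte_fin ltr_pM2r ?invr_gt0// ltrD2r.
case: ifP => _; rewrite ?mule0// -!EFinB -EFinM; congr (_%:E).
by field; rewrite gt_eqF.
Qed.

Lemma leb2_aff2 s y (A : set (mplane R)) : 0 < s -> measurable A ->
  (mu A = (s ^+ 2)%:E * mu (aff2 s y @^-1` A))%E.
Proof.
move=> s0 mA.
have s0' : 0 <= s ^+ 2 by exact: sqr_ge0.
pose m1 := measure_function_pushforward__canonical__measure_function_Measure mu (measurable_aff2 s y).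
pose m2 : {measure set _ -> \bar R} := mscale (NngNum s0') m1.
apply: (@product_measure_unique _ _ _ _ _ lambda lambda m2) => // B C mB mC.
rewrite /m2 /= /mscale /= /pushforward.
have -> : aff2 s y @^-1` (B `*` C) = (aff1 s y.1 @^-1` B) `*` (aff1 s y.2 @^-1` C) by [].
rewrite (_ : mu _ = lambda (aff1 s y.1 @^-1` B) * lambda (aff1 s y.2 @^-1` C))%E; last first.
  by rewrite -product_measure1E//; apply: preimage_measurable => //; exact: measurable_aff1.
rewrite (lebesgue_aff1 y.1 s0 mB) (lebesgue_aff1 y.2 s0 mC).
by rewrite muleACA -EFinM -expr2.
Qed.

Lemma ge0_integral_aff2 s y (f : mplane R -> \bar R) : 0 < s ->
  measurable_fun setT f -> (forall x, 0 <= f x)%E ->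
  (\int[mu]_x f x = (s ^+ 2)%:E * \int[mu]_x f (aff2 s y x))%E.
Proof.
move=> s0 mf f0.
have s0' : 0 <= s ^+ 2 by exact: sqr_ge0.
pose m1 := measure_function_pushforward__canonical__measure_function_Measure mu (measurable_aff2 s y).
have := @ge0_integral_pushforward _ _ _ _ _ _ (measurable_aff2 s y) mu setT f measurableT mf (fun x _ => f0 x).
rewrite preimage_setT /comp => <-.
rewrite -(@ge0_integral_mscale _ _ _ m1 _ measurableT (NngNum s0')) //.
by apply: eq_measure_integral => A mA _; exact: leb2_aff2.
Qed.

Lemma itg_aff2 s y (f : mplane R -> R) : 0 < s -> itg mu f -> itg mu (fun x => f (aff2 s y x)).
Proof.
move=> s0 /itgP[mf fi]; apply/itgP; split.
  exact: (measurableT_comp mf (measurable_aff2 s y)).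
move: fi; rewrite (ge0_integral_aff2 y s0 _ _)//; last first.
  by apply/measurable_EFinP; exact: measurableT_comp.
have s20 : 0 < s ^+ 2 by rewrite exprn_gt0.
have lty_mul (z : \bar R) : (0 <= z -> (s ^+ 2)%:E * z < +oo -> z < +oo)%E.
  by case: z => [r||]//; rewrite ?ltry// gt0_muley ?lte_fin.
by apply: lty_mul; apply: integral_ge0 => x _; rewrite lee_fin.
Qed.

Lemma Rint_aff2 s y (f : mplane R -> R) : 0 < s -> itg mu f ->
  \int[mu]_x f x = s ^+ 2 * \int[mu]_x f (aff2 s y x).
Proof.
move=> s0.
have nn (g : mplane R -> R) : (forall x, 0 <= g x) -> itg mu g ->
    \int[mu]_x g x = s ^+ 2 * \int[mu]_x g (aff2 s y x).
  move=> g0 gi; apply: EFin_inj; rewrite EFinM (Rint_fin gi) (Rint_fin (itg_aff2 y s0 gi)).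
  rewrite (ge0_integral_aff2 y s0)//.
  exact: measurable_int gi.
(* Writing [f] as [|f| - g] with both terms nonnegative reduces the claim to [nn]. *)
move=> fi; pose g x := `|f x| - f x.
have gi : itg mu g by apply: itgB => //; exact: itg_norm.
have -> : \int[mu]_x f x = \int[mu]_x (`|f x| - g x).
  by apply: eq_Rint => x; rewrite /g subKr.
rewrite RintB//; last exact: itg_norm.
rewrite nn//; last exact: itg_norm.
rewrite (nn g)//; last by move=> x; rewrite subr_ge0 ler_norm.
rewrite -mulrBr -RintB; [|exact: (itg_aff2 y s0 (itg_norm fi))|exact: itg_aff2].
by congr (_ * _); apply: eq_Rint => x; rewrite /g subKr.
Qed.

Lemma aff2_1 y x : aff2 1 y x = x + y.
Proof. by rewrite /aff2 !mul1r. Qed.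

Lemma itg_shift y (f : mplane R -> R) : itg mu f -> itg mu (fun x => f (x + y)).
Proof.
by move=> /(itg_aff2 y ltr01); under [X in itg _ X -> _]eq_fun do rewrite aff2_1.
Qed.

Lemma Rint_shift y (f : mplane R -> R) : itg mu f ->
  \int[mu]_x f (x + y) = \int[mu]_x f x.
Proof.
move=> fi; rewrite (Rint_aff2 y ltr01 fi) expr1n mul1r.
by apply: eq_Rint => x; rewrite aff2_1.
Qed.

Lemma measurable_shift y (f : mplane R -> R) : measurable_fun setT f ->
  measurable_fun [set: mplane R] (fun x : R * R => f (x + y)).
Proof.
move=> mf; have := measurableT_comp mf (measurable_aff2 1 y).
by apply: eq_measurable_fun => x _ /=; rewrite aff2_1.
Qed.

Lemma sqi_shift y (f : mplane R -> R) : sqi mu f -> sqi mu (fun x => f (x + y)).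
Proof. by move=> [mf fi]; split; [exact: measurable_shift|exact: (itg_shift y fi)]. Qed.

Lemma rweak_shift i y a b : sqi mu a -> sqi mu b -> rweak i a b ->
  rweak i (fun x => a (x + y)) (fun x => b (x + y)).
Proof.
move=> La Lb w f tf.
have tf' := test_shift (- y) tf; have tdf' := test_partial i tf'.
have := w _ tf'.
rewrite -(Rint_shift y (itg_test La tdf')) -(Rint_shift y (itg_test Lb tf')).
rewrite partial_shift// => H.
etransitivity; last first.
  by etransitivity; [exact: H|congr (- _); apply: eq_Rint => x; rewrite addrK].
by apply: eq_Rint => x; rewrite addrK.
Qed.

Lemma rH1_shift y (a : mplane R -> R) : rH1 a -> rH1 (fun x : R * R => a (x + y)).
Proof.
move=> [La Ha]; split; first exact: sqi_shift.
by move=> i; have [b Lb wb] := Ha i; exists (fun x => b (x + y)); [exact: sqi_shift|exact: rweak_shift].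
Qed.

End affine_change.

Section gradient.
Context {R : realType}.
Local Notation mu := (leb2 R).
Implicit Types (u v g : R * R -> R[i]) (c : R).
Local Open Scope complex_scope.

Definition scalec c u : R * R -> R[i] := fun x => c%:C * u x.

Lemma reu_scalec c u : reu (scalec c u) = fun x => c * reu u x.
Proof. by apply/funext => x; rewrite /reu /scalec; case: (u x) => a b /=; rewrite mul0r subr0. Qed.

Lemma imu_scalec c u : imu (scalec c u) = fun x => c * imu u x.
Proof. by apply/funext => x; rewrite /imu /scalec; case: (u x) => a b /=; rewrite mul0r addr0. Qed.

Lemma modulus_scalec2 c u x : modulus (scalec c u) x ^+ 2 = c ^+ 2 * modulus u x ^+ 2.
Proof. by rewrite !modulus_sqr reu_scalec imu_scalec !exprMn mulrDr. Qed.

Lemma scalec_comp c d u : scalec c (scalec d u) = scalec (c * d) u.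
Proof. by apply/funext => x; rewrite /scalec mulrA -rmorphM. Qed.

Lemma scalec1 u : scalec 1 u = u.
Proof. by apply/funext => x; rewrite /scalec mul1r. Qed.

Lemma Lp2_scalec c u : Lp 2 u -> Lp 2 (scalec c u).
Proof. by move=> /Lp2P[Lr Li]; apply/Lp2P; rewrite reu_scalec imu_scalec; split; exact: sqiZ. Qed.

Lemma weak_scalec i c u g : Lp 2 u -> Lp 2 g -> weak_derivative i u g ->
  weak_derivative i (scalec c u) (scalec c g).
Proof.
move=> /Lp2P[? ?] /Lp2P[? ?] /weakP[? ?]; apply/weakP.
by rewrite !reu_scalec !imu_scalec; split; exact: rweakZ.
Qed.

Lemma H1_scalec c u : H1 u -> H1 (scalec c u).
Proof. by move=> /H1P[? ?]; apply/H1P; rewrite reu_scalec imu_scalec; split; exact: rH1Z. Qed.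

Lemma H1_Lp2 u : H1 u -> Lp 2 u.
Proof. by case. Qed.

Lemma Lp2_ae_norm u v : Lp 2 u -> Lp 2 v -> (\forall x \ae mu, u x = v x) ->
  lp_norm 2 u ^+ 2 = lp_norm 2 v ^+ 2.
Proof.
move=> Lu Lv uv; rewrite !lp_norm2; apply/eqP; rewrite -subr_eq0 -RintB; try exact: Lp2_itg.
apply/eqP/integral_ae0; first by apply: ae_plane_imp uv => x; rewrite /modulus => ->; rewrite subrr.
by apply: itg_measurable; apply: itgB; exact: Lp2_itg.
Qed.

Lemma weak_unique i u g g' : Lp 2 g -> Lp 2 g' -> weak_derivative i u g ->
  weak_derivative i u g' -> \forall x \ae mu, g x = g' x.
Proof.
move=> /Lp2P[? ?] /Lp2P[? ?] /weakP[w1 w2] /weakP[w1' w2'].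
have e1 := rweak_unique _ _ w1 w1'; have e2 := rweak_unique _ _ w2 w2'.
apply: ae_plane_imp2 (e1 _ _) (e2 _ _) => // x; rewrite /reu /imu.
by case: (g x) => a b; case: (g' x) => a' b' /= -> ->.
Qed.

Lemma wpartial_norm i u g : Lp 2 g -> weak_derivative i u g ->
  lp_norm 2 (wpartial i u) ^+ 2 = lp_norm 2 g ^+ 2.
Proof.
move=> Lg wg.
have [Lw ww] : Lp 2 (wpartial i u) /\ weak_derivative i u (wpartial i u).
  by apply: (@xgetPex _ (cst 0) [set g | Lp 2 g /\ weak_derivative i u g]); exists g.
by apply: Lp2_ae_norm => //; exact: weak_unique ww wg.
Qed.

Lemma grad2_ge0 u : 0 <= grad2 u.
Proof. by apply: sumr_ge0 => i _; exact: sqr_ge0. Qed.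

Lemma lp_norm2_scalec c u : Lp 2 u -> lp_norm 2 (scalec c u) ^+ 2 = c ^+ 2 * lp_norm 2 u ^+ 2.
Proof.
move=> Lu; rewrite !lp_norm2 -RintZ; last exact: Lp2_itg.
by apply: eq_Rint => x; exact: modulus_scalec2.
Qed.

(** H^1 is not assumed: in a direction without a square-integrable weak derivative, [wpartial] takes
    its default 0 for [u], and also for [scalec c u] because [c] is invertible. *)
Lemma grad2_scalec c u : c != 0 -> Lp 2 u -> grad2 (scalec c u) = c ^+ 2 * grad2 u.
Proof.
move=> c0 Lu; rewrite /grad2 mulr_sumr; apply: eq_bigr => i _.
have [[g [Lg wg]]|ne] := pselect (exists g, Lp 2 g /\ weak_derivative i u g).
  rewrite (wpartial_norm Lg wg) -lp_norm2_scalec//.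
  by apply: wpartial_norm; [exact: Lp2_scalec|exact: weak_scalec].
rewrite /wpartial !xgetPN ?lp_norm2; last 2 first.
- by move=> g Hg; apply: ne; exists g.
- move=> g [Lg wg]; apply: ne; exists (scalec c^-1 g); split; first exact: Lp2_scalec.
  by rewrite -[u]scalec1 -(mulVf c0) -scalec_comp; apply: weak_scalec => //; exact: Lp2_scalec.
rewrite (eq_Rint _ (g := cst 0)).
  by rewrite Rintegral_cst//= mul0r mulr0.
by move=> x; rewrite modulus_sqr /reu /imu /= expr0n addr0.
Qed.

Lemma Lp2_0 : Lp 2 (cst 0 : R * R -> R[i]).
Proof. by apply/Lp2P; split; exact: sqi0. Qed.

Lemma H1_ae0 u : Lp 2 u -> ae0 u -> H1 u.
Proof. by move=> /Lp2P[[? _] [? _]] /ae0_parts[? ?]; apply/H1P; split; exact: rH1_ae0. Qed.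

Lemma weak_ae0 i u : Lp 2 u -> ae0 u -> weak_derivative i u (cst 0).
Proof.
move=> /Lp2P[? ?] /ae0_parts[ur ui]; apply/weakP.
by split; (apply: rweak_ae (rweak0 i); [exact: sqi0|by []|]);
  [apply: ae_plane_imp ur|apply: ae_plane_imp ui] => x ->.
Qed.

Lemma lp_norm2_0 : lp_norm 2 (cst 0 : R * R -> R[i]) ^+ 2 = 0.
Proof. by apply: ae0_lp_norm2; [exact: Lp2_0|apply/ae0P; exact: aeW]. Qed.

Lemma grad2_ae0 u : Lp 2 u -> ae0 u -> grad2 u = 0.
Proof.
move=> Lu u0; rewrite /grad2 big1// => i _.
by rewrite (wpartial_norm Lp2_0 (weak_ae0 i Lu u0)) lp_norm2_0.
Qed.

Definition shiftf (y : R * R) u : R * R -> R[i] := fun x => u (x + y).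

Lemma Lp2_shift y u : Lp 2 u -> Lp 2 (shiftf y u).
Proof. by move=> /Lp2P[Lr Li]; apply/Lp2P; split; [exact: (sqi_shift y Lr)|exact: (sqi_shift y Li)]. Qed.

Lemma weak_shift i y u g : Lp 2 u -> Lp 2 g -> weak_derivative i u g ->
  weak_derivative i (shiftf y u) (shiftf y g).
Proof.
move=> /Lp2P[ur ui] /Lp2P[gr gi] /weakP[wr wi]; apply/weakP.
by split; [exact: (rweak_shift y ur gr)|exact: (rweak_shift y ui gi)].
Qed.

Lemma H1_shift y u : H1 u -> H1 (shiftf y u).
Proof.
by move=> /H1P[ur ui]; apply/H1P; split; [exact: (rH1_shift y ur)|exact: (rH1_shift y ui)].
Qed.

Lemma lp_norm2_shift y u : Lp 2 u -> lp_norm 2 (shiftf y u) ^+ 2 = lp_norm 2 u ^+ 2.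
Proof. by move=> Lu; rewrite !lp_norm2; exact: (Rint_shift y (Lp2_itg Lu)). Qed.

Lemma grad2_shift y u : H1 u -> grad2 (shiftf y u) = grad2 u.
Proof.
move=> [Lu Hu]; apply: eq_bigr => i _; have [g Lg wg] := Hu i.
rewrite (wpartial_norm Lg wg) -(lp_norm2_shift y Lg).
by apply: wpartial_norm; [exact: Lp2_shift|exact: weak_shift].
Qed.

End gradient.

(** * Existence of the Green's function *)

Section chain_rule.
Context {R : realType}.

Lemma MVT_between (f f' : R -> R) (a b : R) :
  (forall x : R, is_derive x 1 f (f' x)) ->
  exists2 c : R, `|c - a| <= `|b - a| & f b - f a = f' c * (b - a).
Proof.
move=> df.
have cf (u v : R) : {within `[u, v], continuous f}.
  by apply: derivable_within_continuous => x _; have [] := df x.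
have [ab|ba] := leP a b.
  have [c] := MVT_segment ab (fun x _ => df x) (cf a b).
  rewrite in_itv /= => /andP[ac cb] e; exists c => //.
  by rewrite !ger0_norm ?subr_ge0// lerD2r.
have [c] := MVT_segment (ltW ba) (fun x _ => df x) (cf b a).
rewrite in_itv /= => /andP[bc ca] e; exists c; last by rewrite -opprB e -mulrN opprB.
by rewrite !ler0_norm ?subr_le0 ?(ltW ba)// lerN2 lerD2r.
Qed.

Lemma shift0_cvg (p : R -> R) (r : R) : {for r, continuous p} ->
  p (h *: (1 : R) + r) @[h --> 0^'] --> p r.
Proof.
move=> cp; rewrite (_ : (fun h : R => _) = p \o shift r); first exact/continuous_withinNshiftx.
by apply/funext => h /=; rewrite /GRing.scale /= mulr1.
Qed.

(* The increment of the first coordinate is controlled by the mean value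
   theorem, so that continuity of the partial derivatives suffices. *)
Lemma test_chain (f : R * R -> R) (p q p' q' : R -> R) (r : R) : test_function f ->
  is_derive r 1 p (p' r) -> is_derive r 1 q (q' r) ->
  is_derive r (1 : R) (fun t => f (p t, q t))
    (p' r * partial_derivative dir0 f (p r, q r) + q' r * partial_derivative dir1 f (p r, q r)).
Proof.
move=> tf dp dq.
have d0 x y : is_derive x (1 : R) (fun t => f (t, y)) (partial_derivative dir0 f (x, y)).
  by apply: (is_derive_dir0 f (x, y) _).2; exact: test_is_derive.
have d1 x y : is_derive y (1 : R) (fun t => f (x, t)) (partial_derivative dir1 f (x, y)).
  by apply: (is_derive_dir1 f (x, y) _).2; exact: test_is_derive.
have cf0 : continuous (partial_derivative dir0 f) by exact/test_continuous/test_partial.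
have cp : {for r, continuous p} by apply/differentiable_continuous/derivable1_diffP; case: dp.
have cq : {for r, continuous q} by apply/differentiable_continuous/derivable1_diffP; case: dq.
(* The intermediate points are picked by choice. Nothing is known about their dependence on [h], but
   [xi1] alone forces them to [p r]. *)
pose H h := cid2 (MVT_between (p r) (p (h *: (1 : R) + r)) (fun x => d0 x (q (h *: (1 : R) + r)))).
pose xi h := s2val (H h).
have xi1 h : `|xi h - p r| <= `|p (h *: (1 : R) + r) - p r| by exact: (s2valP (H h)).
have xi2 h : f (p (h *: (1 : R) + r), q (h *: (1 : R) + r)) - f (p r, q (h *: (1 : R) + r)) =
    partial_derivative dir0 f (xi h, q (h *: (1 : R) + r)) * (p (h *: (1 : R) + r) - p r).
  exact: (s2valP' (H h)).
apply: is_derive_lim.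
rewrite (_ : (fun h => _) = (fun h : R =>
   (h^-1 *: (p (h *: (1 : R) + r) - p r)) * partial_derivative dir0 f (xi h, q (h *: (1 : R) + r)) +
   h^-1 *: (f (p r, q (h *: (1 : R) + r)) - f (p r, q r)))); last first.
  apply/funext => h; rewrite -[f (p _, _) - _](subrKA (f (p r, q (h *: (1 : R) + r)))) xi2.
  by rewrite /GRing.scale /=; ring.
apply: cvgD; last first.
  rewrite mulrC; apply: (is_derive_cvg (f := fun t => f (p r, q t))).
  exact: (@is_derive1_comp R (fun t => f (p r, t)) q).
apply: cvgM; first exact: is_derive_cvg.
apply: (cvg_comp (fun h : R => (xi h, q (h *: (1 : R) + r)))); last exact: cf0.
have c2 := shift0_cvg cq.
suff c1 : xi h @[h --> 0^'] --> p r.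
  exact: (@cvg_pair _ _ _ _ (nbhs (p r)) (nbhs (q r)) _ _ _ xi (fun h => q (h *: (1 : R) + r)) c1 c2).
have := shift0_cvg cp; move=> /cvgrPdist_lt cp'; apply/cvgrPdist_lt => e /cp'.
apply: filterS => h; rewrite distrC [X in _ -> X < _]distrC; exact: le_lt_trans.
Qed.
End chain_rule.

(** * Fubini's theorem for real-valued integrals *)

Section real_fubini.
Context d1 d2 {T1 : measurableType d1} {T2 : measurableType d2} {R : realType}.
Variable m1 : {sigma_finite_measure set T1 -> \bar R}.
Variable m2 : {sigma_finite_measure set T2 -> \bar R}.
Implicit Types f : T1 * T2 -> R.

Lemma itg_prod21 f : measurable_fun setT f ->
  (\int[m2]_y \int[m1]_x (`|f (x, y)|)%:E < +oo)%E -> itg (m1 \x m2)%E f.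
Proof.
by move=> mf H; apply/(@integrable21ltyP _ _ _ _ _ m1 m2); [exact/measurable_EFinP|exact: H].
Qed.

Lemma itg_tensor (a : T1 -> R) (b : T2 -> R) : itg m1 a -> itg m2 b ->
  itg (m1 \x m2)%E (fun x => a x.1 * b x.2).
Proof.
move=> ai bi; have [ma fa] := (itgP m1 a).1 ai; have [mb fb] := (itgP m2 b).1 bi.
apply: itg_prod21.
  by apply: measurable_funM; [exact: (measurableT_comp ma measurable_fst)|exact: (measurableT_comp mb measurable_snd)].
have E y : (\int[m1]_x (`|a x * b y|)%:E = (`|b y|)%:E * \int[m1]_x (`|a x|)%:E)%E.
  rewrite -ge0_integralZl//; last exact/measurable_EFinP/measurableT_comp.
  by apply: eq_integral => x _; rewrite -EFinM normrM mulrC.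
rewrite /=; under eq_integral do rewrite E.
have na := itg_norm ai; have nb := itg_norm bi.
rewrite -(Rint_fin na); under eq_integral do rewrite -EFinM mulrC.
rewrite (_ : (\int[m2]_y _)%E = (\int[m2]_y (\int[m1]_x `|a x| * `|b y|)%:E)%E)//.
by rewrite -Rint_fin ?ltry//; exact: itgZ.
Qed.

(** The inner integral is taken with [fine], so it agrees with the extended-real section integral
    only where that is finite. Integrability makes this almost everywhere, which suffices for the
    outer integral. *)
Lemma Rint_fubini1 f : itg (m1 \x m2)%E f ->
  itg m1 (fun x => \int[m2]_y f (x, y)) /\
  \int[(m1 \x m2)%E]_z f z = \int[m1]_x \int[m2]_y f (x, y).
Proof.
move=> fi; have Fi := integrable_fubini_F fi.
pose h (x : T1) : R := \int[m2]_y f (x, y); rewrite -/h.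
have mF := measurable_int _ Fi.
have Ffin : {ae m1, forall x, setT x -> fubini_F m2 (EFin \o f) x \is a fin_num} := integrable_ae measurableT Fi.
have mFf : measurable_fun setT (fun x => fine (fubini_F m2 (EFin \o f) x)) by exact: measurableT_comp.
have Fe : ae_eq m1 setT (fubini_F m2 (EFin \o f)) (EFin \o h).
  by apply: filterS Ffin => x H /H /fineK <-.
have Gi : itg m1 h.
  apply/integrableP; split; first exact/measurable_EFinP.
  case/integrableP : Fi => _.
  have -> : (\int[m1]_x `|fubini_F m2 (EFin \o f) x| = \int[m1]_x `|(EFin \o h) x|)%E.
    apply: ae_eq_integral => //; [exact: measurableT_comp|..].
      by apply: measurableT_comp => //; exact/measurable_EFinP.
    by apply: filterS Fe => x H /H ->.
  by [].
split => //; apply: EFin_inj; rewrite Rint_fin// Rint_fin//.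
rewrite -integral12_prod_meas1//; apply: ae_eq_integral => //.
exact/measurable_EFinP.
Qed.

Lemma Rint_fubini2 f : itg (m1 \x m2)%E f ->
  itg m2 (fun y => \int[m1]_x f (x, y)) /\
  \int[(m1 \x m2)%E]_z f z = \int[m2]_y \int[m1]_x f (x, y).
Proof.
move=> fi.
have Fi : m2.-integrable setT (fubini_G m1 (EFin \o f)).
  have mf := measurable_int _ fi.
  apply/integrableP; split; first exact: (measurable_fubini_G fi).
  have mabs : measurable_fun setT (abse \o (EFin \o f)) by exact: measurableT_comp.
  apply: le_lt_trans ((integrable21ltyP m1 m2 mf).1 fi).
  apply: ge0_le_integral => //.
  - by apply: measurableT_comp => //; exact: (measurable_fubini_G fi).
  - exact: (@measurable_fun_fubini_tonelli_G _ _ _ _ _ m1 (abse \o (EFin \o f)) mabs (fun x => abse_ge0 _)).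
  - move=> y _; apply: le_abse_integral => //.
    exact: measurableT_comp mf (pair2_measurable y).
pose h (y : T2) : R := \int[m1]_x f (x, y); rewrite -/h.
have mF := measurable_int _ Fi.
have Ffin : {ae m2, forall x, setT x -> fubini_G m1 (EFin \o f) x \is a fin_num} := integrable_ae measurableT Fi.
have mFf : measurable_fun setT (fun x => fine (fubini_G m1 (EFin \o f) x)) by exact: measurableT_comp.
have Fe : ae_eq m2 setT (fubini_G m1 (EFin \o f)) (EFin \o h).
  by apply: filterS Ffin => x H /H /fineK <-.
have Gi : itg m2 h.
  apply/integrableP; split; first exact/measurable_EFinP.
  case/integrableP : Fi => _.
  have -> : (\int[m2]_x `|fubini_G m1 (EFin \o f) x| = \int[m2]_x `|(EFin \o h) x|)%E.
    apply: ae_eq_integral => //; [exact: measurableT_comp|..].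
      by apply: measurableT_comp => //; exact/measurable_EFinP.
    by apply: filterS Fe => x H /H ->.
  by [].
split => //; apply: EFin_inj; rewrite Rint_fin// Rint_fin//.
rewrite -integral21_prod_meas1//; apply: ae_eq_integral => //.
exact/measurable_EFinP.
Qed.

Lemma ae_itg_section1 f : itg (m1 \x m2)%E f ->
  \forall x \ae m1, itg m2 (fun y => f (x, y)).
Proof. by move=> fi; exact: (ae_integrable1 fi). Qed.

Lemma itg_prod_dom f (b : T2 -> R) : measurable_fun setT f ->
  (forall y, itg m1 (fun x => f (x, y)) /\ \int[m1]_x `|f (x, y)| <= b y) -> itg m2 b ->
  itg (m1 \x m2)%E f.
Proof.
move=> mf fb bi; apply: itg_prod21 => //.
apply: (@le_lt_trans _ _ (\int[m2]_y (b y)%:E)%E); last by rewrite -Rint_fin ?ltry.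
apply: ge0_le_integral.
- by [].
- by move=> y _; apply: integral_ge0.
- apply: (@measurable_fun_fubini_tonelli_G _ _ _ _ _ m1 (fun p => (`|f p|)%:E)) => //.
  by apply/measurable_EFinP; exact: measurableT_comp.
- by apply/measurable_EFinP; exact: itg_measurable bi.
- by move=> y _; have [/itg_norm i fy] := fb y; rewrite -Rint_fin// lee_fin.
Qed.

End real_fubini.

Section leb2_sigma_finite.
Context {R : realType}.
Local Notation lambda := (@lebesgue_measure R).

Lemma sigma_finite_leb2 : sigma_finite setT (leb2 R).
Proof.
exists (fun n => ocrect (- n%:R) n%:R (- n%:R) n%:R); last first.
  by move=> n; split; [exact: measurable_ocrect|exact: leb2_ocrect_fin].
apply/seteqP; split => // x _; exists (Num.trunc `|x|).+1 => //.
have := truncnS_gt `|x|; set n := _%:R; rewrite prod_normE gt_max !ltr_norml.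
by move=> /andP[/andP[? ?] /andP[? ?]]; split; rewrite /= in_itv /=; apply/andP; split => //; exact: ltW.
Qed.

(** The same measure as [leb2 R], equipped with sigma-finiteness so that the plane can be a factor
    in Fubini's theorem. The two integrals are convertible. *)
Definition sleb2 : {sigma_finite_measure set (mplane R) -> \bar R} :=
  HB.pack (Measure.sort (leb2 R)) (Measure_isSigmaFinite.Build _ _ _ (Measure.sort (leb2 R)) sigma_finite_leb2).

Lemma Rint_leb2_iter (f : mplane R -> R) : itg (leb2 R) f ->
  \int[leb2 R]_z f z = \int[lambda]_x \int[lambda]_y f (x, y).
Proof. by move=> fi; have [_] := Rint_fubini1 (m1 := lambda) (m2 := lambda) fi. Qed.

Lemma Rint_leb2_iter2 (f : mplane R -> R) : itg (leb2 R) f ->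
  \int[leb2 R]_z f z = \int[lambda]_y \int[lambda]_x f (x, y).
Proof. by move=> fi; have [_] := Rint_fubini2 (m1 := lambda) (m2 := lambda) fi. Qed.

Lemma itg_tens (a b : R -> R) : itg lambda a -> itg lambda b -> itg (leb2 R) (tens a b).
Proof. exact: itg_tensor. Qed.

End leb2_sigma_finite.

Section line_integrals.
Context {R : realType}.
Local Notation lambda := (@lebesgue_measure R).

Lemma derive_continuous (f f' : R -> R) : (forall x : R, is_derive x 1 f (f' x)) -> continuous f.
Proof. by move=> df x; apply/differentiable_continuous/derivable1_diffP; case: (df x). Qed.

Lemma FTC2 (f f' : R -> R) (a b : R) : a < b ->
  (forall x : R, is_derive x 1 f (f' x)) -> continuous f' ->
  \int[lambda]_(x in `[a, b]) f' x = f b - f a.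
Proof.
move=> ab df cf'; have cf := derive_continuous df.
rewrite /Rintegral (@continuous_FTC2 _ f' f a b)//.
- exact: continuous_subspaceT.
- split.
  + by move=> x _; case: (df x).
  + by apply: cvg_at_right_filter; exact: cf.
  + by apply: cvg_at_left_filter; exact: cf.
- by move=> x _; have := df x => dfx; rewrite derive1E derive_val.
Qed.

Lemma Rint_derive_bsupp (f f' : R -> R) (M : R) :
  (forall x : R, is_derive x 1 f (f' x)) -> continuous f' ->
  bsupp M f -> bsupp M f' -> \int[lambda]_x f' x = 0.
Proof.
move=> df cf' Mf Mf'; pose N := `|M| + 1.
have N0 : 0 < N by rewrite ltr_wpDl.
have MN : M < N by rewrite /N ltr_pwDr// ler_norm.
have -> : \int[lambda]_x f' x = \int[lambda]_(x in `[- N, N]) f' x.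
  rewrite [RHS]Rintegral_mkcond; apply: eq_Rintegral => x _; rewrite patchE.
  case: ifPn => //; rewrite mem_setE in_itv /= -ler_norml -ltNge => Nx.
  by rewrite Mf'// (lt_trans MN).
rewrite (FTC2 _ df cf') ?gtrN//.
by rewrite !Mf ?subrr// ?normrN gtr0_norm.
Qed.

(** The integrand is a multiple of the normal density of variance [(2 * c)^-1]. *)
Lemma expR_sqr_itg (c : R) : 0 < c -> itg lambda (fun x => expR (- (c * x ^+ 2))).
Proof.
move=> c0; pose s := Num.sqrt (2 * c)^-1.
have s2 : s ^+ 2 = (2 * c)^-1 by rewrite sqr_sqrtr// invr_ge0 mulr_ge0// ltW.
have s0 : 0 < s by rewrite sqrtr_gt0 invr_gt0 mulr_gt0.
have H := @integrable_normal_pdf R 0 s.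
have peak0 : normal_peak s != 0.
  by rewrite /normal_peak invr_neq0// gt_eqF// sqrtr_gt0 pmulrn_lgt0// mulr_gt0 ?pi_gt0// exprn_gt0.
apply: eq_integrable (itgZ (normal_peak s)^-1 H) => // x _ /=; congr (_%:E).
rewrite /normal_pdf gt_eqF//= mulKf// /normal_fun subr0 s2.
by congr expR; rewrite mulNr; congr (- _); field; rewrite gt_eqF.
Qed.

Lemma expR_quartic_itg (c : R) : 0 < c -> itg lambda (fun x => expR (- (c * x ^+ 4))).
Proof.
move=> c0; apply: (itg_le _ _ (itgZ (expR c) (expR_sqr_itg (mulr_gt0 (ltr0n R 2) c0)))).
  apply: measurableT_comp => //; apply: measurableT_comp => //.
  by apply: measurable_funM => //; exact: measurable_funX.
move=> x; rewrite ger0_norm ?expR_ge0// -expRD ler_expR.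
rewrite -subr_ge0; have -> : c + - (2 * c * x ^+ 2) - - (c * x ^+ 4) = c * (x ^+ 2 - 1) ^+ 2 by ring.
by rewrite mulr_ge0 ?sqr_ge0// ltW.
Qed.

(** The heat kernel of the line at time 1, not normalised. *)
Definition gaussian (t : R) : R := expR (- (t ^+ 2 / 4)).

Lemma gaussian_gt0 t : 0 < gaussian t. Proof. exact: expR_gt0. Qed.

Lemma itg_gaussian : itg lambda gaussian.
Proof.
have c0 : 0 < 4^-1 :> R by rewrite invr_gt0.
apply: eq_integrable (expR_sqr_itg c0) => // x _ /=.
by rewrite /gaussian mulrC.
Qed.

Lemma is_derive_exprn (n : nat) (t : R) :
  is_derive t (1 : R) (fun t => t ^+ n) (n%:R * t ^+ n.-1).
Proof.
have -> : (fun t : R => t ^+ n) = (id : R -> R) ^+ n by apply/funext => x; rewrite fctE.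
have H := @is_deriveX R R id n t 1 1 (is_derive_id _ _).
by apply: is_derive_eq; rewrite /GRing.scale /= mulr1.
Qed.

Lemma is_derive_gaussian (t : R) : is_derive t 1 gaussian (- (t / 2) * gaussian t).
Proof.
rewrite mulrC; apply: (@is_derive1_comp R expR (fun t => - (t ^+ 2 / 4))).
have dX := is_derive_exprn 2 t.
have H : is_derive t (1 : R) ((- 4^-1) \*: (fun t : R => t ^+ 2)) (- 4^-1 *: (2%:R * t ^+ 1)).
  exact: is_deriveZ.
rewrite (_ : (fun t => _) = (- 4^-1) \*: (fun t : R => t ^+ 2)); last first.
  by apply/funext => x; rewrite /= -mulrN mulrC.
by apply: is_derive_eq; rewrite /GRing.scale /=; field.
Qed.

(** The Gaussian is split into two equal factors; one absorbs [|t|], since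
    [|t| <= 8 + t^2 <= 8 e^(t^2 / 8)], and the other remains integrable. *)
Lemma itg_gaussian_moment : itg lambda (fun t => gaussian t * `|t|).
Proof.
have c0 : 0 < 8^-1 :> R by rewrite invr_gt0.
apply: (itg_le _ _ (itgZ 8 (expR_sqr_itg c0))).
  by apply: measurable_funM; [exact: itg_measurable itg_gaussian|exact: normr_measurable].
move=> t; rewrite ger0_norm ?mulr_ge0 ?(ltW (gaussian_gt0 _))//.
have -> : gaussian t = expR (- (8^-1 * t ^+ 2)) * expR (- (8^-1 * t ^+ 2)).
  by rewrite -expRD /gaussian; congr expR; field.
rewrite -mulrA mulrC ler_pM2r ?expR_gt0// expRN ler_pdivrMl ?expR_gt0//.
have := @expR_ge1Dx R (8^-1 * t ^+ 2); move: (expR _) => E H.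
have e : t ^+ 2 = `|t| ^+ 2 by rewrite real_normK ?num_real.
have n0 : 0 <= `|t| by []; have := sqr_ge0 (`|t| - 1).
move: H; rewrite e sqrrB expr1n mulr1 mulr2n.
by move: (`|t| : R) n0 => y n0; move: (y ^+ 2) => z H1 H2; lra.
Qed.

End line_integrals.

(** * Gaussian averages of dilated test functions and integration by parts *)

Section gaussian_identities.
Context {R : realType}.
Local Notation lambda := (@lebesgue_measure R).
Local Notation mu := (leb2 R).
Implicit Types f phi : R * R -> R.

Definition scl (s : R) (z : mplane R) : mplane R := (s * z.1, s * z.2).

Lemma scl_aff2 s z : aff2 s 0 z = scl s z.
Proof. by rewrite /aff2 /scl !addr0. Qed.

Lemma measurable_scl s : measurable_fun setT (scl s).
Proof.
by apply: measurable_fun_pair; apply: measurable_funM.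
Qed.

Lemma Rint_scl s (h : mplane R -> R) : 0 < s -> itg mu h ->
  \int[mu]_x h x = s ^+ 2 * \int[mu]_z h (scl s z).
Proof.
move=> s0 hi; rewrite (Rint_aff2 0 s0 hi); congr (_ * _).
by apply: eq_Rint => z; rewrite scl_aff2.
Qed.

Definition gauss2 : mplane R -> R := tens gaussian gaussian.

Lemma gauss2_gt0 z : 0 < gauss2 z.
Proof. by rewrite mulr_gt0 ?gaussian_gt0. Qed.

Lemma itg_gauss2 : itg mu gauss2.
Proof. by apply: itg_tens; exact: itg_gaussian. Qed.

Lemma continuous_gaussian : continuous (@gaussian R).
Proof. exact: derive_continuous is_derive_gaussian. Qed.

Definition gauss2_dom (z : mplane R) : R := gauss2 z * (1 + `|z.1| + `|z.2|).

Lemma itg_gauss2_dom : itg mu gauss2_dom.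
Proof.
have h1 := itg_tens (@itg_gaussian_moment R) itg_gaussian.
have h2 := itg_tens itg_gaussian (@itg_gaussian_moment R).
apply: eq_integrable (itgD (itgD itg_gauss2 h1) h2) => // z _ /=; congr (_%:E).
by rewrite /gauss2_dom /gauss2 /tens; ring.
Qed.

Lemma gauss2_dom_ge0 z : 0 <= gauss2_dom z.
Proof. by rewrite mulr_ge0 ?(ltW (gauss2_gt0 _))// !addr_ge0. Qed.

Lemma itg_gauss2_bounded (C : R) (h : mplane R -> R) : measurable_fun setT h ->
  (forall z, `|h z| <= C * (1 + `|z.1| + `|z.2|)) -> itg mu (fun z => gauss2 z * h z).
Proof.
move=> mh hC; apply: (itg_le _ _ (itgZ C itg_gauss2_dom)).
  by apply: measurable_funM => //; exact: itg_measurable itg_gauss2.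
move=> z; rewrite normrM (gtr0_norm (gauss2_gt0 z)) /gauss2_dom mulrCA.
by rewrite ler_pM2l ?gauss2_gt0.
Qed.

Lemma measurable_test_scl phi s : test_function phi ->
  measurable_fun setT (fun z : mplane R => phi (scl s z)).
Proof.
by move=> tp; exact: (measurableT_comp (test_measurable tp) (measurable_scl s)).
Qed.

Lemma one_le_moment (z : mplane R) : 1 <= 1 + `|z.1| + `|z.2|.
Proof. by rewrite -addrA lerDl addr_ge0. Qed.

Lemma fst_le_moment (z : mplane R) : `|z.1| <= 1 + `|z.1| + `|z.2|.
Proof. by have := normr_ge0 z.1; have := normr_ge0 z.2 => *; lra. Qed.

Lemma snd_le_moment (z : mplane R) : `|z.2| <= 1 + `|z.1| + `|z.2|.
Proof. by have := normr_ge0 z.1; have := normr_ge0 z.2 => *; lra. Qed.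

Lemma itg_gauss2_test phi s : test_function phi -> itg mu (fun z => gauss2 z * phi (scl s z)).
Proof.
move=> tp; have [B B0 HB] := test_bounded tp.
apply: (@itg_gauss2_bounded B); first exact: measurable_test_scl.
move=> z; apply: le_trans (HB _) _; rewrite ler_peMr ?(ltW B0)//; exact: one_le_moment.
Qed.

Lemma itg_gauss2_test0 phi s : test_function phi ->
  itg mu (fun z => gauss2 z * (z.1 * phi (scl s z))).
Proof.
move=> tp; have [B B0 HB] := test_bounded tp.
apply: (@itg_gauss2_bounded B).
  by apply: measurable_funM => //; exact: measurable_test_scl.
move=> z; rewrite normrM mulrC ler_pM//; exact: fst_le_moment.
Qed.

Lemma itg_gauss2_test1 phi s : test_function phi ->
  itg mu (fun z => gauss2 z * (z.2 * phi (scl s z))).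
Proof.
move=> tp; have [B B0 HB] := test_bounded tp.
apply: (@itg_gauss2_bounded B).
  by apply: measurable_funM => //; exact: measurable_test_scl.
move=> z; rewrite normrM mulrC ler_pM//; exact: snd_le_moment.
Qed.

(** The integrand is the derivative of the compactly supported [2 * gaussian x * phi (s * x)],
    because [gaussian' = - (x / 2) * gaussian]. *)
Lemma gauss_line_ibp (phi phi' : R -> R) (s M : R) : 0 < s ->
  (forall x : R, is_derive x 1 phi (phi' x)) -> continuous phi' -> bsupp M phi -> bsupp M phi' ->
  \int[lambda]_x (gaussian x * (2 * s * phi' (s * x)) - gaussian x * (x * phi (s * x))) = 0.
Proof.
move=> s0 dphi cphi' Mp Mp'.
pose h x := 2 * gaussian x * phi (s * x).
apply: (@Rint_derive_bsupp _ h _ (M / s)).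
- move=> x; have dg := is_derive_gaussian x.
  have ds : is_derive x (1 : R) (fun x => phi (s * x)) (phi' (s * x) * s).
    apply: (@is_derive1_comp R phi (fun x => s * x)).
    have : is_derive x (1 : R) (s \*: (id : R -> R)) (s *: (1 : R)) by exact: is_deriveZ.
    by rewrite /GRing.scale /= mulr1.
  have dM := is_deriveM (is_deriveZ 2 dg) ds.
  apply: is_derive_eq; rewrite /GRing.scale /= /GRing.scale /=.
  by field; rewrite ?pnatr_eq0.
- have cphi := derive_continuous dphi.
  have cs (q : R -> R) : continuous q -> continuous (fun x => q (s * x)).
    move=> cq x; apply: continuous_comp; last exact: cq.
    by apply: cvgM; [exact: cvg_cst|exact: cvg_id].
  move=> x; apply: cvgB.
    by apply: cvgM; [exact: continuous_gaussian|apply: cvgM; [exact: cvg_cst|exact: cs]].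
  by apply: cvgM; [exact: continuous_gaussian|apply: cvgM; [exact: cvg_id|exact: cs]].
- by move=> x Mx; rewrite /h Mp ?mulr0// normrM gtr0_norm// mulrC -ltr_pdivrMr.
- move=> x Mx; have Msx : M < `|s * x| by rewrite normrM gtr0_norm// mulrC -ltr_pdivrMr.
  by rewrite Mp// Mp'// !mulr0 subrr.
Qed.

Lemma test_slice0 phi (c : R) : test_function phi -> forall x : R,
  is_derive x 1 (fun t => phi (t, c)) (partial_derivative dir0 phi (x, c)).
Proof. by move=> tp x; apply: (is_derive_dir0 phi (x, c) _).2; exact: test_is_derive. Qed.

Lemma test_slice1 phi (c : R) : test_function phi -> forall y : R,
  is_derive y 1 (fun t => phi (c, t)) (partial_derivative dir1 phi (c, y)).
Proof. by move=> tp x; apply: (is_derive_dir1 phi (c, x) _).2; exact: test_is_derive. Qed.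

(** Stein's identity for a Gaussian of variance 2. Fubini's theorem puts coordinate [i] innermost,
    and the slices are handled by [gauss_line_ibp]. *)
Lemma gauss2_ibp i phi s : 0 < s -> test_function phi ->
  \int[mu]_z (gauss2 z * ((if i == dir0 then z.1 else z.2) * phi (scl s z))) =
  2 * s * \int[mu]_z (gauss2 z * partial_derivative i phi (scl s z)).
Proof.
move=> s0 tp; have tdp := test_partial i tp; have ti := itg_gauss2_test s tdp.
have i1 := itgZ (2 * s) ti.
have i2 : itg mu (fun z => gauss2 z * ((if i == dir0 then z.1 else z.2) * phi (scl s z))).
  by case: (i == dir0); [exact: itg_gauss2_test0|exact: itg_gauss2_test1].
have [M M0 HM] := test_bsupp tp; have [M' M0' HM'] := test_bsupp tdp.
pose N := Num.max M M'.
have NM x : N < `|x| -> phi x = 0.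
  by move=> Nx; apply: HM; rewrite (le_lt_trans _ Nx)// le_max lexx.
have NM' x : N < `|x| -> partial_derivative i phi x = 0.
  by move=> Nx; apply: HM'; rewrite (le_lt_trans _ Nx)// le_max lexx orbT.
rewrite -RintZ//; apply/eqP; rewrite eq_sym -subr_eq0 -RintB//; apply/eqP.
move: i tdp ti i1 i2 HM' NM'; apply: ord2P => tdp ti i1 i2 HM' NM'.
- rewrite eqxx in i2 *; rewrite Rint_leb2_iter2; last exact: itgB.
  rewrite (eq_Rint _ (g := cst 0)) ?Rintegral_cst ?mul0r// => y /=.
  have d1 := is_derive_cmul (gaussian y) (test_slice0 (s * y) tp).
  have d2 := is_derive_cmul (gaussian y) (test_slice0 (s * y) tdp).
  rewrite -[RHS](gauss_line_ibp (M := N) s0 d1 (derive_continuous d2)).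
  + by apply: eq_Rint => x; rewrite /gauss2 /tens /scl /=; ring.
  + by move=> x Nx; rewrite NM ?mulr0// prod_normE lt_max Nx.
  + by move=> x Nx; rewrite NM' ?mulr0// prod_normE lt_max Nx.
- rewrite /= in i2 *; rewrite Rint_leb2_iter; last exact: itgB.
  rewrite (eq_Rint _ (g := cst 0)) ?Rintegral_cst ?mul0r// => x /=.
  have d1 := is_derive_cmul (gaussian x) (test_slice1 (s * x) tp).
  have d2 := is_derive_cmul (gaussian x) (test_slice1 (s * x) tdp).
  rewrite -[RHS](gauss_line_ibp (M := N) s0 d1 (derive_continuous d2)).
  + by apply: eq_Rint => y; rewrite /gauss2 /tens /scl /=; ring.
  + by move=> y Ny; rewrite NM ?mulr0// prod_normE lt_max Ny orbT.
  + by move=> y Ny; rewrite NM' ?mulr0// prod_normE lt_max Ny orbT.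
Qed.

Lemma laplacianE f x : laplacian f x =
  partial_derivative dir0 (partial_derivative dir0 f) x +
  partial_derivative dir1 (partial_derivative dir1 f) x.
Proof. rewrite /laplacian big_ord_recl big_ord1; reflexivity. Qed.

Lemma gauss2_heat_algebra (k s : R) (F P0 P1 L0 L1 : mplane R -> R) :
  itg mu (fun z => gauss2 z * F z) ->
  itg mu (fun z => gauss2 z * (z.1 * P0 z)) -> itg mu (fun z => gauss2 z * (z.2 * P1 z)) ->
  itg mu (fun z => gauss2 z * L0 z) -> itg mu (fun z => gauss2 z * L1 z) ->
  \int[mu]_z (gauss2 z * (z.1 * P0 z)) = 2 * s * \int[mu]_z (gauss2 z * L0 z) ->
  \int[mu]_z (gauss2 z * (z.2 * P1 z)) = 2 * s * \int[mu]_z (gauss2 z * L1 z) ->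
  \int[mu]_z (gauss2 z * (- (L0 z + L1 z) + k * F z)) * (2 * s) =
  \int[mu]_z (gauss2 z * (2 * k * s * F z - z.1 * P0 z - z.2 * P1 z)).
Proof.
move=> a b0 b1 c0 c1 E0 E1.
have -> : \int[mu]_z (gauss2 z * (- (L0 z + L1 z) + k * F z)) =
   \int[mu]_z (k * (gauss2 z * F z) - gauss2 z * L0 z - gauss2 z * L1 z).
  by apply: eq_Rint => z; ring.
have -> : \int[mu]_z (gauss2 z * (2 * k * s * F z - z.1 * P0 z - z.2 * P1 z)) =
  \int[mu]_z (2 * k * s * (gauss2 z * F z) - gauss2 z * (z.1 * P0 z) - gauss2 z * (z.2 * P1 z)).
  by apply: eq_Rint => z; ring.
rewrite !RintB ?RintZ//; try by [exact: itgZ|apply: itgB => //; exact: itgZ].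
by rewrite E0 E1; ring.
Qed.

(* Up to the factor [expR (- k s^2)], the right-hand side is minus the
   s-derivative of the damped Gaussian average of [f] at scale s. *)
Lemma gauss2_heat (k s : R) f : 0 < s -> test_function f ->
  \int[mu]_z (gauss2 z * (- laplacian f (scl s z) + k * f (scl s z))) * (2 * s) =
  \int[mu]_z (gauss2 z * (2 * k * s * f (scl s z) -
    z.1 * partial_derivative dir0 f (scl s z) - z.2 * partial_derivative dir1 f (scl s z))).
Proof.
move=> s0 tf; have t0 := test_partial dir0 tf; have t1 := test_partial dir1 tf.
have t00 := test_partial dir0 t0; have t11 := test_partial dir1 t1.
rewrite (eq_Rint _ (fun z => congr1 (fun l => gauss2 z * (- l + _)) (laplacianE f (scl s z)))).
apply: gauss2_heat_algebra.
- exact: itg_gauss2_test.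
- exact: itg_gauss2_test0.
- exact: itg_gauss2_test1.
- exact: itg_gauss2_test.
- exact: itg_gauss2_test.
- exact: (gauss2_ibp dir0 s0 t0).
- exact: (gauss2_ibp dir1 s0 t1).
Qed.

End gaussian_identities.

Section itg_extra.
Context d {T : measurableType d} {R : realType} (mu : {measure set T -> \bar R}).

Lemma eq_itg (f g : T -> R) : f =1 g -> itg mu f -> itg mu g.
Proof. by move=> fg; apply: eq_integrable => // x _ /=; rewrite fg. Qed.

Lemma itg0 : itg mu (cst 0).
Proof. exact: integrable0. Qed.

Lemma Rint0 : \int[mu]_x (cst 0 x : R) = 0.
Proof. by rewrite /Rintegral integral0_eq. Qed.

End itg_extra.

Section green_kernel.
Context {R : realType}.
Local Notation lambda := (@lebesgue_measure R).
Local Notation mu := (leb2 R).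

(** The damping factor [e^(- k t)] at [t = r^4]. *)
Definition decay (k r : R) : R := expR (- (k * r ^+ 4)).

Lemma decay_gt0 k r : 0 < decay k r. Proof. exact: expR_gt0. Qed.

Lemma measurable_decay k : measurable_fun setT (decay k).
Proof.
apply: measurableT_comp => //; apply: measurableT_comp => //.
by apply: measurable_funM => //; exact: measurable_funX.
Qed.

(** One of two equal factors [decay (k / 2) r] absorbs the polynomial through [1 + y <= e^y]. The
    constant is chosen so that [(1 + 2 / k) (1 + (k / 2) r^4)] exceeds [1 + r^4]. *)
Lemma decay_poly_le (k r : R) : 0 < k ->
  (1 + r ^+ 4) * decay k r <= (1 + 2 / k) * decay (k / 2) r.
Proof.
move=> k0; have k20 : 0 < k / 2 by rewrite divr_gt0.
have -> : decay k r = decay (k / 2) r * decay (k / 2) r.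
  by rewrite /decay -expRD; congr expR; field.
rewrite mulrA ler_pM2r ?decay_gt0// /decay expRN ler_pdivrMr ?expR_gt0//.
have r4 : 0 <= r ^+ 4 by rewrite exprn_even_ge0.
have H := expR_ge1Dx (k / 2 * r ^+ 4).
apply: (@le_trans _ _ ((1 + 2 / k) * (1 + k / 2 * r ^+ 4))); last first.
  by rewrite ler_pM2l// ltr_wpDr// divr_ge0// ltW.
have -> : (1 + 2 / k) * (1 + k / 2 * r ^+ 4) = 1 + r ^+ 4 + (2 / k + k / 2 * r ^+ 4).
  by field; rewrite gt_eqF.
by rewrite lerDl; apply: addr_ge0; [rewrite divr_ge0 ?ltW|rewrite mulr_ge0 ?(ltW k20)].
Qed.

(** A common integrable bound for [r ^+ m * decay k r] with [m <= 4] and [0 <= r]. *)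
Definition decay_dom (k r : R) := (1 + r ^+ 4) * decay k r.

Lemma decay_dom_ge0 k r : 0 <= decay_dom k r.
Proof. by rewrite mulr_ge0 ?(ltW (decay_gt0 _ _))// addr_ge0// exprn_even_ge0. Qed.

Lemma itg_decay_dom k : 0 < k -> itg lambda (decay_dom k).
Proof.
move=> k0; have k20 : 0 < k / 2 by rewrite divr_gt0.
apply: (itg_le _ _ (itgZ (1 + 2 / k) (expR_quartic_itg k20))).
  by apply: measurable_funM; [apply: measurable_funD => //; exact: measurable_funX|exact: measurable_decay].
by move=> r; rewrite ger0_norm ?decay_dom_ge0//; exact: decay_poly_le.
Qed.

Definition rinv (r : R) : R := if 0 < r then r^-1 else 0.

Lemma rinv_ge0 r : 0 <= rinv r.
Proof. by rewrite /rinv; case: ifPn => // r0; rewrite invr_ge0 ltW. Qed.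

Lemma measurable_rinv : measurable_fun setT rinv.
Proof.
apply: measurable_fun_if => //; first exact: measurable_fun_ltr.
rewrite setTI (_ : _ @^-1` _ = `]0, +oo[%classic); last first.
  by apply/seteqP; split => r /=; rewrite in_itv /= andbT.
apply: open_continuous_measurable_fun; first exact: interval_open.
move=> r; rewrite inE /= in_itv /= andbT => r0.
by apply: inv_continuous; rewrite gt_eqF.
Qed.

(* The integrand of [int_0^oo e^(-k t) (1 / t) e^(- |x|^2 / (4 t)) dt] after the
   substitution [t = r^4], extended by 0 to [r <= 0]; the missing factor
   [1 / (4 pi)] is [gmass^-1]. *)
Definition kern (k : R) (p : mplane R * measurableTypeR R) : R :=
  4 * rinv p.2 * decay k p.2 * gauss2 (scl (rinv p.2 ^+ 2) p.1).

Lemma kern_ge0 k p : 0 <= kern k p.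
Proof.
by rewrite /kern mulr_ge0 ?(ltW (gauss2_gt0 _))// mulr_ge0 ?(ltW (decay_gt0 _ _))// mulr_ge0 ?rinv_ge0.
Qed.

Lemma measurable_gauss2 : measurable_fun setT (@gauss2 R).
Proof. exact: itg_measurable itg_gauss2. Qed.

Lemma measurable_scl_joint (a : R -> R) (h : mplane R -> R) :
  measurable_fun setT a -> measurable_fun setT h ->
  measurable_fun setT (fun p : mplane R * measurableTypeR R => h (scl (a p.2) p.1)).
Proof.
move=> ma mh; apply: (measurableT_comp mh).
have ma2 : measurable_fun setT (fun p : mplane R * measurableTypeR R => a p.2).
  exact: measurableT_comp ma measurable_snd.
apply: measurable_fun_pair; apply: measurable_funM => //.
  exact: (measurableT_comp measurable_fst measurable_fst).
exact: (measurableT_comp measurable_snd measurable_fst).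
Qed.

Lemma measurable_kern k : measurable_fun setT (kern k).
Proof.
have m2 : measurable_fun setT (fun p : mplane R * measurableTypeR R => rinv p.2).
  exact: measurableT_comp measurable_rinv measurable_snd.
apply: measurable_funM; last first.
  by apply: (measurable_scl_joint (a := fun r => rinv r ^+ 2)) measurable_gauss2; apply: measurable_funX; exact: measurable_rinv.
apply: measurable_funM; first exact: measurable_funM.
exact: measurableT_comp (measurable_decay k) measurable_snd.
Qed.

Lemma kern_pos k (x : mplane R) (r : R) : 0 < r ->
  kern k (x, r) = 4 / r * decay k r * gauss2 (scl (r^-1 ^+ 2) x).
Proof. by move=> r0; rewrite /kern /= /rinv r0. Qed.

Lemma kern_npos k (x : mplane R) (r : R) : r <= 0 -> kern k (x, r) = 0.
Proof. by move=> r0; rewrite /kern /= /rinv ltNge r0 /= mulr0 !mul0r. Qed.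

Lemma sclK (s : R) (z : mplane R) : s != 0 -> scl s^-1 (scl s z) = z.
Proof. by move=> s0; rewrite /scl /= !mulKf//; case: z. Qed.

Lemma scl_itg s (h : mplane R -> R) : 0 < s -> itg mu h -> itg mu (fun x => h (scl s x)).
Proof. by move=> s0 /(itg_aff2 0 s0); apply: eq_integrable => // x _ /=; rewrite scl_aff2. Qed.

Lemma kern_slice_itg k (h : mplane R -> R) (C r : R) : measurable_fun setT h ->
  (forall x, `|h x| <= C) -> itg mu (fun x => kern k (x, r) * h x).
Proof.
move=> mh hC; have [r0|r0] := ltP 0 r; last first.
  by apply: (eq_itg _ (itg0 mu)) => x; rewrite kern_npos// mul0r.
have r20 : 0 < r^-1 ^+ 2 by rewrite exprn_gt0// invr_gt0.
have gi := itgZ (C * (4 / r * decay k r)) (scl_itg r20 itg_gauss2).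
apply: itg_le gi.
  apply: measurable_funM => //; under eq_fun do rewrite kern_pos//.
  by apply: measurable_funM => //; exact: measurableT_comp measurable_gauss2 (measurable_scl _).
move=> x; rewrite normrM ger0_norm ?kern_ge0// mulrC -[leRHS]mulrA -kern_pos//.
by rewrite ler_wpM2r ?kern_ge0.
Qed.

(** Under [x = r^2 z] the Jacobian [r^4] turns the prefactor [4 / r] into [4 r^3], the density of
    [dt] for [t = r^4]. *)
Lemma kern_slice k (h : mplane R -> R) (C r : R) : 0 < r -> measurable_fun setT h ->
  (forall x, `|h x| <= C) ->
  \int[mu]_x (kern k (x, r) * h x) =
  4 * r ^+ 3 * decay k r * \int[mu]_z (gauss2 z * h (scl (r ^+ 2) z)).
Proof.
move=> r0 mh hC; have r20 : 0 < r ^+ 2 by rewrite exprn_gt0.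
rewrite (Rint_scl r20 (kern_slice_itg k r mh hC)).
rewrite (eq_Rint _ (g := fun z => 4 / r * decay k r * (gauss2 z * h (scl (r ^+ 2) z)))); last first.
  move=> z; rewrite kern_pos// exprVn sclK; last by rewrite gt_eqF.
  by rewrite [RHS]mulrA.
rewrite RintZ; first by field; rewrite gt_eqF.
apply: (@itg_le _ _ _ _ _ (fun z => C * gauss2 z)); last exact: itgZ itg_gauss2.
  by apply: measurable_funM; [exact: measurable_gauss2|exact: measurableT_comp mh (measurable_scl _)].
by move=> z; rewrite normrM (gtr0_norm (gauss2_gt0 z)) mulrC ler_pM2r ?gauss2_gt0.
Qed.

Definition gmass : R := \int[mu]_z gauss2 z.

Lemma gmass_gt0 : 0 < gmass.
Proof.
rewrite lt_def; apply/andP; split; last by apply: Rintegral_ge0 => z _; exact/ltW/gauss2_gt0.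
apply/eqP => m0; have := nneg_integral_eq0 (fun z => ltW (gauss2_gt0 z)) itg_gauss2 m0.
have g0 := gauss2_gt0.
move=> /(@ae_plane_imp _ _ (fun=> False)) H.
have {}H : mu.-negligible (setT : set (mplane R)).
  by rewrite -setC0; apply: H => x g; have := g0 _ x; rewrite g ltxx.
have T0 := measure_negligible measurableT H.
have : (mu (ocrect 0 1 0 1) <= 0)%E by rewrite -T0; apply: le_measure; rewrite ?inE//; exact: measurable_ocrect.
rewrite (_ : mu _ = lebesgue_measure `]0%R, 1%R]%classic * lebesgue_measure `]0%R, 1%R]%classic)%E;
  last by rewrite -product_measure1E//; exact: measurable_itv.
by rewrite !lebesgue_measure_itv /= lte_fin ltr01 -!EFinB -EFinM lee_fin subr0 mulr1 ler10.
Qed.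

End green_kernel.

Section kernel_powers.
Context {R : realType}.
Variable k : R.
Hypothesis k0 : 0 < k.
Local Notation lambda := (@lebesgue_measure R).
Local Notation mu := (leb2 R).
Local Notation smu := (@sleb2 R).
Variable n : nat.
Hypothesis n4 : (0 < n <= 4)%N.

Lemma pow_le_1D4 (m : nat) (r : R) : (m <= 4)%N -> 0 <= r -> r ^+ m <= 1 + r ^+ 4.
Proof.
move=> m4 r0; have [r1|r1] := leP r 1.
  by rewrite (le_trans (exprn_ile1 _ r0 r1))// lerDl exprn_ge0.
by rewrite (le_trans (ler_weXn2l (ltW r1) m4))// lerDr.
Qed.

(** The density of the kernel with respect to the weight [decay k r dr], the form in which Jensen's
    inequality is applied. *)
Definition ratio (p : mplane R * measurableTypeR R) : R :=
  4 * rinv p.2 * gauss2 (scl (rinv p.2 ^+ 2) p.1).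

Lemma kern_ratio p : kern k p = decay k p.2 * ratio p.
Proof. by rewrite /kern /ratio mulrA (mulrC (decay k p.2)). Qed.

Lemma ratio_ge0 p : 0 <= ratio p.
Proof. by rewrite mulr_ge0 ?(ltW (gauss2_gt0 _))// mulr_ge0 ?rinv_ge0. Qed.

Lemma measurable_ratio : measurable_fun setT ratio.
Proof.
have m2 : measurable_fun setT (fun p : mplane R * measurableTypeR R => rinv p.2).
  exact: measurableT_comp (@measurable_rinv R) measurable_snd.
apply: measurable_funM; first exact: measurable_funM.
by apply: (measurable_scl_joint (a := fun r => rinv r ^+ 2)) (@measurable_gauss2 R); apply: measurable_funX; exact: measurable_rinv.
Qed.

Definition kern_power (p : mplane R * measurableTypeR R) : R := decay k p.2 * ratio p ^+ n.

Lemma kern_power_ge0 p : 0 <= kern_power p.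
Proof. by rewrite mulr_ge0 ?(ltW (decay_gt0 _ _))// exprn_ge0// ratio_ge0. Qed.

Lemma gauss2_le1 (z : mplane R) : gauss2 z <= 1.
Proof.
have g1 (t : R) : gaussian t <= 1 by rewrite /gaussian expR_le1 oppr_le0 divr_ge0// sqr_ge0.
by rewrite /gauss2 /tens mulr_ile1// ltW// gaussian_gt0.
Qed.

Lemma itg_gauss2X : itg mu (fun z => gauss2 z ^+ n).
Proof.
apply: (itg_le _ _ (@itg_gauss2 R)); first by apply: measurable_funX; exact: measurable_gauss2.
move=> z; have g0 := ltW (gauss2_gt0 z); rewrite ger0_norm ?exprn_ge0//.
by case: n n4 => // m _; rewrite exprS ler_piMr// exprn_ile1// gauss2_le1.
Qed.

Lemma measurable_kern_power : measurable_fun setT kern_power.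
Proof.
apply: measurable_funM; first exact: measurableT_comp (measurable_decay k) measurable_snd.
by apply: measurable_funX; exact: measurable_ratio.
Qed.

(** The n-th power contributes [r^(- n)] and the Jacobian of [x = r^2 z] contributes [r^4]. The
    exponent [4 - n] is nonnegative because [n <= 4], so there is no singularity at [r = 0]. *)
Lemma kern_power_slice (r : R) : itg mu (fun x => kern_power (x, r)) /\
  \int[mu]_x kern_power (x, r) <= 4 ^+ n * (\int[mu]_z gauss2 z ^+ n) * decay_dom k r.
Proof.
have g0 : 0 <= \int[mu]_z gauss2 z ^+ n by apply: Rintegral_ge0 => z _; rewrite exprn_ge0// ltW// gauss2_gt0.
have [r0|r0] := ltP 0 r; last first.
  have E x : kern_power (x, r) = 0.
    rewrite /kern_power /ratio /= /rinv ltNge r0 /= mulr0 mul0r expr0n.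
    by case: n n4 => //= m _; rewrite mulr0.
  split; first by apply: (eq_itg _ (itg0 mu)) => x; rewrite E.
  rewrite (eq_Rint mu (g := cst 0)) ?Rint0//.
  by rewrite mulr_ge0 ?decay_dom_ge0// mulr_ge0// exprn_ge0.
have r20 : 0 < r^-1 ^+ 2 by rewrite exprn_gt0// invr_gt0.
have r2 : 0 < r ^+ 2 by rewrite exprn_gt0.
have E x : kern_power (x, r) = (4 / r) ^+ n * decay k r * gauss2 (scl (r^-1 ^+ 2) x) ^+ n.
  by rewrite /kern_power /ratio /= /rinv r0 exprMn; ring.
have gi := scl_itg r20 itg_gauss2X.
have ki : itg mu (fun x => kern_power (x, r)).
  by apply: (eq_itg _ (itgZ ((4 / r) ^+ n * decay k r) gi)) => x; rewrite E.
split => //.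
rewrite (eq_Rint _ E) (RintZ _ gi) (Rint_scl r2 gi).
rewrite (eq_Rint _ (g := fun z => gauss2 z ^+ n)); last first.
  by move=> z; rewrite exprVn sclK// gt_eqF.
have -> : (4 / r) ^+ n * decay k r * (r ^+ 2 ^+ 2 * \int[mu]_x gauss2 x ^+ n) =
   4 ^+ n * (\int[mu]_x gauss2 x ^+ n) * ((r^-1 ^+ n * r ^+ 4) * decay k r).
  by rewrite exprMn -exprM; ring.
apply: ler_wpM2l; first by rewrite mulr_ge0// exprn_ge0.
rewrite ler_pM2r ?decay_gt0//.
have [_ n4'] := andP n4.
have -> : r^-1 ^+ n * r ^+ 4 = r ^+ (4 - n).
  by rewrite -[in r ^+ 4](subnK n4') exprD exprVn mulrCA mulVf ?mulr1// gt_eqF// exprn_gt0.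
by apply: pow_le_1D4; [exact: leq_subr|exact: ltW].
Qed.

Lemma itg_kern_power : itg (smu \x lambda)%E kern_power.
Proof.
apply: (itg_prod_dom (m1 := smu) (m2 := lambda) measurable_kern_power _
  (itgZ (4 ^+ n * (\int[mu]_z gauss2 z ^+ n)) (itg_decay_dom k0))) => r.
have [ki kle] := kern_power_slice r; split => //.
by rewrite (eq_Rint smu (g := fun x => kern_power (x, r)))// => x; rewrite ger0_norm ?kern_power_ge0.
Qed.
End kernel_powers.

Section green_function.
Context {R : realType}.
Variable k : R.
Hypothesis k0 : 0 < k.
Local Notation lambda := (@lebesgue_measure R).
Local Notation mu := (leb2 R).
Local Notation smu := (@sleb2 R).

Lemma itg_kern : itg (smu \x lambda)%E (kern k).
Proof.
by apply: (eq_itg _ (itg_kern_power k0 (n := 1) isT)) => p; rewrite kern_ratio /kern_power expr1.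
Qed.

Definition green_e (x : mplane R) : R := (gmass)^-1 * \int[lambda]_r kern k (x, r).

Lemma measurable_green_e : measurable_fun setT green_e.
Proof.
apply: measurable_funM => //.
by apply: itg_measurable; exact: (Rint_fubini1 (m1 := smu) (m2 := lambda) itg_kern).1.
Qed.

Lemma green_e_ge0 x : 0 <= green_e x.
Proof.
rewrite mulr_ge0 ?invr_ge0 ?(ltW gmass_gt0)//.
by apply: Rintegral_ge0 => r _; exact: kern_ge0.
Qed.

Lemma itg_green_e : itg mu green_e.
Proof. by apply: itgZ; exact: (Rint_fubini1 (m1 := smu) (m2 := lambda) itg_kern).1. Qed.

Lemma green_e_Fubini (h : mplane R -> R) (C : R) : measurable_fun setT h ->
  (forall x, `|h x| <= C) ->
  \int[mu]_x (green_e x * h x) =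
  gmass^-1 * \int[lambda]_r \int[mu]_x (kern k (x, r) * h x).
Proof.
move=> mh hC.
have hi : itg (smu \x lambda)%E (fun p => kern k p * h p.1).
  apply: (itg_le _ _ (itgZ C itg_kern)).
    by apply: measurable_funM; [exact: measurable_kern|exact: measurableT_comp mh measurable_fst].
  by move=> p; rewrite normrM mulrC (ger0_norm (kern_ge0 k p)) ler_wpM2r ?kern_ge0.
have [i1 e1] := Rint_fubini1 (m1 := smu) (m2 := lambda) hi.
have [i2 e2] := Rint_fubini2 (m1 := smu) (m2 := lambda) hi.
have gh : itg mu (fun x => green_e x * h x).
  apply: (itg_le _ _ (itgZ C itg_green_e)).
    by apply: measurable_funM => //; exact: measurable_green_e.
  by move=> x; rewrite normrM mulrC (ger0_norm (green_e_ge0 x)) ler_wpM2r ?green_e_ge0.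
rewrite -[X in _ * X]/(\int[lambda]_r \int[smu]_x (kern k (x, r) * h x)) -e2 e1 -RintZ//.
have iz : itg mu (fun x => gmass^-1 * \int[lambda]_y (kern k (x, y) * h x)) := itgZ gmass^-1 i1.
apply/eqP; rewrite -subr_eq0 -RintB//.
apply/eqP/integral_ae0; last exact: (itg_measurable (itgB gh iz)).
(* Pulling [h x] out of the inner integral uses integrability of the section of [kern], which holds
   for almost every [x]. *)
have := ae_itg_section1 itg_kern.
apply: ae_plane_imp => x xi; rewrite /green_e.
rewrite [X in _ - _ * X](eq_Rint lambda (g := fun r => h x * kern k (x, r))); last first.
  by move=> r; rewrite mulrC.
by rewrite RintZ// -mulrA [h x * _]mulrC subrr.
Qed.
End green_function.

Section helmholtz.
Context {R : realType}.
Local Notation mu := (leb2 R).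
Variables (k : R) (f : R * R -> R).
Hypothesis tf : test_function f.

Definition helmholtz (x : mplane R) : R := - laplacian f x + k * f x.

Lemma sqi_laplacian : sqi mu (laplacian f).
Proof.
rewrite (funext (laplacianE f)).
by apply: sqiD; apply: test_sqi; do 2 apply: test_partial.
Qed.

Lemma sqi_helmholtz : sqi mu helmholtz.
Proof. by apply: sqiD; [exact/sqiN/sqi_laplacian|exact/sqiZ/test_sqi]. Qed.

Lemma bounded_laplacian : exists2 B : R, 0 < B & forall x, `|laplacian f x| <= B.
Proof.
have [B1 B10 H1] := test_bounded (test_partial dir0 (test_partial dir0 tf)).
have [B2 B20 H2] := test_bounded (test_partial dir1 (test_partial dir1 tf)).
exists (B1 + B2) => [|x]; first exact: addr_gt0.
by rewrite laplacianE (le_trans (ler_normD _ _))// lerD.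
Qed.

Lemma bounded_helmholtz : exists2 B : R, 0 < B & forall x, `|helmholtz x| <= B.
Proof.
have [B0 B00 H0] := test_bounded tf; have [B1 B10 H1] := bounded_laplacian.
exists (B1 + `|k| * B0) => [|x]; first by rewrite ltr_wpDr// mulr_ge0// ltW.
by rewrite (le_trans (ler_normD _ _))// normrN lerD// normrM ler_wpM2l.
Qed.

End helmholtz.

(** * The explicit kernel solves the equation *)

Section green_solution.
Context {R : realType}.
Variable k : R.
Hypothesis k0 : 0 < k.
Variable f : R * R -> R.
Hypothesis tf : test_function f.
Local Notation lambda := (@lebesgue_measure R).
Local Notation mu := (leb2 R).
Local Notation smu := (@sleb2 R).

(* [- d/dr (decay k r * f (r^2 z))] *)
Definition flow_rate (z : mplane R) (r : R) : R :=
  2 * r * decay k r * (2 * k * r ^+ 2 * f (scl (r ^+ 2) z) -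
    z.1 * partial_derivative dir0 f (scl (r ^+ 2) z) -
    z.2 * partial_derivative dir1 f (scl (r ^+ 2) z)).

(** Because [flow_rate z 0] vanishes through its factor [r], the maximum extends the rate by 0 to
    negative [r]. *)
Definition flow (p : mplane R * measurableTypeR R) : R :=
  gauss2 p.1 * flow_rate p.1 (Num.max p.2 0).

Lemma measurable_flow : measurable_fun setT flow.
Proof.
have mg : measurable_fun setT (fun p : mplane R * measurableTypeR R => gauss2 p.1).
  exact: measurableT_comp (@measurable_gauss2 R) measurable_fst.
have m0 : measurable_fun setT (fun r : R => Num.max r 0) by exact: measurable_maxr.
have mm : measurable_fun setT (fun p : mplane R * measurableTypeR R => Num.max p.2 0).
  exact: measurableT_comp m0 measurable_snd.
have ms h : test_function h -> measurable_fun setT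
    (fun p : mplane R * measurableTypeR R => h (scl (Num.max p.2 0 ^+ 2) p.1)).
  move=> th; apply: (measurable_scl_joint (a := fun r => Num.max r 0 ^+ 2)); last exact: test_measurable th.
  exact: measurable_funX.
have md : measurable_fun setT (fun p : mplane R * measurableTypeR R => decay k (Num.max p.2 0)).
  exact: measurableT_comp (measurable_decay k) mm.
have m1 : measurable_fun setT (fun p : mplane R * measurableTypeR R => p.1.1).
  exact: measurableT_comp measurable_fst measurable_fst.
have m2 : measurable_fun setT (fun p : mplane R * measurableTypeR R => p.1.2).
  exact: measurableT_comp measurable_snd measurable_fst.
have mf := ms _ tf; have mf0 := ms _ (test_partial dir0 tf); have mf1 := ms _ (test_partial dir1 tf).
have i0 := measurable_funM (measurable_funM (@measurable_cst _ _ _ _ setT (2 * k)) (measurable_funX 2 mm)) mf.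
have i1 := measurable_funM m1 mf0; have i2 := measurable_funM m2 mf1.
have i3 := measurable_funM (measurable_funM (@measurable_cst _ _ _ _ setT (2 : R)) mm) md.
exact: (measurable_funM mg (measurable_funM i3 (measurable_funB (measurable_funB i0 i1) i2))).
Qed.

Lemma flow_rate_bound : exists C : R, forall (z : mplane R) (r : R), 0 <= r ->
  `|flow_rate z r| <= C * decay_dom k r * (1 + `|z.1| + `|z.2|).
Proof.
have [B0 B00 H0] := test_bounded tf.
have [B1 B10 H1] := test_bounded (test_partial dir0 tf).
have [B2 B20 H2] := test_bounded (test_partial dir1 tf).
pose B := B0 + B1 + B2.
have B_ge0 : 0 <= B by rewrite addr_ge0 ?addr_ge0// ltW.
(* The bound comes from [2 r B (2 k r^2 + 1) = 2 B (2 k r^3 + r)], where both [r] and [r^3] are at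
   most [1 + r^4]. *)
exists (2 * B * (2 * k + 1)) => z r r0.
rewrite /flow_rate !normrM (ger0_norm r0) (gtr0_norm (decay_gt0 k r)) (ger0_norm (ler0n R 2)).
set a := f _; set b := partial_derivative dir0 f _; set c := partial_derivative dir1 f _.
have ha : `|a| <= B by rewrite (le_trans (H0 _))// /B -addrA lerDl addr_ge0// ltW.
have hb : `|b| <= B by rewrite (le_trans (H1 _))// /B addrAC lerDr addr_ge0// ltW.
have hc : `|c| <= B by rewrite (le_trans (H2 _))// /B lerDr addr_ge0// ltW.
clearbody a b c.
have z1 := normr_ge0 z.1; have z2 := normr_ge0 z.2.
have I : `|2 * k * r ^+ 2 * a - z.1 * b - z.2 * c| <= B * (2 * k * r ^+ 2 + 1) * (1 + `|z.1| + `|z.2|).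
  apply: (le_trans (ler_normB _ _)); apply: (le_trans (lerD (ler_normB _ _) (lexx _))).
  have kr : 0 <= 2 * k * r ^+ 2 by rewrite mulr_ge0 ?sqr_ge0// mulr_ge0// ltW.
  rewrite (normrM _ a) (ger0_norm kr) (normrM _ b) (normrM _ c).
  have e1 := ler_wpM2l kr ha; have e2 := ler_wpM2l z1 hb; have e3 := ler_wpM2l z2 hc.
  have e4 := mulr_ge0 kr (mulr_ge0 B_ge0 z1); have e5 := mulr_ge0 kr (mulr_ge0 B_ge0 z2).
  by nra.
have d0 := decay_gt0 k r.
have e1 := @pow_le_1D4 R 1 r isT r0; have e3 := @pow_le_1D4 R 3 r isT r0.
rewrite expr1 in e1.
have Z0 : 0 <= 1 + `|z.1| + `|z.2| by rewrite addr_ge0// addr_ge0.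
have rd : 0 <= 2 * r * decay k r by rewrite mulr_ge0 ?(ltW d0)// mulr_ge0.
apply: (le_trans (ler_wpM2l rd I)).
rewrite /decay_dom [leLHS]mulrA ler_wpM2r//.
have -> : 2 * r * decay k r * (B * (2 * k * r ^+ 2 + 1)) = 2 * B * (2 * k * r ^+ 3 + r) * decay k r by ring.
rewrite [leRHS]mulrA ler_pM2r// -[leRHS]mulrA ler_wpM2l ?mulr_ge0//.
by rewrite [leRHS]mulrDl mul1r lerD// ler_pM2l// mulr_gt0.
Qed.

Lemma itg_flow : itg (smu \x lambda)%E flow.
Proof.
have [C HC] := flow_rate_bound.
have mf := measurable_flow.
have i1 := itgZ C (itg_tensor (m1 := smu) (m2 := lambda) (@itg_gauss2_dom R) (itg_decay_dom k0)).
apply: itg_le mf _ i1 => -[z r] /=; rewrite /flow /= normrM (gtr0_norm (gauss2_gt0 z)).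
have C0 : 0 <= C.
  have := le_trans (normr_ge0 _) (HC 0 0 (lexx _)); rewrite /= !normr0 !addr0 mulr1.
  by rewrite /decay_dom /decay expr0n /= mulr0 oppr0 expR0 addr0 !mulr1.
have [r0|r0] := ltP r 0; last first.
  apply: (le_trans (ler_wpM2l (ltW (gauss2_gt0 z)) (HC z r r0))).
  by rewrite /gauss2_dom le_eqVlt; apply/orP; left; apply/eqP; ring.
rewrite (_ : flow_rate z 0 = 0); last by rewrite /flow_rate mulr0 !mul0r.
by rewrite normr0 mulr0 mulr_ge0// mulr_ge0 ?gauss2_dom_ge0// decay_dom_ge0.
Qed.

Lemma flow_slice (r : R) :
  \int[mu]_x (kern k (x, r) * helmholtz k f x) = \int[mu]_z flow (z, r).
Proof.
have t0 := test_partial dir0 tf; have t1 := test_partial dir1 tf.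
have [r0|r0] := ltP 0 r; last first.
  rewrite (eq_Rint mu (g := cst 0)); last by move=> x; rewrite kern_npos// mul0r.
  rewrite Rint0 (eq_Rint mu (g := cst 0)) ?Rint0// => z.
  by rewrite /flow /= (max_idPr r0) /flow_rate mulr0 !mul0r mulr0.
have [B _ bl] := bounded_helmholtz k tf.
have [ml _] := sqi_helmholtz k tf.
have r20 : 0 < r ^+ 2 by rewrite exprn_gt0.
rewrite (kern_slice k r0 ml bl).
(* With the scale [s = r^2], this isolates the factor [2 * s] of [gauss2_heat]. *)
have -> : 4 * r ^+ 3 * decay k r = 2 * r * decay k r * (2 * r ^+ 2) by ring.
rewrite -mulrA (mulrC (2 * r ^+ 2)) gauss2_heat//.
rewrite -RintZ; last first.
  apply: eq_itg (itgB (itgB (itgZ (2 * k * r ^+ 2) (itg_gauss2_test (r ^+ 2) tf)) (itg_gauss2_test0 (r ^+ 2) t0)) (itg_gauss2_test1 (r ^+ 2) t1)).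
  by move=> z; rewrite !mulrBr [in RHS]mulrCA.
apply: eq_Rint => z; rewrite /flow /= (max_idPl (ltW r0)) /flow_rate.
by rewrite mulrCA.
Qed.

Lemma is_derive_decay (r : R) : is_derive r (1 : R) (decay k) (- (4 * k * r ^+ 3) * decay k r).
Proof.
rewrite mulrC; apply: (@is_derive1_comp R expR (fun t => - (k * t ^+ 4))).
rewrite (_ : - (4 * k * r ^+ 3) = - k * (4 * r ^+ 3)); last by ring.
rewrite (_ : (fun t => _) = fun t => - k * t ^+ 4); last by apply/funext => t; rewrite mulNr.
exact: (is_derive_cmul (- k) (is_derive_exprn 4) r).
Qed.

Lemma is_derive_test_scl (z : mplane R) h : test_function h -> forall r : R,
  is_derive r (1 : R) (fun t => h (scl (t ^+ 2) z))
    (2 * r * z.1 * partial_derivative dir0 h (scl (r ^+ 2) z) +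
     2 * r * z.2 * partial_derivative dir1 h (scl (r ^+ 2) z)).
Proof.
move=> th r; have dz (c : R) : is_derive r 1 (fun t : R => t ^+ 2 * c) (2 * r * c).
  have := is_derive_cmul c (is_derive_exprn 2) r.
  rewrite expr1 (mulrC c) => H.
  by rewrite (_ : (fun t => _) = fun t => c * t ^+ 2)//; apply/funext => t; rewrite mulrC.
exact: (test_chain (p' := fun r => 2 * r * z.1) (q' := fun r => 2 * r * z.2) th (dz z.1) (dz z.2)).
Qed.

Lemma is_derive_flow (z : mplane R) (r : R) :
  is_derive r (1 : R) (fun t => decay k t * f (scl (t ^+ 2) z)) (- flow_rate z r).
Proof.
have dc := is_derive_test_scl z tf r.
have := is_deriveM (is_derive_decay r) dc.
rewrite /GRing.scale /= => H; apply: is_derive_eq; rewrite /flow_rate /scl.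
set a := f _; set b := partial_derivative dir0 f _; set c := partial_derivative dir1 f _.
by clearbody a b c; ring.
Qed.

Lemma continuous_flow_rate (z : mplane R) : continuous (flow_rate z).
Proof.
have cX n : continuous (fun r : R => r ^+ n) by exact: exprn_continuous.
have cs h : test_function h -> continuous (fun r : R => h (scl (r ^+ 2) z)).
  by move=> th; exact: derive_continuous (is_derive_test_scl z th).
have cd : continuous (decay k) := derive_continuous is_derive_decay.
move=> r; apply: cvgM; first by apply: cvgM; [apply: cvgMl_tmp; exact: cvg_id|exact: cd].
apply: cvgB; last by apply: cvgMl_tmp; exact: cs (test_partial dir1 tf) r.
apply: cvgB; last by apply: cvgMl_tmp; exact: cs (test_partial dir0 tf) r.
by apply: cvgM; [apply: cvgMl_tmp; exact: cX|exact: cs].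
Qed.

(** The rate is minus the derivative of [decay k r * f (r^2 z)], which equals [f 0] at [r = 0] and
    vanishes for large [r], since [r^2 z] leaves the support when [z] is nonzero. *)
Lemma flow_line (z : mplane R) : z != 0 -> \int[lambda]_r flow (z, r) = gauss2 z * f 0.
Proof.
move=> z0; have z00 : 0 < `|z| by rewrite normr_gt0.
have [M M0 HM] := test_bsupp tf.
have [M1 M10 HM1] := test_bsupp (test_partial dir0 tf).
have [M2 M20 HM2] := test_bsupp (test_partial dir1 tf).
(* The summand 1 gives [S >= 1], so [r^2 >= r >= S] beyond [S], and [r^2 z] lies outside all three
   supports. *)
pose S := (M + M1 + M2) / `|z| + 1.
have MM : 0 <= M + M1 + M2 by rewrite addr_ge0 ?addr_ge0// ltW.
have S1 : 1 <= S by rewrite lerDr divr_ge0// ltW.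
have S0 : 0 < S by rewrite (lt_le_trans ltr01).
have far r : S <= r -> M + M1 + M2 < `|scl (r ^+ 2) z|.
  move=> Sr; have r1 : 1 <= r by rewrite (le_trans S1).
  have -> : scl (r ^+ 2) z = r ^+ 2 *: z by [].
  rewrite normrZ ger0_norm ?sqr_ge0// -ltr_pdivrMr//.
  apply: (@lt_le_trans _ _ S); first by rewrite ltrDl.
  by rewrite (le_trans Sr)// expr2 ler_peMr// (le_trans ler01).
have f0 r : S <= r -> f (scl (r ^+ 2) z) = 0.
  by move=> /far H; apply: HM; apply: le_lt_trans H; rewrite -addrA lerDl addr_ge0// ltW.
have rate0 r : S <= r -> flow_rate z r = 0.
  move=> Sr; have H := far r Sr.
  rewrite /flow_rate f0// HM1 ?HM2 ?mulr0 ?subrr ?mulr0//; apply: le_lt_trans H.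
    by rewrite lerDr addr_ge0// ltW.
  by rewrite addrAC lerDr addr_ge0// ltW.
have -> : \int[lambda]_r flow (z, r) = \int[lambda]_(r in `[0, S]) (gauss2 z * flow_rate z r).
  rewrite [RHS]Rintegral_mkcond; apply: eq_Rint => r; rewrite patchE.
  case: ifPn => [|]; rewrite ?inE /= ?in_itv /=.
    by move=> /andP[r0 _]; rewrite /flow /= (max_idPl r0).
  rewrite notin_setE /= in_itv /= => /negP; rewrite negb_and -!ltNge /flow /= => /orP[r0|Sr].
    by rewrite (max_idPr (ltW r0)) /flow_rate mulr0 !mul0r mulr0.
  by rewrite (max_idPl _) ?(le_trans (ltW S0) (ltW Sr))// rate0 ?mulr0// ltW.
have dg (r : R) := is_derive_cmul (- gauss2 z) (is_derive_flow z) r.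
have E : (fun r => - gauss2 z * - flow_rate z r) = (fun r => gauss2 z * flow_rate z r).
  by apply/funext => r; rewrite mulrNN.
rewrite -E (FTC2 S0 dg); last first.
  by rewrite E => r; apply: cvgMl_tmp; exact: continuous_flow_rate.
rewrite f0// !mulr0 sub0r mulNr opprK expr0n /= /decay expr0n /= mulr0 oppr0 expR0 mul1r.
by rewrite /scl !mul0r.
Qed.

Lemma ae_neq0 : \forall z \ae mu, z != 0.
Proof.
exists ([set 0] `*` [set 0])%classic; split.
- exact: measurableX.
- rewrite (_ : mu _ = lebesgue_measure [set 0%R]%classic * lebesgue_measure [set 0%R]%classic)%E;
    last by rewrite -product_measure1E.
  by rewrite lebesgue_measure_set1 mul0e.
- by move=> z /= /negP; rewrite negbK => /eqP ->.
Qed.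

(** Integrated over [z] at fixed [r], [flow] is the kernel slice tested against [helmholtz k f];
    integrated over [r] at fixed nonzero [z], it is [gauss2 z * f 0]. Exchanging the two orders
    leaves [gmass * f 0]. *)
Lemma green_e_solution : \int[mu]_x (green_e k x * helmholtz k f x) = f 0.
Proof.
have [B _ bl] := bounded_helmholtz k tf.
have [ml _] := sqi_helmholtz k tf.
rewrite (green_e_Fubini k0 ml bl).
rewrite [X in _ * X](eq_Rint lambda (g := fun r => \int[mu]_z flow (z, r)) flow_slice).
have [i1 e1] := Rint_fubini1 (m1 := smu) (m2 := lambda) itg_flow.
have [i2 e2] := Rint_fubini2 (m1 := smu) (m2 := lambda) itg_flow.
rewrite -[X in _ * X]/(\int[lambda]_r \int[smu]_z flow (z, r)) -e2 e1.
have i3 := itgZr (f 0) (@itg_gauss2 R).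
rewrite (_ : \int[smu]_z _ = \int[mu]_z (gauss2 z * f 0)); last first.
  apply/eqP; rewrite -subr_eq0 -RintB//.
  apply/eqP/integral_ae0; last exact: (itg_measurable (itgB i1 i3)).
  by apply: ae_plane_imp ae_neq0 => z z0; rewrite flow_line// subrr.
rewrite (eq_Rint _ (g := fun z => f 0 * gauss2 z)); last by move=> z; rewrite mulrC.
by rewrite RintZ ?itg_gauss2// mulrCA -/gmass mulVf ?mulr1// gt_eqF// gmass_gt0.
Qed.

End green_solution.

(** * Higher integrability of the kernel by Jensen's inequality *)

Section green_powers.
Context {R : realType}.
Variable k : R.
Hypothesis k0 : 0 < k.
Local Notation lambda := (@lebesgue_measure R).
Local Notation mu := (leb2 R).
Local Notation smu := (@sleb2 R).
Variable n : nat.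
Hypothesis n4 : (0 < n <= 4)%N.
(** Convexity in tangent-line form on the whole line; it is supplied for [n = 2] and [n = 4]. *)
Hypothesis tangent : forall y m : R, m ^+ n + n%:R * m ^+ n.-1 * (y - m) <= y ^+ n.

(* Jensen's inequality for the weight [decay k]: integrate the tangent line to
   the n-th power at the average. *)
Lemma green_e_power_le (x : mplane R) :
  itg lambda (fun r => kern k (x, r)) -> itg lambda (fun r => kern_power k n (x, r)) ->
  green_e k x ^+ n <= (gmass^-1 * (\int[lambda]_r decay k r + 1)) ^+ n *
     \int[lambda]_r kern_power k n (x, r).
Proof.
move=> ki pi; rewrite /green_e !exprMn -mulrA ler_wpM2l ?exprn_ge0 ?invr_ge0 ?(ltW gmass_gt0)//.
have di : itg lambda (decay k) := expR_quartic_itg k0.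
set W := \int[lambda]_r decay k r; set A := \int[lambda]_r kern k (x, r).
set P := \int[lambda]_r kern_power k n (x, r).
have W0 : 0 <= W by apply: Rintegral_ge0 => r _; exact/ltW/decay_gt0.
have A0 : 0 <= A by apply: Rintegral_ge0 => r _; exact/kern_ge0.
(* Dividing by [W + 1] avoids proving [W] positive. The tangent at [m = A / V] still gives
   [(W + n) * m ^+ n <= P], and [1 <= W + n]. *)
pose V := W + 1; have V0 : 0 < V by rewrite ltr_wpDl.
have V1 : 1 <= V by rewrite lerDr.
pose m := A / V; have m0 : 0 <= m by rewrite divr_ge0// ltW.
have : W * m ^+ n + n%:R * m ^+ n.-1 * (A - m * W) <= P.
  have i1 := itgB ki (itgZ m di).
  have i2 := itgD (itgZr (m ^+ n) di) (itgZ (n%:R * m ^+ n.-1) i1).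
  have -> : W * m ^+ n + n%:R * m ^+ n.-1 * (A - m * W) =
    \int[lambda]_r (decay k r * m ^+ n + n%:R * m ^+ n.-1 * (kern k (x, r) - m * decay k r)).
    rewrite RintD//; [|exact: itgZr|exact: itgZ].
    rewrite (RintZ (n%:R * m ^+ n.-1) i1) RintB//; last exact: itgZ.
    rewrite (RintZ m di) (eq_Rint lambda (g := fun r => m ^+ n * decay k r)); last by move=> r; rewrite mulrC.
    by rewrite (RintZ _ di) (mulrC (m ^+ n)).
  apply: le_Rintegral => // r _; rewrite kern_ratio /= /kern_power /=.
  have := ler_wpM2l (ltW (decay_gt0 k r)) (tangent (ratio (x, r)) m).
  by apply: le_trans; rewrite le_eqVlt; apply/orP; left; apply/eqP; ring.
have AV : A = m * V by rewrite divfK// gt_eqF.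
have mm : m ^+ n = m ^+ n.-1 * m by case: n n4 => // j _; rewrite exprSr.
have n1 : 1 <= n%:R :> R by case: n n4 => // j _; rewrite ler1n.
clearbody m; move=> H; rewrite -/V AV exprMn; move: H; rewrite AV.
have -> : W * m ^+ n + n%:R * m ^+ n.-1 * (m * V - m * W) = (W + n%:R * (V - W)) * m ^+ n.
  by rewrite mm; ring.
rewrite (_ : V - W = 1); last by rewrite /V addrC addKr.
rewrite mulr1 => H.
have mn0 : 0 <= m ^+ n by rewrite exprn_ge0.
rewrite mulrC ler_wpM2l ?exprn_ge0 ?(ltW V0)//.
apply: le_trans H; rewrite ler_peMl// (le_trans n1)// lerDr//.
Qed.

Lemma itg_green_eX : itg mu (fun x => green_e k x ^+ n).
Proof.
pose c := (gmass^-1 * (\int[lambda]_r decay k r + 1)) ^+ n.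
have [i1 _] := Rint_fubini1 (m1 := smu) (m2 := lambda) (itg_kern_power k0 n4).
have i2 : itg mu (fun x => c * \int[lambda]_r kern_power k n (x, r)) := itgZ c i1.
have mg : measurable_fun setT (fun x => green_e k x ^+ n).
  by apply: measurable_funX; exact: measurable_green_e.
apply/itgP; split => //.
apply: (@le_lt_trans _ _ (\int[mu]_x (`|c * \int[lambda]_r kern_power k n (x, r)|)%:E)%E); last first.
  by have [_] := (itgP _ _).1 i2.
apply: ae_ge0_le_integral => //.
- by apply/measurable_EFinP; exact: measurableT_comp.
- by apply/measurable_EFinP; apply: measurableT_comp => //; exact: itg_measurable i2.
apply: ae_plane_imp2 (ae_itg_section1 (m1 := smu) (m2 := lambda) (itg_kern k0)) (ae_itg_section1 (m1 := smu) (m2 := lambda) (itg_kern_power k0 n4)).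
move=> x h1 h2 _; rewrite lee_fin ger0_norm ?exprn_ge0 ?green_e_ge0//.
by apply: le_trans (ler_norm _); exact: green_e_power_le.
Qed.
End green_powers.

(** * Uniqueness of the Green's function *)

Section pairing.
Context {R : realType}.
Local Notation mu := (leb2 R).

Lemma norm_basis_dir i : `|basis_dir R i| = 1.
Proof.
by move: i; apply: ord2P; rewrite /basis_dir prod_normE /= ?eqxx /= normr0 normr1;
  [exact/max_idPl|exact/max_idPr].
Qed.

Lemma test_is_derive_line i f x (t : R) : test_function f ->
  is_derive t (1 : R) (fun s => f (x + s *: basis_dir R i))
    (partial_derivative i f (x + t *: basis_dir R i)).
Proof. by move=> tf; apply: is_derive_line; exact: test_is_derive. Qed.

Lemma test_line_lipschitz i f : test_function f -> exists2 B : R, 0 <= B &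
  forall x t, `|f (x + t *: basis_dir R i) - f x| <= B * `|t|.
Proof.
move=> tf; have [B B0 HB] := test_bounded (test_partial i tf).
exists B => [|x t]; first exact: ltW.
have [c _] := MVT_between 0 t (fun t => test_is_derive_line i x t tf).
by rewrite scale0r addr0 subr0 => ->; rewrite normrM ler_wpM2r.
Qed.

Lemma test_taylor2 i f : test_function f -> exists2 B : R, 0 <= B &
  forall x t, `|f (x + t *: basis_dir R i) - f x - t * partial_derivative i f x| <= B * t ^+ 2.
Proof.
move=> tf; have [B B0 HB] := test_line_lipschitz i (test_partial i tf).
exists B => // x t.
have [c + E] := MVT_between 0 t (fun t => test_is_derive_line i x t tf).
rewrite scale0r addr0 !subr0 in E * => ct; rewrite E mulrC -mulrBr normrM mulrC.
rewrite -[t ^+ 2]ger0_norm ?sqr_ge0// normrX expr2 mulrA ler_wpM2r//.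
by rewrite (le_trans (HB _ _))// ler_wpM2l.
Qed.

(** The remainder will be integrated against [D], which is only square-integrable, so its bound has
    to live on one fixed square for all small [t]. *)
Lemma test_taylor2_local i f : test_function f -> exists C M : R, 0 <= C /\
  forall x t, `|t| <= 1 ->
   `|f (x + t *: basis_dir R i) - f x - t * partial_derivative i f x| <=
     t ^+ 2 * (C * \1_(ocrect (- M) M (- M) M) x).
Proof.
move=> tf; have [B B0 HB] := test_taylor2 i tf.
have [N N0 HN] := test_bsupp tf; have [N' N'0 HN'] := test_bsupp (test_partial i tf).
(* One extra unit covers the step [|t| <= 1], the other the missing edges of the half-open
   square. *)
exists B, (N + N' + 2); split=> // x t t1.
rewrite indicE; case: (boolP (x \in _)) => [_|]; first by rewrite mulr1 [leRHS]mulrC; exact: HB.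
rewrite notin_setE => xM.
have Nx : N + N' + 1 < `|x|.
  rewrite ltNge; apply/negP => xN; apply: xM; split; rewrite /= in_itv /=.
    have h : `|x.1| < N + N' + 2 by rewrite (@le_lt_trans _ _ `|x|) ?prod_normE ?le_max ?lexx// -prod_normE; lra.
    by move: h; rewrite ltr_norml => /andP[-> /ltW].
  have h : `|x.2| < N + N' + 2 by rewrite (@le_lt_trans _ _ `|x|) ?prod_normE ?le_max ?lexx ?orbT// -prod_normE; lra.
  by move: h; rewrite ltr_norml => /andP[-> /ltW].
have Nxt : N < `|x + t *: basis_dir R i|.
  have := lerB_dist x (- (t *: basis_dir R i)).
  rewrite opprK normrN normrZ norm_basis_dir mulr1; lra.
rewrite HN// HN ?HN' ?mulr0 ?subrr ?normr0 ?mulr0//; lra.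
Qed.

(** A mollification of [D] by the test function [f]: it may be differentiated in [y] although [D]
    may not. *)
Definition pairing (D f : mplane R -> R) (y : mplane R) : R :=
  \int[mu]_x (D x * f ((x : R * R) + y)).

Variable D : mplane R -> R.
Hypothesis LD : sqi mu D.

Lemma itg_pairing f y : test_function f -> itg mu (fun x => D x * f ((x : R * R) + y)).
Proof. by move=> tf; apply: sqiM => //; apply: test_sqi; exact: test_shift. Qed.

Lemma pairing_bounded f : test_function f -> exists2 B : R, 0 < B & forall y, `|pairing D f y| <= B.
Proof.
move=> tf; have [_ D2] := LD; have [_ f2] := test_sqi tf.
exists ((\int[mu]_x D x ^+ 2 + \int[mu]_x f x ^+ 2) + 1) => [|y].
  by rewrite ltr_wpDl// addr_ge0//; apply: Rintegral_ge0 => x _; exact: sqr_ge0.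
have ii := itg_pairing y tf.
apply: (@le_trans _ _ (\int[mu]_x `|D x * f ((x : R * R) + y)|)); first exact: le_normr_Rintegral.
apply: (@le_trans _ _ (\int[mu]_x D x ^+ 2 + \int[mu]_x f x ^+ 2)); last by rewrite lerDl.
have f2y := itg_shift y f2.
rewrite -(Rint_shift y f2) -RintD//.
apply: le_Rintegral => //; [exact: itg_norm|exact: itgD|].
move=> x _; rewrite normrM -(real_normK (num_real (D x))) -(real_normK (num_real (f _))).
have := sqr_ge0 (`|D x| - `|f ((x : R * R) + y)|); have := mulr_ge0 (normr_ge0 (D x)) (normr_ge0 (f ((x : R * R) + y))).
by nra.
Qed.

(** Differentiation under the integral sign: the Taylor remainder of [f] is at most [h ^+ 2] times a
    fixed function that is integrable against [|D|]. *)
Lemma pairing_is_derive i f y : test_function f -> forall t : R,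
  is_derive t (1 : R) (fun s => pairing D f (y + s *: basis_dir R i))
    (pairing D (partial_derivative i f) (y + t *: basis_dir R i)).
Proof.
move=> tf t; set z := y + t *: _.
have tg := test_shift z tf; have tdf := test_partial i tf.
have [C [M [C0 HC]]] := test_taylor2_local i tg.
have mr := measurable_ocrect (- M) M (- M) M.
have bi : itg mu (fun x => `|D x| * (C * \1_(ocrect (- M) M (- M) M) x)).
  have := itg_norm (sqiM LD (sqiZ C (sqi_indic mr (leb2_ocrect_fin _ _ _ _)))).
  apply: eq_itg => x; rewrite normrM [X in _ * X]ger0_norm// mulr_ge0// indicE ler0n//.
pose K := \int[mu]_x (`|D x| * (C * \1_(ocrect (- M) M (- M) M) x)).
have K0 : 0 <= K by apply: Rintegral_ge0 => x _; rewrite mulr_ge0// mulr_ge0// indicE ler0n.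
apply: is_derive_lim.
have key h : `|h| <= 1 -> `|pairing D f (y + (h + t) *: basis_dir R i) - pairing D f z -
     h * pairing D (partial_derivative i f) z| <= h ^+ 2 * K.
  move=> h1; rewrite /pairing.
  have i1 := itg_pairing (y + (h + t) *: basis_dir R i) tf.
  have i2 := itg_pairing z tf; have i3 := itg_pairing z tdf.
  rewrite -RintB// -(RintZ h i3) -RintB; [|exact: itgB|exact: itgZ].
  have i4 := itgB (itgB i1 i2) (itgZ h i3).
  apply: (le_trans (le_normr_Rintegral _ i4)) => //.
  rewrite -(RintZ _ bi); apply: le_Rintegral => //; [exact: itg_norm|exact: itgZ|].
  move=> x _; rewrite mulrCA -mulrBr -mulrBr normrM [leRHS]mulrCA.
  apply: ler_wpM2l => //; have := HC x h h1; rewrite partial_shift//.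
  have -> : x + h *: basis_dir R i + z = (x : R * R) + (y + (h + t) *: basis_dir R i).
    by rewrite -addrA /z [h *: _ + (y + _)]addrCA -scalerDl.
  by [].
apply/cvgrPdist_le => e e0; near=> h.
have h0 : h != 0 by near: h; exact: nbhs_dnbhs_neq.
have h1 : `|h| <= 1 by near: h; exact: dnbhs0_le.
have he : `|h| <= e / (K + 1) by near: h; apply: dnbhs0_le; rewrite divr_gt0// ltr_wpDl.
rewrite (_ : h *: (1 : R) = h); last by rewrite /GRing.scale /= mulr1.
rewrite -/z distrC /GRing.scale /=.
have -> : h^-1 * (pairing D f (y + (h + t) *: basis_dir R i) - pairing D f z) -
    pairing D (partial_derivative i f) z =
    h^-1 * (pairing D f (y + (h + t) *: basis_dir R i) - pairing D f z -
     h * pairing D (partial_derivative i f) z).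
  by rewrite [RHS]mulrBr (mulrA h^-1 h) mulVf// mul1r.
rewrite normrM normfV ler_pdivrMl ?normr_gt0//.
apply: (le_trans (key h h1)); rewrite -[h ^+ 2]ger0_norm ?sqr_ge0// normrX expr2 -mulrA ler_wpM2l//.
apply: (@le_trans _ _ (e / (K + 1) * (K + 1))); last by rewrite divfK// gt_eqF// ltr_wpDl.
by rewrite ler_pM// lerDl.
Unshelve. all: by end_near. Qed.

End pairing.

(** If [l > 0], the difference quotients of [g'] at 0 are positive near 0. The mean value theorem
    then puts [g] above [g 0] at [e / 2] when [g' 0 >= 0], and at [- (e / 2)] otherwise. *)
Lemma second_derivative_max {R : realType} (g g' : R -> R) (l : R) :
  (forall x : R, is_derive x (1 : R) g (g' x)) -> is_derive (0 : R) (1 : R) g' l ->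
  (forall t, g t <= g 0) -> l <= 0.
Proof.
move=> dg dg' gmax; rewrite leNgt; apply/negP => l0.
have /cvgrPdist_lt/(_ l l0) : h^-1 *: (g' (h *: (1 : R) + 0) - g' 0) @[h --> 0^'] --> l by exact: is_derive_cvg.
move=> -[e /= e0 H].
have quot h : h != 0 -> `|h| < e -> 0 < h^-1 * (g' h - g' 0).
  move=> h0 he; have := H h; rewrite /= sub0r normrN => /(_ he h0).
  rewrite addr0 (_ : h *: (1 : R) = h); last by rewrite /GRing.scale /= mulr1.
  by rewrite ltr_norml => /andP[_]; rewrite ltrBlDr /GRing.scale /= -ltrBlDl subrr.
have cg a b : {within `[a, b], continuous g}.
  by apply: derivable_within_continuous => x _; case: (dg x).
have e20 : 0 < e / 2 by rewrite divr_gt0.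
have e2e : e / 2 < e by rewrite ltr_pdivrMr// mulr2n mulrDr mulr1 ltrDl.
have [p|n] := leP 0 (g' 0).
- have [c] := MVT e20 (fun x _ => dg x) (cg _ _); rewrite in_itv /= => /andP[c0 ce] E.
  have c1 : `|c| < e by rewrite gtr0_norm// (lt_trans ce).
  have := quot c; rewrite gt_eqF// => /(_ isT c1); rewrite pmulr_rgt0 ?invr_gt0// subr_gt0 => gc.
  have := gmax (e / 2); rewrite -subr_le0 E leNgt => /negP; apply.
  by rewrite subr0 mulr_gt0// (le_lt_trans p).
- have e20' : - (e / 2) < 0 by rewrite oppr_lt0.
  have [c] := MVT e20' (fun x _ => dg x) (cg _ _); rewrite in_itv /= => /andP[ec c0] E.
  have c1 : `|c| < e by rewrite ltr0_norm// (lt_trans _ e2e)// ltrNl.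
  have := quot c; rewrite lt_eqF// => /(_ isT c1); rewrite nmulr_rgt0 ?invr_lt0// subr_lt0 => gc.
  have := gmax (- (e / 2)); rewrite -subr_ge0 E leNgt => /negP; apply.
  by rewrite sub0r opprK pmulr_llt0// (lt_trans gc).
Qed.

Section green_uniqueness.
Context {R : realType}.
Local Notation mu := (leb2 R).
Variables (k : R) (D : mplane R -> R).
Hypothesis k0 : 0 < k.
Hypothesis LD : sqi mu D.

Lemma basis_decomp (y z : R * R) :
  z = y + (z.1 - y.1) *: basis_dir R dir0 + (z.2 - y.2) *: basis_dir R dir1.
Proof.
case: y z => [y1 y2] [z1 z2]; rewrite /basis_dir /=.
by congr (_, _); rewrite /= /GRing.scale /= ?mulr0 ?mulr1; ring.
Qed.

Lemma pairing_lipschitz f : test_function f -> exists2 B : R, 0 < B & forall y z : R * R,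
  `|pairing D f z - pairing D f y| <= B * `|z - y|.
Proof.
move=> tf.
have [B0 B00 H0] := pairing_bounded LD (test_partial dir0 tf).
have [B1 B10 H1] := pairing_bounded LD (test_partial dir1 tf).
exists (B1 + B0); first exact: addr_gt0.
move=> y z; pose w := y + (z.1 - y.1) *: basis_dir R dir0.
have step i B (u : R * R) t : (forall x, `|pairing D (partial_derivative i f) x| <= B) ->
    `|pairing D f (u + t *: basis_dir R i) - pairing D f u| <= B * `|t|.
  move=> HB; have [c _] := MVT_between 0 t (fun t => pairing_is_derive LD i u tf t).
  by rewrite scale0r addr0 subr0 => ->; rewrite normrM ler_wpM2r.
rewrite {1}(basis_decomp y z) -/w -(subrKA (pairing D f w)) mulrDl.
apply: (le_trans (ler_normD _ _)); apply: lerD.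
  apply: (le_trans (step _ B1 _ _ H1)); rewrite ler_pM2l//.
  by rewrite prod_normE le_max lexx orbT.
apply: (le_trans (step _ B0 _ _ H0)); rewrite ler_pM2l//.
by rewrite prod_normE le_max lexx.
Qed.

Lemma continuous_pairing f : test_function f -> continuous (pairing D f : R * R -> R).
Proof.
move=> tf y; have [B B0 HB] := pairing_lipschitz tf.
apply/cvgrPdist_le => e e0; near=> z.
rewrite distrC (le_trans (HB _ _))// -ler_pdivlMl// distrC.
near: z; have /cvgrPdist_le := @cvg_id _ (nbhs y); apply; rewrite mulr_gt0// invr_gt0.
Unshelve. all: by end_near. Qed.

Hypothesis orthD : forall f, test_function f -> \int[mu]_x (D x * helmholtz k f x) = 0.

Lemma pairing_helmholtz f y : test_function f ->
  pairing D (partial_derivative dir0 (partial_derivative dir0 f)) y +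
  pairing D (partial_derivative dir1 (partial_derivative dir1 f)) y = k * pairing D f y.
Proof.
move=> tf; have tg := test_shift y tf; have E := orthD tg.
have t0 := test_partial dir0 tf; have t1 := test_partial dir1 tf.
have t00 := test_partial dir0 t0; have t11 := test_partial dir1 t1.
have i0 := itg_pairing LD y t00; have i1 := itg_pairing LD y t11.
have i2 := itg_pairing LD y tf.
rewrite /pairing -RintD// -(RintZ k i2); apply/eqP; rewrite -subr_eq0 -oppr_eq0 -E.
rewrite -RintB; [|exact: itgD|exact: itgZ].
apply/eqP; rewrite -mulN1r -RintZ; last by apply: itgB; [exact: itgD|exact: itgZ].
apply: eq_Rint => x; rewrite /helmholtz laplacianE.
rewrite (partial_shift dir0 y tf) (partial_shift dir1 y tf) (partial_shift dir0 y t0) (partial_shift dir1 y t1).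
set a := partial_derivative dir0 _ _; set b := partial_derivative dir1 _ _.
by clearbody a b; ring.
Qed.

Definition sqnorm (y : R * R) : R := y.1 ^+ 2 + y.2 ^+ 2.
Definition coord (i : 'I_2) (y : R * R) : R := if i == dir0 then y.1 else y.2.

Lemma sqnorm_line i (y : R * R) (t : R) :
  sqnorm (y + t *: basis_dir R i) = sqnorm y + (2 * coord i y * t + t ^+ 2).
Proof.
case: y => a b; move: i; apply: ord2P; rewrite /sqnorm /coord /basis_dir /= /GRing.scale /=; ring.
Qed.

(* The quadratic penalty makes the maximum attained without any decay of the
   bounded function [pairing D f] at infinity. *)
Lemma max_penalized f e : test_function f -> 0 < e -> exists y : R * R,
  forall z : R * R, pairing D f z - e * sqnorm z <= pairing D f y - e * sqnorm y.
Proof.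
move=> tf e0; have [B B0 HB] := pairing_bounded LD tf.
pose h (z : R * R) := pairing D f z - e * sqnorm z.
(* Outside the square, [sqnorm z >= r^2 >= r], so the penalty is at least [e + 2 * B], more than the
   oscillation of [pairing D f]. *)
pose r := 1 + 2 * B / e; have r0 : 1 <= r by rewrite lerDl divr_ge0// ltW// mulr_gt0.
pose A := (`[- r, r] `*` `[- r, r])%classic : set (R * R).
have A0 : A 0 by split; rewrite /= in_itv /= oppr_le0 (le_trans ler01).
have ch : continuous h.
  move=> z; apply: cvgB; first exact: continuous_pairing.
  apply: cvgMl_tmp; apply: cvgD; apply: (@continuous_comp _ _ _ _ (fun t : R => t ^+ 2)); try exact: exprn_continuous.
    exact: cvg_fst.
  exact: cvg_snd.
have [y _ Hy] : exists2 y, y \in A & forall t, t \in A -> h t <= h y.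
  apply: compact_EVT_max; first by exists 0.
    by apply: compact_setX; exact: segment_compact.
  exact: continuous_subspaceT.
exists y => z; rewrite -/(h z) -/(h y).
have [zA|zA] := pselect (A z); first by apply: Hy; rewrite inE.
apply: (@le_trans _ _ (h 0)); last by apply: Hy; rewrite inE.
have sz : r <= sqnorm z.
  have rr : r <= r ^+ 2 by rewrite expr2 ler_peMr// (le_trans ler01).
  have aux (t : R) : ~ t \in `[- r, r] -> r <= t ^+ 2.
    rewrite in_itv /= -ler_norml => /negP; rewrite -ltNge => rt.
    by rewrite (le_trans rr)// -(real_normK (num_real t)) lerXn2r ?nnegrE ?(le_trans ler01 r0) ?(ltW rt).
  have [z1|z1] := pselect (z.1 \in `[- r, r]).
    have z2 : ~ z.2 \in `[- r, r] by move=> z2; exact: zA.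
    by rewrite (le_trans (aux _ z2))// lerDr sqr_ge0.
  by rewrite (le_trans (aux _ z1))// lerDl sqr_ge0.
have h0 : h 0 = pairing D f 0 by rewrite /h /sqnorm /= expr0n /= addr0 mulr0 subr0.
have := HB 0; have := HB z; rewrite !ler_norml h0 /h => /andP[_ u1] /andP[u2 _].
have : e * r <= e * sqnorm z by rewrite ler_pM2l.
rewrite /r mulrDr mulr1 (mulrC e (_ / _)) divfK ?gt_eqF// => u3.
lra.
Qed.

(** Maximum principle: at a maximum of the penalised function, the Laplacian of the pairing, which
    is [k] times its value, is at most that of the penalty. Hence the value there, and with it the
    value at 0, is arbitrarily small. *)
Lemma pairing_le0 f : test_function f -> \int[mu]_x (D x * f x) <= 0.
Proof.
move=> tf; have -> : \int[mu]_x (D x * f x) = pairing D f 0.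
  by apply: eq_Rint => x; rewrite addr0.
apply/ler_addgt0Pr => e1 e10; rewrite add0r.
(* The penalty has Laplacian [4 * e], which this choice makes equal to [k * e1]. *)
pose e := e1 * k / 4; have e0 : 0 < e by rewrite divr_gt0// mulr_gt0.
have [y Hy] := max_penalized tf e0.
have second i : pairing D (partial_derivative i (partial_derivative i f)) y <= 2 * e.
  rewrite -subr_le0.
  apply: (@second_derivative_max _ (fun t => pairing D f (y + t *: basis_dir R i) - e * (sqnorm y + (2 * coord i y * t + t ^+ 2)))
     (fun t => pairing D (partial_derivative i f) (y + t *: basis_dir R i) - e * (2 * coord i y + 2 * t))).
  - have d2 (t : R) : is_derive t 1 (fun t => sqnorm y + (2 * coord i y * t + t ^+ 2)) (2 * coord i y + 2 * t).
      have q1 := is_derive_cmul (2 * coord i y) (fun x => is_derive_id x (1 : R)) t.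
      have q2 := is_derive_exprn 2 t; rewrite expr1 in q2.
      have := is_deriveD (is_derive_cst (sqnorm y) t 1) (is_deriveD q1 q2).
      by rewrite mulr1 add0r.
    by move=> t; exact: is_deriveB (pairing_is_derive LD i y tf t) (is_derive_cmul e d2 t).
  - have d2 (t : R) : is_derive t 1 (fun t => 2 * coord i y + 2 * t) 2.
      have q1 := is_derive_cmul 2 (fun x => is_derive_id x (1 : R)) t.
      have := is_deriveD (is_derive_cst (2 * coord i y) t 1) q1.
      by rewrite mulr1 add0r.
    have := is_deriveB (pairing_is_derive LD i y (test_partial i tf) 0) (is_derive_cmul e d2 0).
    by rewrite scale0r addr0 (mulrC e).
  - by move=> t; rewrite -sqnorm_line scale0r addr0 mulr0 expr0n /= !addr0; exact: Hy.
have := pairing_helmholtz y tf; have := second dir0; have := second dir1 => s1 s0 E.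
have ky : k * pairing D f y <= k * e1.
  rewrite -E; apply: le_trans (lerD s0 s1) _.
  by have -> : 2 * e + 2 * e = k * e1 by rewrite /e; field.
rewrite ler_pM2l// in ky; clear second s0 s1 E.
have := Hy 0; rewrite {1}/sqnorm /= expr0n /= addr0 mulr0 subr0.
have : 0 <= e * sqnorm y by rewrite mulr_ge0 ?(ltW e0)// addr_ge0 ?sqr_ge0.
lra.
Qed.
End green_uniqueness.

(** The one-sided bound [pairing_le0], applied to [D] and to [- D], gives orthogonality to every
    test function. *)
Lemma helmholtz_ae0 {R : realType} (k : R) (D : mplane R -> R) : 0 < k -> sqi (leb2 R) D ->
  (forall f, test_function f -> \int[leb2 R]_x (D x * helmholtz k f x) = 0) ->
  ae_eq (leb2 R) setT (EFin \o D) (cst 0%E).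
Proof.
move=> k0 LD HD; apply: (sqi_test_orthogonal_ae0 LD) => f tf; apply/eqP.
rewrite eq_le (pairing_le0 k0 LD HD tf)/=.
have LN := sqiN LD.
have E (g : mplane R -> R) : itg (leb2 R) (fun x => D x * g x) ->
    \int[leb2 R]_x (- D x * g x) = - \int[leb2 R]_x (D x * g x).
  by move=> fi; rewrite -mulN1r -RintZ//; apply: eq_Rint => x; rewrite mulN1r mulNr.
rewrite -oppr_le0 -E; last exact: sqiM LD (test_sqi tf).
apply: (pairing_le0 k0 LN _ tf) => g tg.
by rewrite E ?HD ?oppr0//; exact: sqiM LD (sqi_helmholtz k tg).
Qed.

(** * Uniqueness of the charge *)

Section concentration.
Context {R : realType}.
Local Notation mu := (leb2 R).

Definition cube (r : R) : set (mplane R) := ocrect (- r) r (- r) r.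

Lemma cube_norm (x : R * R) r : `|x| < r -> cube r x.
Proof.
rewrite prod_normE gt_max => /andP[]; rewrite !ltr_norml => /andP[? ?] /andP[? ?].
by split; rewrite /= in_itv /=; apply/andP; split => //; exact: ltW.
Qed.

Lemma norm_cube (x : R * R) r : cube r x -> `|x| <= r.
Proof.
rewrite prod_normE ge_max !ler_norml => -[]; rewrite /= !in_itv /= => /andP[a ->] /andP[b ->].
by rewrite (ltW a) (ltW b).
Qed.

Lemma measurable_cube r : measurable (cube r).
Proof. exact: measurable_ocrect. Qed.

Lemma sqi_small_cube (g : mplane R -> R) (M : R) : 0 < M -> sqi mu g ->
  \int[mu]_x (g x ^+ 2 * \1_(cube (M / n.+1%:R)) x) @[n --> \oo] --> (0 : R).
Proof.
(* The pointwise limit keeps its value at the origin, which belongs to all the cubes; that single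
   point is null. *)
move=> M0 [mg g2]; pose l (x : mplane R) : R := if x == 0 :> R * R then g x ^+ 2 else 0.
have [||||li H] := @Rint_dom _ _ _ mu (fun n x => g x ^+ 2 * \1_(cube (M / n.+1%:R)) x) l (fun x => g x ^+ 2).
- by move=> n; apply: measurable_funM; [exact: measurable_funX|apply: measurable_indic; exact: measurable_cube].
- move=> x; rewrite /l; case: eqP => [->|/eqP x0].
    apply: cvg_near_cst; apply: nearW => n; rewrite indicE mem_set ?mulr1//.
    by apply: cube_norm; rewrite normr0 divr_gt0.
  apply: cvg_near_cst; have nx : 0 < `|x| by rewrite normr_gt0.
  near=> n; rewrite indicE memNset ?mulr0// => /norm_cube.
  apply/negP; rewrite -ltNge ltr_pdivrMr// -ltr_pdivrMl//.
  near: n; exists (Num.trunc (`|x|^-1 * M)) => // n /= Hn.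
  by rewrite (lt_le_trans (truncnS_gt _))// ler_nat.
- move=> n x; rewrite normrM ger0_norm ?sqr_ge0// indicE ler_piMr ?sqr_ge0//.
  by case: (_ \in _); rewrite ?normr1 ?normr0.
- exact: g2.
rewrite (_ : 0 = \int[mu]_x l x)//; apply/esym/integral_ae0; last exact: itg_measurable li.
by apply: ae_plane_imp (@ae_neq0 R) => x /negPf x0; rewrite /l x0.
Unshelve. all: by end_near. Qed.

(** A weighted arithmetic-geometric mean inequality in place of Cauchy-Schwarz. Only the mass of [g]
    on [A] enters, and it is this mass that shrinks later. *)
Lemma pairing_AMGM (g h : mplane R -> R) (A : set (mplane R)) (t : R) : 0 < t -> measurable A ->
  sqi mu g -> sqi mu h -> (forall x, ~ A x -> h x = 0) ->
  `|\int[mu]_x (g x * h x)| <= t * \int[mu]_x (g x ^+ 2 * \1_A x) + t^-1 * \int[mu]_x h x ^+ 2.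
Proof.
move=> t0 mA Lg Lh Ah; have [mg g2] := Lg; have [_ h2] := Lh.
have gA : itg mu (fun x => g x ^+ 2 * \1_A x).
  apply: itg_le g2; first by apply: measurable_funM; [exact: measurable_funX|exact: measurable_indic].
  by move=> x; rewrite normrM ger0_norm ?sqr_ge0// indicE ler_piMr ?sqr_ge0//; case: (_ \in _); rewrite ?normr1 ?normr0.
have gh := sqiM Lg Lh.
rewrite -(RintZ t gA) -(RintZ t^-1 h2) -RintD; [|exact: itgZ|exact: itgZ].
apply: (le_trans (le_normr_Rintegral _ gh)) => //.
apply: le_Rintegral => //; [exact: itg_norm|by apply: itgD; exact: itgZ|move=> x _].
rewrite indicE; have [xA|nA] := pselect (A x); last by rewrite Ah// memNset// expr0n /= !mulr0 normr0 addr0.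
rewrite mem_set// mulr1 normrM -(real_normK (num_real (g x))) -(real_normK (num_real (h x))).
have := normr_ge0 (g x); have := normr_ge0 (h x); move: `|g x| `|h x| => a b b0 a0.
have -> : t^-1 * b ^+ 2 = t * (b / t) ^+ 2 by field; rewrite gt_eqF.
have -> : a * b = t * (a * (b / t)) by field; rewrite gt_eqF.
rewrite -mulrDr ler_pM2l//; have := divr_ge0 b0 (ltW t0); move: (b / t) => c c0.
have := sqr_ge0 (a - c); have := mulr_ge0 a0 c0; nra.
Qed.

Lemma concentrating_orthogonal (g : mplane R -> R) (h : nat -> mplane R -> R) (M K : R) : 0 < M ->
  sqi mu g -> (forall n, sqi mu (h n)) -> (forall n x, ~ cube (M / n.+1%:R) x -> h n x = 0) ->
  (forall n, \int[mu]_x h n x ^+ 2 <= K) ->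
  \int[mu]_x (g x * h n x) @[n --> \oo] --> (0 : R).
Proof.
move=> M0 Lg Lh h0 hK; apply/cvgr0Pnorm_le => e e0.
have K0 : 0 <= K by apply: le_trans (hK 0%N); apply: Rintegral_ge0 => x _; exact: sqr_ge0.
(* This weight makes the term of [h] at most [e / 2], uniformly in [n]; the mass of [g] is then made
   small against [t]. *)
pose t := 2 * (K + 1) / e; have t0 : 0 < t by rewrite divr_gt0// mulr_gt0// ltr_wpDl.
have et0 : 0 < e / 2 / t by apply: divr_gt0 => //; exact: divr_gt0.
have /cvgr0Pnorm_le/(_ (e / 2 / t) et0) := sqi_small_cube M0 Lg.
apply: filterS => n Hn.
apply: (le_trans (pairing_AMGM t0 (measurable_cube _) Lg (Lh n) (h0 n))).
have {}Hn := le_trans (ler_norm _) Hn.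
have H1 := ler_wpM2l (ltW t0) Hn; rewrite (mulrC t (e / 2 / t)) divfK ?gt_eqF// in H1.
have ti : 0 <= t^-1 by rewrite invr_ge0 ltW.
have H2 := ler_wpM2l ti (hK n).
have H3 : t^-1 * K <= e / 2.
  rewrite /t invf_div mulrAC ler_pdivrMr ?mulr_gt0 ?ltr_wpDl//.
  have -> : e / 2 * (2 * (K + 1)) = e * (K + 1) by field.
  by rewrite ler_pM2l// lerDl.
by rewrite (le_trans (lerD H1 (le_trans H2 H3)))// -splitr.
Qed.

Lemma bump_exists : exists2 f : R * R -> R, test_function f & f 0 != 0.
Proof.
pose b : R -> R := ocbump (- 1) 1 0.
exists (tens b b).
  by apply: (@test_tens _ (`|- 1| + `|1| + 1)); try exact: smooth_ocbump; exact: bsupp_ocbump.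
by rewrite /tens mulf_neq0// gt_eqF// /b ocbump_gt0//=; lra.
Qed.

Lemma Rint_opp_sum (w a b : mplane R -> R) : itg mu (fun x => w x * a x) -> itg mu (fun x => w x * b x) ->
  - (\int[mu]_x (w x * a x) + \int[mu]_x (w x * b x)) = \int[mu]_x (w x * - (a x + b x)).
Proof.
move=> i0 i1; rewrite -RintD// -[LHS]mulN1r -RintZ; last exact: itgD.
by apply: eq_Rint => x; ring.
Qed.

Lemma rweak_laplacian (w g0 g1 : mplane R -> R) f : sqi mu w -> rweak dir0 w g0 -> rweak dir1 w g1 ->
  test_function f -> \int[mu]_x (w x * - laplacian f x) =
  \int[mu]_x (g0 x * partial_derivative dir0 f x) + \int[mu]_x (g1 x * partial_derivative dir1 f x).
Proof.
move=> Lw w0 w1 tf.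
have t0 := test_partial dir0 tf; have t1 := test_partial dir1 tf.
have i0 := itg_test Lw (test_partial dir0 t0); have i1 := itg_test Lw (test_partial dir1 t1).
have e0 := esym (w0 _ t0); have e1 := esym (w1 _ t1).
have alg (A B X Y : R) : - A = X -> - B = Y -> - (X + Y) = A + B by move=> <- <-; ring.
rewrite -(alg _ _ _ _ e0 e1) (Rint_opp_sum i0 i1).
by apply: eq_Rint => x; rewrite laplacianE.
Qed.

(* [f (n x)] has bounded Dirichlet energy while its support shrinks to 0. *)
Definition dilate (f : R * R -> R) (n : nat) (x : R * R) : R := 1 * f (n.+1%:R *: x + 0).

Lemma dilateE f n (x : R * R) : dilate f n x = f (scl n.+1%:R x).
Proof. by rewrite /dilate mul1r addr0. Qed.

Lemma test_dilate f n : test_function f -> test_function (dilate f n).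
Proof. by apply: test_affine; rewrite pnatr_eq0. Qed.

Lemma partial_dilate i f n x : test_function f ->
  partial_derivative i (dilate f n) x = n.+1%:R * dilate (partial_derivative i f) n x.
Proof. by move=> tf; rewrite partial_affine// mul1r /dilate mul1r. Qed.

Lemma dilate_cube N f n (x : R * R) : 0 < N -> bsupp N f -> ~ cube ((N + 1) / n.+1%:R) x -> dilate f n x = 0.
Proof.
move=> N0 HN nx; rewrite /dilate HN ?mulr0// addr0 normrZ ger0_norm// -ltr_pdivrMl// mulrC ltNge.
apply/negP => xN; apply: nx; apply: cube_norm; rewrite (le_lt_trans xN)// ltr_pM2r ?invr_gt0//.
by rewrite ltrDl.
Qed.

Lemma Rint_dilate (n : nat) f : test_function f ->
  n.+1%:R ^+ 2 * \int[mu]_x dilate f n x ^+ 2 = \int[mu]_x f x ^+ 2.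
Proof.
move=> tf; have [_ i2] := test_sqi tf; rewrite (Rint_scl (ltr0Sn R n) i2); congr (_ * _).
by apply: eq_Rint => x; rewrite dilateE.
Qed.

Lemma dilate_orthogonal f g : test_function f -> sqi mu g ->
  \int[mu]_x (g x * dilate f n x) @[n --> \oo] --> (0 : R).
Proof.
move=> tf Lg; have [N N0 HN] := test_bsupp tf; have M0 : 0 < N + 1 by rewrite addr_gt0.
apply: (concentrating_orthogonal (K := \int[mu]_x f x ^+ 2) M0 Lg).
- by move=> n; apply: test_sqi; exact: test_dilate.
- by move=> n x; exact: dilate_cube.
- move=> n; rewrite -(Rint_dilate n tf) ler_peMl ?exprn_ege1 ?ler1n//.
  by apply: Rintegral_ge0 => x _; exact: sqr_ge0.
Qed.

(** In dimension two the Dirichlet energy is scale invariant: the factor [n.+1] of the chain rule,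
    squared, cancels the Jacobian. *)
Lemma partial_dilate_orthogonal i f g : test_function f -> sqi mu g ->
  \int[mu]_x (g x * partial_derivative i (dilate f n) x) @[n --> \oo] --> (0 : R).
Proof.
move=> tf Lg; have ti := test_partial i tf; have [N N0 HN] := test_bsupp ti.
have M0 : 0 < N + 1 by rewrite addr_gt0.
apply: (concentrating_orthogonal (K := \int[mu]_x partial_derivative i f x ^+ 2) M0 Lg).
- by move=> n; apply: test_sqi; apply: test_partial; exact: test_dilate.
- by move=> n x nx; rewrite partial_dilate// (dilate_cube N0 HN nx) mulr0.
- move=> n; rewrite -(Rint_dilate n ti) -RintZ; last by have [] := test_sqi (test_dilate n ti).
  by rewrite le_eqVlt; apply/orP; left; apply/eqP/eq_Rint => x; rewrite partial_dilate// exprMn.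
Qed.

(** On the dilates of a bump, [c * f 0] stays constant, while the terms with the weak derivatives of
    [w] and with the source [h] tend to 0. *)
Lemma rH1_no_point_charge (w h : mplane R -> R) (c : R) : rH1 w -> sqi mu h ->
  (forall f, test_function f -> \int[mu]_x (w x * - laplacian f x) = c * f 0 + \int[mu]_x (h x * f x)) ->
  c = 0.
Proof.
move=> [Lw Hw] Lh E; have [f tf f0] := bump_exists.
have [g0 Lg0 w0] := Hw dir0; have [g1 Lg1 w1] := Hw dir1.
have En n : c * f 0 = \int[mu]_x (g0 x * partial_derivative dir0 (dilate f n) x) +
    \int[mu]_x (g1 x * partial_derivative dir1 (dilate f n) x) - \int[mu]_x (h x * dilate f n x).
  have tn := test_dilate n tf.
  have := E _ tn; rewrite (_ : dilate f n 0 = f 0); last by rewrite /dilate scaler0 addr0 mul1r.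
  by rewrite (rweak_laplacian Lw w0 w1 tn) => ->; rewrite addrK.
have c0 := partial_dilate_orthogonal dir0 tf Lg0; have c1 := partial_dilate_orthogonal dir1 tf Lg1.
have H : (fun _ : nat => c * f 0) @ \oo --> (0 + 0 - 0 : R).
  by rewrite (funext En); exact: cvgB (cvgD c0 c1) (dilate_orthogonal tf Lh).
have /eqP : c * f 0 = 0.
  have := cvg_unique (@norm_hausdorff _ _) (cvg_cst (c * f 0)) H; rewrite addr0 subr0; exact.
by rewrite mulf_eq0 (negPf f0) orbF => /eqP.
Qed.
End concentration.

Section green_charge.
Context {R : realType}.
Local Notation mu := (leb2 R).
Implicit Types (u v G : R * R -> R[i]) (q : R[i]) (w : mplane R -> R).
Local Open Scope complex_scope.

Lemma is_greenP k G : is_green k G <->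
  [/\ sqi mu (reu G), sqi mu (imu G),
      forall f, test_function f -> \int[mu]_x (reu G x * helmholtz k f x) = f 0 &
      forall f, test_function f -> \int[mu]_x (imu G x * helmholtz k f x) = 0].
Proof.
have reM f : \int[mu]_x complex.Re (G x * (- laplacian f x + k * f x)%:C) =
    \int[mu]_x (reu G x * helmholtz k f x).
  by apply: eq_Rint => x; rewrite /reu /helmholtz; case: (G x) => p q /=; rewrite mulr0 subr0.
have imM f : \int[mu]_x complex.Im (G x * (- laplacian f x + k * f x)%:C) =
    \int[mu]_x (imu G x * helmholtz k f x).
  by apply: eq_Rint => x; rewrite /imu /helmholtz; case: (G x) => p q /=; rewrite mulr0 add0r.
split=> [[/Lp2P[Lr Li] H]|[Lr Li Hr Hi]].
  by split => // f /H; rewrite /cintegral reM imM => -[].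
split; first exact/Lp2P.
by move=> f tf; rewrite /cintegral reM imM Hr// Hi.
Qed.

Variable k : R.
Hypothesis k0 : 0 < k.

Lemma sqi_green_e : sqi mu (green_e k).
Proof.
split; first exact: measurable_green_e.
by apply: (itg_green_eX k0 (n := 2)) => // y m; have := sqr_ge0 (y - m); nra.
Qed.

Lemma itg_green_e4 : itg mu (fun x => green_e k x ^+ 4).
Proof.
apply: (itg_green_eX k0 (n := 4)) => // y m; rewrite -subr_ge0.
rewrite (_ : _ - _ = (y - m) ^+ 2 * ((y + m) ^+ 2 + 2 * m ^+ 2)) /=; last by ring.
by rewrite mulr_ge0 ?sqr_ge0// addr_ge0 ?sqr_ge0// mulr_ge0 ?sqr_ge0.
Qed.

(** The explicit kernel witnesses the set behind [xget], so [green k] is a solution and not the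
    default [cst 0]. *)
Lemma green_is_green : is_green k (green k).
Proof.
apply: (@xgetPex _ (cst 0) [set G | is_green k G]); exists (fun x => (green_e k x)%:C).
apply/is_greenP; split.
- exact: sqi_green_e.
- exact: sqi0.
- by move=> f tf; exact: green_e_solution.
- by move=> f _; rewrite (eq_Rint _ (g := cst 0)) ?Rint0// => x; rewrite mul0r.
Qed.

Lemma sqi_re_green : sqi mu (reu (green k)). Proof. by have /is_greenP[] := green_is_green. Qed.
Lemma sqi_im_green : sqi mu (imu (green k)). Proof. by have /is_greenP[] := green_is_green. Qed.

Lemma re_green_ae : \forall x \ae mu, reu (green k) x = green_e k x.
Proof.
have /is_greenP[Lr _ Hr _] := green_is_green.
have := helmholtz_ae0 k0 (sqiB Lr sqi_green_e) => H.
have : ae_eq mu setT (EFin \o (fun x => reu (green k) x - green_e k x)) (cst 0%E).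
  apply: H => f tf; have Lh := sqi_helmholtz k tf.
  rewrite (eq_Rint _ (g := fun x => reu (green k) x * helmholtz k f x - green_e k x * helmholtz k f x)).
    by rewrite RintB ?Hr ?green_e_solution ?subrr//; apply: sqiM => //; exact: sqi_green_e.
  by move=> x; rewrite mulrBl.
by apply: ae_plane_imp => x /(_ I)[/eqP]; rewrite subr_eq0 => /eqP.
Qed.

Lemma im_green_ae : \forall x \ae mu, imu (green k) x = 0.
Proof.
have /is_greenP[_ Li _ Hi] := green_is_green.
by apply: ae_plane_imp (helmholtz_ae0 k0 Li Hi) => x /(_ I)[].
Qed.

(* [w] is, up to a square-integrable source, a distributional solution of [- Delta w = c delta_0] *)
Definition point_charge (c : R) w := sqi mu w /\ exists2 h, sqi mu h &
  forall f, test_function f -> \int[mu]_x (w x * - laplacian f x) = c * f 0 + \int[mu]_x (h x * f x).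

Lemma point_chargeD c c' w w' : point_charge c w -> point_charge c' w' ->
  point_charge (c + c') (fun x => w x + w' x).
Proof.
move=> [Lw [h Lh H]] [Lw' [h' Lh' H']]; split; first exact: sqiD.
exists (fun x => h x + h' x) => [|f tf]; first exact: sqiD.
have Ll := sqiN (sqi_laplacian tf).
rewrite (eq_Rint _ (g := fun x => w x * - laplacian f x + w' x * - laplacian f x)); last by move=> x; rewrite mulrDl.
rewrite (RintD (sqiM Lw Ll) (sqiM Lw' Ll)) H// H'// [in RHS](eq_Rint _ (g := fun x => h x * f x + h' x * f x)); last by move=> x; rewrite mulrDl.
rewrite RintD; [|exact: itg_test|exact: itg_test]; ring.
Qed.

Lemma point_chargeZ c d w : point_charge c w -> point_charge (d * c) (fun x => d * w x).
Proof.
move=> [Lw [h Lh H]]; split; first exact: sqiZ.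
exists (fun x => d * h x) => [|f tf]; first exact: sqiZ.
have Ll := sqiN (sqi_laplacian tf).
rewrite (eq_Rint _ (g := fun x => d * (w x * - laplacian f x))); last by move=> x; rewrite mulrA.
rewrite (RintZ _ (sqiM Lw Ll)) H// [in RHS](eq_Rint _ (g := fun x => d * (h x * f x))); last by move=> x; rewrite mulrA.
rewrite RintZ; [by ring|exact: itg_test].
Qed.

Lemma helmholtz_point_charge c w : sqi mu w ->
  (forall f, test_function f -> \int[mu]_x (w x * helmholtz k f x) = c * f 0) -> point_charge c w.
Proof.
move=> Lw H; split => //; exists (fun x => - k * w x) => [|f tf]; first exact: sqiZ.
have Ll := sqiN (sqi_laplacian tf).
rewrite -H// [in RHS](eq_Rint _ (g := fun x => w x * - laplacian f x + k * (w x * f x))); last first.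
  by move=> x; rewrite /helmholtz; ring.
have wf := itg_test Lw tf.
rewrite (RintD (sqiM Lw Ll) (itgZ k wf)) (RintZ _ wf) [X in _ = _ + X](eq_Rint _ (g := fun x => - k * (w x * f x))).
  by rewrite (RintZ _ wf); ring.
by move=> x; rewrite mulrA.
Qed.

Lemma point_charge_re_green : point_charge 1 (reu (green k)).
Proof.
apply: helmholtz_point_charge; first exact: sqi_re_green.
by move=> f tf; rewrite mul1r; have /is_greenP[_ _ ->] := green_is_green.
Qed.

Lemma point_charge_im_green : point_charge 0 (imu (green k)).
Proof.
apply: helmholtz_point_charge; first exact: sqi_im_green.
by move=> f tf; rewrite mul0r; have /is_greenP[_ _ _ ->] := green_is_green.
Qed.

Lemma point_charge_rH1 c w : point_charge c w -> rH1 w -> c = 0.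
Proof. by move=> [_ [h Lh H]] Hw; exact: rH1_no_point_charge Hw Lh H. Qed.

Lemma reuM q x : reu (fun x => q * green k x) x = complex.Re q * reu (green k) x + - complex.Im q * imu (green k) x.
Proof. by rewrite /reu /imu; case: q => a b; case: (green k x) => p r /=; rewrite mulNr. Qed.

Lemma imuM q x : imu (fun x => q * green k x) x = complex.Re q * imu (green k) x + complex.Im q * reu (green k) x.
Proof. by rewrite /reu /imu; case: q => a b; case: (green k x) => p r /=. Qed.

Lemma point_charge_re q : point_charge (complex.Re q) (reu (fun x => q * green k x)).
Proof.
rewrite (funext (reuM q)).
have := point_chargeD (point_chargeZ (complex.Re q) point_charge_re_green) (point_chargeZ (- complex.Im q) point_charge_im_green).
by rewrite mulr1 mulr0 addr0.
Qed.

Lemma point_charge_im q : point_charge (complex.Im q) (imu (fun x => q * green k x)).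
Proof.
rewrite (funext (imuM q)).
have := point_chargeD (point_chargeZ (complex.Re q) point_charge_im_green) (point_chargeZ (complex.Im q) point_charge_re_green).
by rewrite mulr1 mulr0 add0r.
Qed.

Lemma Lp2_green q : Lp 2 (fun x => q * green k x).
Proof. by apply/Lp2P; split; [case: (point_charge_re q)|case: (point_charge_im q)]. Qed.

End green_charge.

Section charges.
Context {R : realType}.
Local Notation mu := (leb2 R).
Implicit Types (u v : R * R -> R[i]) (q : R[i]).
Local Open Scope complex_scope.

(** The difference of the two regular parts is [q2 * green l2 - q1 * green l1]. It lies in H^1 and
    has point charge [q2 - q1]; distinct parameters do no harm, since zeroth-order terms go into the
    source of [point_charge]. *)
Lemma charge_unique u q1 q2 l1 l2 : 0 < l1 -> 0 < l2 ->
  H1 (regular_part l1 q1 u) -> H1 (regular_part l2 q2 u) -> q1 = q2.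
Proof.
move=> l10 l20 /H1P[r1 i1] /H1P[r2 i2].
have Er : rH1 (fun x => reu (fun x => q2 * green l2 x) x + -1 * reu (fun x => q1 * green l1 x) x).
  rewrite (_ : (fun x => _) = fun x => reu (regular_part l1 q1 u) x - reu (regular_part l2 q2 u) x).
    exact: rH1B.
  apply/funext => x; rewrite /reu /regular_part.
  case: (u x) (q1 * _) (q2 * _) => a b [c d] [e f] /=; ring.
have Ei : rH1 (fun x => imu (fun x => q2 * green l2 x) x + -1 * imu (fun x => q1 * green l1 x) x).
  rewrite (_ : (fun x => _) = fun x => imu (regular_part l1 q1 u) x - imu (regular_part l2 q2 u) x).
    exact: rH1B.
  apply/funext => x; rewrite /imu /regular_part.
  case: (u x) (q1 * _) (q2 * _) => a b [c d] [e f] /=; ring.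
have /eqP := point_charge_rH1 (point_chargeD (point_charge_re l20 q2) (point_chargeZ (-1) (point_charge_re l10 q1))) Er.
have /eqP := point_charge_rH1 (point_chargeD (point_charge_im l20 q2) (point_chargeZ (-1) (point_charge_im l10 q1))) Ei.
rewrite !mulN1r !subr_eq0; case: q1 q2 {Er Ei r1 r2 i1 i2} => a b [c d] /= /eqP -> /eqP ->.
by [].
Qed.

Lemma charge_eq u q l : 0 < l -> H1 (regular_part l q u) -> Defs.charge u = q.
Proof.
move=> l0 H.
have [l' l'0 H'] : [set q | exists2 lam, 0 < lam & H1 (regular_part lam q u)] (Defs.charge u).
  by apply: xgetPex; exists q, l.
exact: charge_unique H' H.
Qed.

Lemma charge_H1alpha u : H1alpha u -> exists2 l, 0 < l & H1 (regular_part l (Defs.charge u) u).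
Proof. by move=> [_ [q [l [l0 H]]]]; exists l => //; rewrite (charge_eq l0 H). Qed.

Lemma regular_part0 l u : regular_part l 0 u = u.
Proof. by apply/funext => x; rewrite /regular_part mul0r subr0. Qed.

Lemma H1_H1alpha u : H1 u -> H1alpha u.
Proof. by move=> H; split; [exact: H1_Lp2|exists 0, 1; rewrite regular_part0]. Qed.

Lemma charge_H1 u : H1 u -> Defs.charge u = 0.
Proof. by move=> H; apply: (@charge_eq _ _ 1) => //; rewrite regular_part0. Qed.

Lemma charge0_H1 u : H1alpha u -> Defs.charge u = 0 -> H1 u.
Proof. by move=> /charge_H1alpha[l _ H] q0; move: H; rewrite q0 regular_part0. Qed.

Lemma regular_part_scalec l c q u : regular_part l (c%:C * q) (scalec c u) = scalec c (regular_part l q u).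
Proof. by apply/funext => x; rewrite /regular_part /scalec mulrBr mulrA. Qed.

Lemma H1alpha_scalec c u : H1alpha u -> H1alpha (scalec c u).
Proof.
move=> [Lu [q [l [l0 H]]]]; split; first exact: Lp2_scalec.
by exists (c%:C * q), l; rewrite regular_part_scalec; split => //; exact: H1_scalec.
Qed.

Lemma charge_scalec c u : H1alpha u -> Defs.charge (scalec c u) = c%:C * Defs.charge u.
Proof.
move=> /charge_H1alpha[l l0 H]; apply: (charge_eq l0).
by rewrite regular_part_scalec; exact: H1_scalec.
Qed.

Lemma regular_part_green l q u : regular_part l q (fun x => u x + q * green l x) = u.
Proof. by apply/funext => x; rewrite /regular_part addrK. Qed.

Lemma charge_green l q u : 0 < l -> H1 u -> Defs.charge (fun x => u x + q * green l x) = q.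
Proof. by move=> l0 H; apply: (charge_eq l0); rewrite regular_part_green. Qed.

Lemma Lp2D u v : Lp 2 u -> Lp 2 v -> Lp 2 (fun x => u x + v x).
Proof.
move=> /Lp2P[ur ui] /Lp2P[vr vi]; apply/Lp2P; split.
  rewrite (_ : reu _ = fun x => reu u x + reu v x); first exact: sqiD.
  by apply/funext => x; rewrite /reu; case: (u x) => a b; case: (v x).
rewrite (_ : imu _ = fun x => imu u x + imu v x); first exact: sqiD.
by apply/funext => x; rewrite /imu; case: (u x) => a b; case: (v x).
Qed.

Lemma H1alpha_green l q u : 0 < l -> H1 u -> H1alpha (fun x => u x + q * green l x).
Proof.
move=> l0 H; split; last by exists q, l; rewrite regular_part_green.
by apply: Lp2D; [exact: H1_Lp2|exact: Lp2_green].
Qed.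

End charges.

(** * The quadratic forms *)

Section forms.
Context {R : realType}.
Local Notation mu := (leb2 R).
Implicit Types (u v : R * R -> R[i]) (q : R[i]).
Local Open Scope complex_scope.

(** Asks for measurability only, so that it covers fourth powers and couplings whose integrability
    is unknown: an infinite integral is read as 0 on both sides. *)
Lemma Rint_nnegZ (c : R) (f : mplane R -> R) : 0 <= c -> measurable_fun setT f -> (forall x, 0 <= f x) ->
  \int[mu]_x (c * f x) = c * \int[mu]_x f x.
Proof.
move=> c0 mf f0; rewrite /Rintegral (_ : (fun x => _) = fun x => (c%:E * (f x)%:E)%E); last by apply/funext => x.
rewrite ge0_integralZl//; last 2 first.
- exact/measurable_EFinP.
- by move=> x _; rewrite lee_fin.
have : (0 <= \int[mu]_x (f x)%:E)%E by apply: integral_ge0 => x _; rewrite lee_fin.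
case: integral => [r| |]//= _; have [->|cn0] := eqVneq c 0; first by rewrite mul0e mul0r.
by rewrite mulr0 gt0_muley// lte_fin lt_def cn0.
Qed.

Lemma measurable_modulus4 u : Lp 2 u -> measurable_fun setT (fun x : mplane R => modulus u x ^+ 4).
Proof.
move=> Lu; apply: (eq_measurable_fun (fun x : mplane R => (modulus u x ^+ 2) ^+ 2)).
  by move=> x _; rewrite -exprM.
by apply: measurable_funX; exact: Lp2_measurable_modulusX2.
Qed.

Lemma modulusX_ge0 u x n : 0 <= modulus u x ^+ n. Proof. by rewrite exprn_ge0// modulus_ge0. Qed.

Lemma lp_norm4_scalec c u : Lp 2 u -> lp_norm 4 (scalec c u) ^+ 4 = c ^+ 4 * lp_norm 4 u ^+ 4.
Proof.
move=> Lu; rewrite !lp_norm4 -Rint_nnegZ ?exprn_even_ge0//; [|exact: measurable_modulus4|by move=> x; exact: modulusX_ge0].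
by apply: eq_Rint => x; rewrite (exprM _ 2 2) modulus_scalec2 exprMn -!exprM.
Qed.

Lemma modulusM2 u v x : modulus (fun y => u y * v y) x ^+ 2 = modulus u x ^+ 2 * modulus v x ^+ 2.
Proof. by rewrite !modulus_sqr /reu /imu; case: (u x) => a b; case: (v x) => c d /=; ring. Qed.

Lemma coupling_ge0 u v : 0 <= coupling u v.
Proof. by apply: Rintegral_ge0 => x _; exact: modulusX_ge0. Qed.

Lemma coupling_scalec c d u v : Lp 2 u -> Lp 2 v ->
  coupling (scalec c u) (scalec d v) = c ^+ 2 * d ^+ 2 * coupling u v.
Proof.
move=> Lu Lv; have cd : 0 <= c ^+ 2 * d ^+ 2 := mulr_ge0 (sqr_ge0 c) (sqr_ge0 d).
rewrite /coupling -(Rint_nnegZ cd).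
- apply: eq_Rint => x; rewrite (modulusM2 (scalec c u) (scalec d v)) (modulusM2 u v).
  by rewrite (modulus_scalec2 c) (modulus_scalec2 d); ring.
- apply: (eq_measurable_fun (fun x : mplane R => modulus u x ^+ 2 * modulus v x ^+ 2)).
    by move=> x _; rewrite modulusM2.
  by apply: measurable_funM; exact: Lp2_measurable_modulusX2.
- by move=> x; exact: modulusX_ge0.
Qed.

Lemma coupling_ae0 u v : Lp 2 u -> Lp 2 v -> ae0 u \/ ae0 v -> coupling u v = 0.
Proof.
move=> Lu Lv uv; apply: integral_ae0; last first.
  apply: (eq_measurable_fun (fun x : mplane R => modulus u x ^+ 2 * modulus v x ^+ 2)).
    by move=> x _; rewrite modulusM2.
  by apply: measurable_funM; exact: Lp2_measurable_modulusX2.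
case: uv => /ae0P; apply: ae_plane_imp => x E; rewrite modulusM2 !modulus_sqr /reu /imu E /=.
  by rewrite expr0n /= addr0 mul0r.
by rewrite expr0n /= addr0 mulr0.
Qed.

Variables (alpha omega tomega lam : R).
Hypothesis htomega : 0 < tomega.
Hypothesis hlam : omega_ alpha < lam <= omega.

Lemma omega_gt0 : 0 < omega_ alpha :> R.
Proof. by rewrite mulr_gt0 ?expR_gt0. Qed.

Lemma lam_gt0 : 0 < lam.
Proof. by have /andP[+ _] := hlam; apply: lt_trans; exact: omega_gt0. Qed.

(** With [h = - 2 pi alpha - gamma], the number [omega_ alpha] is the square of [2 * expR h], so
    [lam > omega_ alpha] says [ln (sqrt lam / 2) > h]. *)
Lemma alpha_theta_gt0 : 0 < alpha + theta lam.
Proof.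
have /andP[hl _] := hlam; set g := euler_gamma R.
pose h := - (2 * pi * alpha) - g.
have s0 : 0 < 2 * expR h by rewrite mulr_gt0 ?expR_gt0.
have sE : 2 * expR h < Num.sqrt lam.
  rewrite -(gtr0_norm s0) -sqrtr_sqr ltr_sqrt ?lam_gt0//; apply: le_lt_trans hl.
  rewrite exprMn expr2 [X in _ * X]expr2 -expRD /omega_ -natrM.
  rewrite (_ : h + h = - 4 * pi * alpha - 2 * euler_gamma R)//; rewrite /h /g; ring.
have : h < ln (Num.sqrt lam / 2).
  rewrite -(expRK h) ltr_ln ?posrE ?expR_gt0 ?divr_gt0 ?sqrtr_gt0 ?lam_gt0//.
  by rewrite ltr_pdivlMr// mulrC.
rewrite /h /theta -/g => H.
have p0 : 0 < 2 * pi :> R by rewrite mulr_gt0// pi_gt0.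
rewrite -(ltr_pM2r p0) mul0r mulrDl divfK ?gt_eqF// (mulrC alpha); lra.
Qed.

Lemma omega_sub_lam_ge0 : 0 <= omega - lam.
Proof. by have /andP[_] := hlam; rewrite subr_ge0. Qed.

Lemma Qalpha_ge0 u : 0 <= Qalpha alpha omega lam u.
Proof.
rewrite /Qalpha; apply: addr_ge0; last by rewrite mulr_ge0 ?sqr_ge0// ltW// alpha_theta_gt0.
apply: addr_ge0; last by rewrite mulr_ge0 ?sqr_ge0// omega_sub_lam_ge0.
by rewrite addr_ge0 ?grad2_ge0// mulr_ge0 ?sqr_ge0// ltW// lam_gt0.
Qed.

(** All four terms of the form are nonnegative. The charge term forces [q = 0], which turns [phi]
    into [u], and the [lam] term then gives the claim. *)
Lemma Qalpha_eq0 u : Lp 2 u -> Qalpha alpha omega lam u = 0 -> ae0 u.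
Proof.
move=> Lu; rewrite /Qalpha; set q := Defs.charge u; set phi := regular_part _ _ _ => E.
have h1 := grad2_ge0 phi.
have h2 : 0 <= lam * lp_norm 2 phi ^+ 2 by rewrite mulr_ge0 ?sqr_ge0// ltW// lam_gt0.
have h3 : 0 <= (omega - lam) * lp_norm 2 u ^+ 2 by rewrite mulr_ge0 ?sqr_ge0// omega_sub_lam_ge0.
have h4 : 0 <= (alpha + theta lam) * ComplexField.Normc.normc q ^+ 2 by rewrite mulr_ge0 ?sqr_ge0// ltW// alpha_theta_gt0.
have e4 : (alpha + theta lam) * ComplexField.Normc.normc q ^+ 2 = 0 by lra.
have e2 : lam * lp_norm 2 phi ^+ 2 = 0 by lra.
move/eqP: e4; rewrite mulf_eq0 gt_eqF ?alpha_theta_gt0//= expf_eq0 /= => /eqP /ComplexField.Normc.eq0_normc q0.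
move/eqP: e2; rewrite mulf_eq0 gt_eqF ?lam_gt0//= => /eqP; rewrite /phi q0 regular_part0.
exact: lp_norm2_eq0.
Qed.

Lemma normc_scalec c q : ComplexField.Normc.normc (c%:C * q) ^+ 2 = c ^+ 2 * ComplexField.Normc.normc q ^+ 2.
Proof. exact: (modulus_scalec2 c (cst q) 0). Qed.

Lemma Lp2_regular_part l q u : 0 < l -> Lp 2 u -> Lp 2 (regular_part l q u).
Proof.
move=> l0 Lu; rewrite (_ : regular_part l q u = fun x => u x + - q * green l x).
  by apply: Lp2D => //; exact: Lp2_green.
by apply/funext => x; rewrite /regular_part mulNr.
Qed.

Lemma Qalpha_scalec c u : c != 0 -> H1alpha u ->
  Qalpha alpha omega lam (scalec c u) = c ^+ 2 * Qalpha alpha omega lam u.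
Proof.
move=> c0 Hu; have [Lu _] := Hu; rewrite /Qalpha charge_scalec// regular_part_scalec.
have Lr := Lp2_regular_part (Defs.charge u) lam_gt0 Lu.
rewrite grad2_scalec// (lp_norm2_scalec _ Lu) (lp_norm2_scalec _ Lr) normc_scalec; ring.
Qed.

Lemma Qalpha_H1 u : H1 u -> Qalpha alpha omega lam u = grad2 u + omega * lp_norm 2 u ^+ 2.
Proof.
move=> Hu; rewrite /Qalpha (charge_H1 Hu) regular_part0 ComplexField.Normc.normc0 expr0n /= mulr0 addr0; ring.
Qed.

Lemma Qalpha_ae0 u : Lp 2 u -> ae0 u -> Qalpha alpha omega lam u = 0.
Proof.
move=> Lu u0; rewrite Qalpha_H1; last exact: H1_ae0.
by rewrite grad2_ae0// ae0_lp_norm2// mulr0 addr0.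
Qed.

Lemma Q0_ge0 v : 0 <= Q0 tomega v.
Proof. by rewrite addr_ge0 ?grad2_ge0// mulr_ge0 ?sqr_ge0// ltW. Qed.

Lemma Q0_eq0 v : Lp 2 v -> Q0 tomega v = 0 -> ae0 v.
Proof.
move=> Lv; rewrite /Q0 => E; apply: lp_norm2_eq0 => //.
have h1 := grad2_ge0 v; have h2 : 0 <= tomega * lp_norm 2 v ^+ 2 by rewrite mulr_ge0 ?sqr_ge0// ltW.
have /eqP : tomega * lp_norm 2 v ^+ 2 = 0 by lra.
by rewrite mulf_eq0 gt_eqF//= => /eqP.
Qed.

Lemma Q0_scalec c v : c != 0 -> Lp 2 v -> Q0 tomega (scalec c v) = c ^+ 2 * Q0 tomega v.
Proof. by move=> c0 Lv; rewrite /Q0 grad2_scalec// lp_norm2_scalec//; ring. Qed.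

Lemma Q0_ae0 v : Lp 2 v -> ae0 v -> Q0 tomega v = 0.
Proof. by move=> Lv v0; rewrite /Q0 grad2_ae0// ae0_lp_norm2// mulr0 addr0. Qed.

Lemma ae0_scalec c u : c != 0 -> ae0 (scalec c u) -> ae0 u.
Proof.
move=> c0 /ae0P H; apply/ae0P; apply: ae_plane_imp H => x /eqP.
by rewrite mulf_eq0 fmorph_eq0 (negPf c0) => /eqP.
Qed.
End forms.

(** * Comparison of the levels *)

Section ground_states.
Context {R : realType}.
Implicit Types (u v : R * R -> R[i]).
Variables (alpha omega tomega lam : R).
Hypothesis htomega : 0 < tomega.
Hypothesis hlam : omega_ alpha < lam <= omega.
Local Notation Q := (Qalpha alpha omega lam).
Local Notation Q' := (Q0 tomega).
Local Notation A := (fun u => lp_norm 4 u ^+ 4).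
Local Notation c := (c_ alpha omega tomega lam).
Local Notation N_ := (nehari alpha omega tomega lam).
Local Notation I := (I_ alpha omega tomega lam).

Let zero_ae0 : ae0 (cst 0 : R * R -> R[i]).
Proof. by apply/ae0P; exact: aeW. Qed.

Let zero_H1 : H1 (cst 0 : R * R -> R[i]) := H1_ae0 Lp2_0 zero_ae0.

Let second_ae0 u v : Lp 2 u -> Lp 2 v -> ae0 v -> [/\ A v = 0, Q' v = 0 & coupling u v = 0].
Proof.
by move=> Lu Lv v0 /=; rewrite ae0_lp_norm4// Q0_ae0// coupling_ae0//; right.
Qed.

Let first_ae0 u v : Lp 2 u -> Lp 2 v -> ae0 u -> [/\ A u = 0, Q u = 0 & coupling u v = 0].
Proof.
by move=> Lu Lv u0 /=; rewrite ae0_lp_norm4// Qalpha_ae0// coupling_ae0//; left.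
Qed.

(** Subtracting [4^-1 * G_] from [I_] cancels the quartic terms and the coupling. *)
Lemma energy_nehari beta w : N_ beta w -> I beta w = 4^-1 * (Q w.1 + Q' w.2).
Proof. move=> [_ _ _ G0]; apply/eqP; rewrite -subr_eq0; apply/eqP.
by transitivity (4^-1 * G_ alpha omega tomega lam beta w); [rewrite /I_ /G_; field|rewrite G0 mulr0]. Qed.

Lemma energy_pos u v : H1alpha u -> H1 v -> ~ (ae0 u /\ ae0 v) -> 0 < Q u + Q' v.
Proof.
move=> Hu Hv nuv; have [Lu _] := Hu; have Lv := H1_Lp2 Hv.
rewrite lt_def addr_ge0 ?(Qalpha_ge0 hlam) ?(Q0_ge0 htomega)// andbT; apply/eqP => E.
have qu := Qalpha_ge0 hlam u; have qv := Q0_ge0 htomega v.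
by apply: nuv; split; [apply: (Qalpha_eq0 hlam) => //|apply: (Q0_eq0 htomega) => //]; lra.
Qed.

(* Projecting [(u, v)] radially onto the Nehari set. *)
Lemma c_le_quotient beta u v : H1alpha u -> H1 v -> ~ (ae0 u /\ ae0 v) ->
  let D := A u + A v + 2 * beta * coupling u v in 0 < D ->
  (c beta <= (4^-1 * (Q u + Q' v) ^+ 2 / D)%:E)%E.
Proof.
move=> Hu Hv nuv D D0; have q0 := energy_pos Hu Hv nuv.
have [Lu _] := Hu; have Lv := H1_Lp2 Hv.
pose t := Num.sqrt ((Q u + Q' v) / D).
have t0 : 0 < t by rewrite sqrtr_gt0 divr_gt0.
have tn : t != 0 by rewrite gt_eqF.
have t2 : t ^+ 2 = (Q u + Q' v) / D by rewrite sqr_sqrtr// divr_ge0// ltW.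
have Hw : N_ beta (scalec t u, scalec t v).
  split => /=; [exact: H1alpha_scalec|exact: H1_scalec|by move=> [/(ae0_scalec tn) ? /(ae0_scalec tn) ?]; exact: nuv|].
  rewrite /G_ /= (Qalpha_scalec hlam tn Hu) (Q0_scalec _ tn Lv) !lp_norm4_scalec// coupling_scalec//.
  have -> : t ^+ 2 * Q u + t ^+ 2 * Q' v - (t ^+ 4 * A u + t ^+ 4 * A v) - 2 * beta * (t ^+ 2 * t ^+ 2 * coupling u v) =
     t ^+ 2 * (Q u + Q' v - t ^+ 2 * D) by rewrite /D; ring.
  by rewrite t2 divfK ?gt_eqF// subrr mulr0.
apply: ereal_inf_lbound; exists (scalec t u, scalec t v) => //; congr (_%:E).
rewrite (energy_nehari Hw) /= (Qalpha_scalec hlam tn Hu) (Q0_scalec _ tn Lv) -mulrDr t2; field; rewrite gt_eqF//.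
Qed.

(** A point of the Nehari set for coupling 0 has [D >= Q u + Q' v] for coupling [beta], so its
    projection does not raise the energy. *)
Lemma c_le_c0 beta : 0 <= beta -> (c beta <= c 0)%E.
Proof.
move=> b0; apply: le_ereal_inf_tmp => _ [[u v] Nw <-]; rewrite (energy_nehari Nw) /=.
have [/= Hu Hv nuv] := Nw; rewrite /G_ /= mulr0 mul0r subr0 => G0.
have q0 := energy_pos Hu Hv nuv; have k0 := coupling_ge0 u v.
have bk : 0 <= 2 * beta * coupling u v by rewrite !mulr_ge0.
have D0 : Q u + Q' v <= A u + A v + 2 * beta * coupling u v by lra.
apply: le_trans (c_le_quotient Hu Hv nuv (lt_le_trans q0 D0)) _.
rewrite lee_fin -mulrA ler_pM2l ?invr_gt0// ler_pdivrMr ?(lt_le_trans q0)//.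
by rewrite expr2 ler_pM2l.
Qed.

Lemma minimizer_scalar beta beta' u v : 0 <= beta -> beta < beta' -> c beta' = c 0 ->
  minimizer alpha omega tomega lam beta (u, v) -> ae0 u \/ ae0 v.
Proof.
move=> b0 bb' cb' [Nw]; rewrite (energy_nehari Nw) /= => cE.
have [/= Hu Hv nuv] := Nw; rewrite /G_ /= => G0.
have [Lu _] := Hu; have Lv := H1_Lp2 Hv.
have q0 := energy_pos Hu Hv nuv; have k0 := coupling_ge0 u v.
apply: contrapT => /not_orP[nu nv].
have qu : 0 < Q u.
  by rewrite lt_def (Qalpha_ge0 hlam) andbT; apply/eqP => /(Qalpha_eq0 hlam Lu).
have qv : 0 < Q' v.
  by rewrite lt_def (Q0_ge0 htomega) andbT; apply/eqP => /(Q0_eq0 htomega Lv).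
have [kz|kp] := eqVneq (coupling u v) 0; last first.
  have kp0 : 0 < coupling u v by rewrite lt_def kp.
  (* Raising the coupling makes the denominator exceed [Q u + Q' v], so [c beta' < c beta <= c 0],
     against [c beta' = c 0]. *)
  have bk : 2 * beta * coupling u v < 2 * beta' * coupling u v by rewrite ltr_pM2r// ltr_pM2l.
  have D0 : Q u + Q' v < A u + A v + 2 * beta' * coupling u v by lra.
  have := c_le_quotient Hu Hv nuv (lt_trans q0 D0); rewrite cb' leNgt => /negP; apply.
  apply: lt_le_trans (c_le_c0 b0); rewrite -cE lte_fin -mulrA ltr_pM2l ?invr_gt0//.
  by rewrite ltr_pdivrMr ?(lt_trans q0)// expr2 ltr_pM2l.
have GE : Q u + Q' v = A u + A v by move: G0; rewrite kz mulr0; lra.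
(* By [GE], one component has its form at most its fourth power. Alone it has quotient at most its
   own form, which is strictly below [Q u + Q' v]. *)
have [uA|Au] := leP (Q u) (A u).
  have A0 : 0 < A u := lt_le_trans qu uA.
  have n0 : ~ (ae0 u /\ ae0 (cst 0 : R * R -> R[i])) by case.
  have := c_le_quotient (beta := beta) Hu zero_H1 n0.
  have [/= -> -> ->] := second_ae0 Lu Lp2_0 zero_ae0.
  rewrite mulr0 !addr0 => /(_ A0); rewrite -cE lee_fin leNgt => /negP; apply.
  rewrite -mulrA ltr_pM2l ?invr_gt0// ltr_pdivrMr// expr2.
  by apply: (@le_lt_trans _ _ (Q u * A u)); [rewrite ler_pM2l|rewrite ltr_pM2r// ltrDl].
have vA : Q' v <= A v by lra.
have A0 : 0 < A v := lt_le_trans qv vA.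
have n0 : ~ (ae0 (cst 0 : R * R -> R[i]) /\ ae0 v) by case.
have := c_le_quotient (beta := beta) (H1_H1alpha zero_H1) Hv n0.
have [/= -> -> ->] := first_ae0 Lp2_0 Lv zero_ae0.
rewrite mulr0 !add0r addr0 => /(_ A0); rewrite -cE lee_fin leNgt => /negP; apply.
rewrite -mulrA ltr_pM2l ?invr_gt0// ltr_pdivrMr// expr2.
by apply: (@le_lt_trans _ _ (Q' v * A v)); [rewrite ler_pM2l|rewrite ltr_pM2r// ltrDr].
Qed.

Lemma c_le_d beta : (c beta <= d_ alpha omega lam)%E.
Proof.
apply: le_ereal_inf_tmp => _ [u [Hu nu E] <-]; have [Lu _] := Hu.
have [/= eA eQ eK] := second_ae0 Lu Lp2_0 zero_ae0.
apply: ereal_inf_lbound; exists (u, cst 0).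
  by split => //=; [case|rewrite /G_ /= eA eQ eK E; ring].
by rewrite /I_ /S_ /= eA eQ eK; congr (_%:E); ring.
Qed.

Lemma c_le_d0 beta : (c beta <= d0 tomega)%E.
Proof.
apply: le_ereal_inf_tmp => _ [v [Hv nv E] <-]; have Lv := H1_Lp2 Hv.
have [/= eA eQ eK] := first_ae0 Lp2_0 Lv zero_ae0.
apply: ereal_inf_lbound; exists (cst 0, v).
  by split => //=; [exact: H1_H1alpha|case|rewrite /G_ /= eA eQ eK E; ring].
by rewrite /I_ /S0 /= eA eQ eK; congr (_%:E); ring.
Qed.

Lemma scalar_minimizer_S beta u v : ae0 v -> minimizer alpha omega tomega lam beta (u, v) ->
  nehari_S alpha omega lam u /\ c beta = (S_ alpha omega lam u)%:E.
Proof.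
move=> v0 [Nw <-]; rewrite (energy_nehari Nw); have [/= Hu Hv nuv] := Nw; rewrite /G_ /=.
have [Lu _] := Hu; have Lv := H1_Lp2 Hv.
have [/= -> -> ->] := second_ae0 Lu Lv v0.
rewrite mulr0 !addr0 subr0 => /eqP; rewrite subr_eq0 => /eqP E.
split; first by split => // u0; exact: nuv.
by rewrite /S_ -E; congr (_%:E); field.
Qed.

Lemma scalar_minimizer_S0 beta u v : ae0 u -> minimizer alpha omega tomega lam beta (u, v) ->
  nehari_S0 tomega v /\ c beta = (S0 tomega v)%:E.
Proof.
move=> u0 [Nw <-]; rewrite (energy_nehari Nw); have [/= Hu Hv nuv] := Nw; rewrite /G_ /=.
have [Lu _] := Hu; have Lv := H1_Lp2 Hv.
have [/= -> -> ->] := first_ae0 Lu Lv u0.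
rewrite mulr0 !add0r subr0 => /eqP; rewrite subr_eq0 => /eqP E.
split; first by split => // v0; exact: nuv.
by rewrite /S0 -E; congr (_%:E); field.
Qed.

End ground_states.

(** * Minimizers of the singular level carry a charge *)

Section convolution.
Context {R : realType}.
Local Notation mu := (leb2 R).
Local Notation smu := (@sleb2 R).

Lemma itg_test_function (f : R * R -> R) : test_function f -> itg mu f.
Proof.
move=> tf; have [N N0 HN] := test_bsupp tf.
have Lc : sqi mu (\1_(cube (N + 1)) : mplane R -> R) := sqi_indic (measurable_cube _) (leb2_ocrect_fin _ _ _ _).
apply: (eq_itg _ (sqiM (test_sqi tf) Lc)) => x.
rewrite indicE; have [xA|nA] := pselect (cube (N + 1) x); first by rewrite mem_set// mulr1.
rewrite HN ?mul0r// ltNge; apply/negP => xN; apply: nA; apply: cube_norm.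
by rewrite (le_lt_trans xN)// ltrDl.
Qed.

Lemma itg_helmholtz k (f : R * R -> R) : test_function f -> itg mu (helmholtz k f).
Proof.
move=> tf; apply: itgD; last exact/itgZ/itg_test_function.
apply: itgN; rewrite (funext (laplacianE f)).
by apply: itgD; apply: itg_test_function; do 2 apply: test_partial.
Qed.

Lemma helmholtz_shift k (f : R * R -> R) (y x : R * R) : test_function f ->
  helmholtz k f (x + y) = helmholtz k (fun z => f (z + y)) x.
Proof.
move=> tf; have t0 := test_partial dir0 tf; have t1 := test_partial dir1 tf.
rewrite /helmholtz !laplacianE.
by rewrite (partial_shift dir0 y tf) (partial_shift dir1 y tf) (partial_shift dir0 y t0) (partial_shift dir1 y t1).
Qed.

Lemma gauss2_even (a : R) (z : R * R) : gauss2 (scl a (- z)) = gauss2 (scl a z).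
Proof. by rewrite /gauss2 /tens /scl /gaussian /= !mulrN !sqrrN. Qed.

Lemma green_e_even k (z : R * R) : green_e k (- z) = green_e k z.
Proof.
rewrite /green_e; congr (_ * _); apply: eq_Rint => r.
by rewrite /kern /= gauss2_even.
Qed.

Lemma measurable_sub_plane (g : mplane R -> R) : measurable_fun setT g ->
  measurable_fun setT (fun p : mplane R * mplane R => g ((p.1 : R * R) - p.2)).
Proof.
move=> mg; apply: (measurableT_comp mg).
have m1 : measurable_fun setT (fun p : mplane R * mplane R => p.1.1) by exact: measurableT_comp measurable_fst measurable_fst.
have m2 : measurable_fun setT (fun p : mplane R * mplane R => p.1.2) by exact: measurableT_comp measurable_snd measurable_fst.
have m3 : measurable_fun setT (fun p : mplane R * mplane R => p.2.1) by exact: measurableT_comp measurable_fst measurable_snd.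
have m4 : measurable_fun setT (fun p : mplane R * mplane R => p.2.2) by exact: measurableT_comp measurable_snd measurable_snd.
by apply: measurable_fun_pair; [exact: measurable_funB m1 m3|exact: measurable_funB m2 m4].
Qed.

Variables (k : R) (h H : mplane R -> R) (C : R).
Hypothesis k0 : 0 < k.
Hypothesis mh : measurable_fun setT h.
Hypothesis Hi : itg mu H.
Hypothesis C0 : 0 <= C.
(** A Young-type bound suited to a residual that is cubic in [u]: with [t] a value of the Green's
    function, its right-hand side is integrable because that function lies in L^2 and L^4. *)
Hypothesis hH : forall x t, `|h x * t| <= H x + C * (t ^+ 2 + t ^+ 4).
Hypothesis h_green : forall y : R * R, \int[mu]_x (h ((x : R * R) + y) * green_e k x) = 0.
Local Notation g := (green_e k).

Lemma itg_green_pow : itg mu (fun x => C * (g x ^+ 2 + g x ^+ 4)).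
Proof. by apply/itgZ/itgD; [case: (sqi_green_e k0)|exact: itg_green_e4]. Qed.

Lemma green_sub_itg (y : R * R) : itg mu (fun x => h x * g ((x : R * R) - y)) /\
  \int[mu]_x `|h x * g ((x : R * R) - y)| <= \int[mu]_x H x + \int[mu]_x (C * (g x ^+ 2 + g x ^+ 4)).
Proof.
have mg : measurable_fun setT (fun x : mplane R => g ((x : R * R) - y)).
  exact: measurable_shift (measurable_green_e k0).
have gi := itg_shift (- y) itg_green_pow.
have ii : itg mu (fun x => h x * g ((x : R * R) - y)).
  by apply: (itg_le _ _ (itgD Hi gi)); [exact: measurable_funM|move=> x; exact: hH].
split => //; rewrite -(Rint_shift (- y) itg_green_pow) -RintD//.
apply: le_Rintegral => //; [exact: itg_norm|exact: itgD].
Qed.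

(** [hH] is used with [t] the indicator of the square; there [t^2 + t^4] is twice the indicator,
    whence [2 * C]. *)
Lemma orthogonal_loc_itg : loc_itg h.
Proof.
move=> M; have mr := measurable_ocrect (- M) M (- M) M.
have Lc := sqi_indic mr (leb2_ocrect_fin (- M) M (- M) M).
have ii : itg mu (fun x => h x * \1_(ocrect (- M) M (- M) M) x).
  have [_ Ic] := Lc.
  apply: (itg_le _ _ (itgD Hi (itgZ (2 * C) Ic))); first by apply: measurable_funM => //; exact: measurable_indic.
  move=> x; apply: (le_trans (hH _ _)); rewrite indicE; case: (_ \in _) => /=; rewrite ?expr1n ?expr0n /=; lra.
apply/integrable_mkcond => //; apply: eq_integrable ii => // x _ /=.
by rewrite patchE indicE; case: ifP => _; rewrite ?mulr1 ?mulr0.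
Qed.

(** Evenness of the kernel makes [f] the convolution of the Green's function with [phi]. Fubini's
    theorem moves the integral over [x] inside, where [h_green] annihilates it for each [y]. *)
Lemma green_orthogonal_test (f : R * R -> R) : test_function f -> \int[mu]_x (h x * f x) = 0.
Proof.
move=> tf; set phi := helmholtz k f.
have Lphi : sqi mu phi := sqi_helmholtz k tf.
have mphi : measurable_fun setT phi by case: Lphi.
pose J (p : mplane R * mplane R) := h p.1 * g ((p.1 : R * R) - p.2) * phi p.2.
have mJ : measurable_fun setT J.
  have m1 : measurable_fun setT (fun p : mplane R * mplane R => h p.1) := measurableT_comp mh measurable_fst.
  have m2 : measurable_fun setT (fun p : mplane R * mplane R => phi p.2) := measurableT_comp mphi measurable_snd.
  exact: measurable_funM (measurable_funM m1 (measurable_sub_plane (measurable_green_e k0))) m2.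
set K := \int[mu]_x H x + \int[mu]_x (C * (g x ^+ 2 + g x ^+ 4)).
have Ji : itg (smu \x smu)%E J.
  apply: (itg_prod_dom (m1 := smu) (m2 := smu) mJ _ (itgZ K (itg_norm (itg_helmholtz k tf)))) => y.
  have [i1 i2] := green_sub_itg y; split; first exact: (itgZr (phi y) i1).
  rewrite (eq_Rint smu (g := fun x => `|phi y| * `|h x * g ((x : R * R) - y)|)); last first.
    by move=> x; rewrite /J normrM mulrC.
  by rewrite (RintZ _ (itg_norm i1)) mulrC ler_wpM2r.
have [_ e1] := Rint_fubini1 (m1 := smu) (m2 := smu) Ji.
have [_ e2] := Rint_fubini2 (m1 := smu) (m2 := smu) Ji.
rewrite -[LHS]/(\int[smu]_x (h x * f x)).
rewrite (eq_Rint smu (g := fun x => \int[smu]_y J (x, y))); last first.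
  move=> x; rewrite (eq_Rint smu (g := fun y => h x * (g ((y : R * R) - x) * phi y))); last first.
    by move=> y; rewrite /J /= -mulrA -green_e_even opprB.
  have Lg := sqi_shift (- (x : R * R)) (sqi_green_e k0).
  have gp := sqiM Lg Lphi.
  rewrite -[RHS]/(\int[mu]_y (h x * (g ((y : R * R) - x) * phi y))) RintZ//; congr (_ * _).
  rewrite -(Rint_shift (x : R * R) gp) /=.
  rewrite (eq_Rint mu (g := fun y => g y * helmholtz k (fun z => f (z + x)) y)).
    by rewrite green_e_solution ?add0r//; exact: test_shift.
  by move=> y; rewrite addrK /phi helmholtz_shift.
rewrite -e1 e2 (eq_Rint smu (g := cst 0)) ?Rint0// => y.
rewrite -[LHS]/(\int[mu]_x J (x, y)) (eq_Rint mu (g := fun x => phi y * (h x * g ((x : R * R) - y)))); last first.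
  by move=> x; rewrite /J mulrC.
have [i1 _] := green_sub_itg y; rewrite RintZ// -(Rint_shift y i1).
rewrite (eq_Rint mu (g := fun x => h ((x : R * R) + y) * g x)); last by move=> x; rewrite addrK.
by rewrite h_green mulr0.
Qed.

Lemma green_orthogonal_ae0 : \forall x \ae mu, h x = 0.
Proof.
by apply: ae_plane_imp (test_orthogonal_ae0 mh orthogonal_loc_itg green_orthogonal_test) => x /(_ I)[].
Qed.

End convolution.

(** * Energy and fourth power after adding a small charge *)

Section variation.
Context {R : realType}.
Local Notation mu := (leb2 R).
Implicit Types (u v w : R * R -> R[i]).
Local Open Scope complex_scope.

Lemma Rint_ae_eq (f g : mplane R -> R) : itg mu f -> itg mu g -> (\forall x \ae mu, f x = g x) ->
  \int[mu]_x f x = \int[mu]_x g x.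
Proof.
move=> fi gi fg; apply/eqP; rewrite -subr_eq0 -RintB//; apply/eqP/integral_ae0.
  by apply: ae_plane_imp fg => x ->; rewrite subrr.
exact: itg_measurable (itgB fi gi).
Qed.

Lemma itg_ae (f g : mplane R -> R) : measurable_fun setT f -> itg mu g -> (\forall x \ae mu, f x = g x) ->
  itg mu f.
Proof.
move=> mf gi fg; have [mg gf] := (itgP _ _).1 gi; apply/itgP; split => //.
rewrite (ae_eq_integral (fun x => (`|g x|)%:E))//.
- by apply/measurable_EFinP; exact: measurableT_comp.
- by apply/measurable_EFinP; exact: measurableT_comp.
- by apply: ae_plane_imp fg => x -> _.
Qed.

(** An infinite integral would have [fine] value 0, so positivity certifies finiteness. *)
Lemma Rint_gt0_itg (f : mplane R -> R) : measurable_fun setT f -> (forall x, 0 <= f x) ->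
  0 < \int[mu]_x f x -> itg mu f.
Proof.
move=> mf f0; rewrite /Rintegral => I0; apply/itgP; split => //.
under eq_integral => x _ do rewrite ger0_norm//.
by move: I0; case: integral => [r| |] //=; rewrite ?ltry ?ltxx.
Qed.

(* The first-order condition at [e = 0] of [(a + 2 e X + e^2 C)^2 >= a (a + 4 e L)], an equality there. *)
Lemma first_order (a X C L : R) : 0 < a ->
  (forall e, 0 < a + 4 * e * L -> a * (a + 4 * e * L) <= (a + 2 * e * X + e ^+ 2 * C) ^+ 2) -> X = L.
Proof.
move=> a0 H; apply/eqP; rewrite -subr_eq0; apply/negPn/negP => D0.
pose D := X - L; have Dp : 0 < `|D| by rewrite normr_gt0.
(* [M] exceeds [4 * |L|] and, for [|e| <= 1], the coefficient of [e ^+ 2] in the difference of the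
   two sides. *)
pose M := 2 * a * `|C| + 4 * X ^+ 2 + 4 * `|X * C| + C ^+ 2 + 4 * `|L| + 1.
have M0 : 0 < M.
  have := mulr_ge0 (ltW a0) (normr_ge0 C); have := sqr_ge0 X; have := normr_ge0 (X * C).
  have := sqr_ge0 C; have := normr_ge0 L; rewrite /M; lra.
(* The three bounds give [|e| <= 1], positivity of [a + 4 * e * L], and a quadratic term below half
   of the linear term [4 a d |D|]. *)
pose d := Num.min 1 (Num.min (a / M) (2 * a * `|D| / M)).
have d0 : 0 < d by rewrite !lt_min ltr01 !divr_gt0// mulr_gt0// mulr_gt0.
have [d1 [da dD]] : d <= 1 /\ d * M <= a /\ d * M <= 2 * a * `|D|.
  by rewrite -!ler_pdivlMr// /d !ge_min !lexx !orbT.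
have mL : 4 * `|L| < M.
  have := mulr_ge0 (ltW a0) (normr_ge0 C); have := sqr_ge0 X; have := normr_ge0 (X * C).
  have := sqr_ge0 C; rewrite /M; lra.
(* A step against the sign of [D] makes the linear term negative. *)
pose e := - (Num.sg D * d).
have eL : `|4 * e * L| < a.
  rewrite -mulrA normrM ger0_norm// /e normrM normrN normrM normr_sg (gtr0_norm d0).
  rewrite D0 mul1r mulrCA; apply: lt_le_trans da; by rewrite ltr_pM2l.
have e1 : 0 < a + 4 * e * L by move: eL; rewrite ltr_norml => /andP[h _]; lra.
have e2 : e ^+ 2 = d ^+ 2 by rewrite /e sqrrN exprMn sqr_sg D0 mul1r.
have eD : e * D = - (d * `|D|) by rewrite /e mulNr mulrAC -normrEsg mulrC.
have := H e e1; rewrite -subr_ge0.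
have -> : (a + 2 * e * X + e ^+ 2 * C) ^+ 2 - a * (a + 4 * e * L) =
   4 * a * (e * D) + e ^+ 2 * (2 * a * C + 4 * X ^+ 2 + 4 * e * (X * C) + e ^+ 2 * C ^+ 2) by rewrite /D; ring.
rewrite eD e2 leNgt => /negP; apply.
have B : 2 * a * C + 4 * X ^+ 2 + 4 * e * (X * C) + d ^+ 2 * C ^+ 2 < M.
  have h1 : 2 * a * C <= 2 * a * `|C| by rewrite ler_pM2l ?ler_norm// mulr_gt0.
  have h2 : e * (X * C) <= `|X * C|.
    apply: (le_trans (ler_norm _)); rewrite normrM ler_piMl// /e normrN normrM normr_sg D0 mul1r gtr0_norm//.
  have h3 : d ^+ 2 * C ^+ 2 <= C ^+ 2 by rewrite ler_piMl ?sqr_ge0// exprn_ile1// ltW.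
  have := normr_ge0 L; rewrite /M; lra.
have d2 : 0 < d ^+ 2 by rewrite exprn_gt0.
have : d ^+ 2 * (2 * a * C + 4 * X ^+ 2 + 4 * e * (X * C) + d ^+ 2 * C ^+ 2) < d ^+ 2 * M by rewrite ltr_pM2l.
have : d ^+ 2 * M <= d * (2 * a * `|D|) by rewrite expr2 -mulrA ler_pM2l.
have : 0 < d * (a * `|D|) by rewrite !mulr_gt0.
lra.
Qed.

Variables (omega lam alpha : R).
Hypothesis hlam : omega_ alpha < lam <= omega.
Local Notation g := (green_e lam).
Local Notation Q := (Qalpha alpha omega lam).
Variables (p q : R).
Hypothesis pq : p ^+ 2 + q ^+ 2 = 1.

(** The real inner product of [w x] with the unit complex number [p + i q], the direction of the
    added charge. *)
Definition component w (x : mplane R) : R := p * reu w x + q * imu w x.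

Lemma component_le w x : component w x ^+ 2 <= modulus w x ^+ 2.
Proof.
rewrite modulus_sqr /component; move: (reu w x) (imu w x) => a b.
rewrite -[X in _ <= X]mul1r -pq -subr_ge0.
rewrite (_ : _ - _ = (p * b - q * a) ^+ 2) ?sqr_ge0//; ring.
Qed.

Lemma sqi_component w : Lp 2 w -> sqi mu (component w).
Proof. by move=> /Lp2P[Lr Li]; apply: sqiD; exact: sqiZ. Qed.

Definition perturb e w : R * R -> R[i] := fun x => w x + ((e * p) +i* (e * q)) * green lam x.

Lemma modulus_perturb e w : \forall x \ae mu, modulus (perturb e w) x ^+ 2 =
  modulus w x ^+ 2 + 2 * e * (g x * component w x) + e ^+ 2 * g x ^+ 2.
Proof.
have l0 := lam_gt0 hlam.
apply: ae_plane_imp2 (re_green_ae l0) (im_green_ae l0) => x.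
rewrite !modulus_sqr /component /perturb /reu /imu; case: (w x) => a b; case: (green lam x) => c d /= -> ->.
rewrite (_ : e ^+ 2 * g x ^+ 2 = e ^+ 2 * (p ^+ 2 + q ^+ 2) * g x ^+ 2); [ring|by rewrite pq mulr1].
Qed.

Lemma sqi_g : sqi mu g. Proof. exact: sqi_green_e (lam_gt0 hlam). Qed.

Variable w : R * R -> R[i].
Hypothesis Hw : H1 w.
Let Lw : Lp 2 w := H1_Lp2 Hw.

Lemma Lp2_perturb e : Lp 2 (perturb e w).
Proof. by apply: Lp2D => //; apply: Lp2_green; exact: lam_gt0 hlam. Qed.

Lemma itg_perturb2 e : itg mu (fun x => modulus w x ^+ 2 + 2 * e * (g x * component w x) + e ^+ 2 * g x ^+ 2).
Proof.
have [_ g2] := sqi_g.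
by apply: itgD; [apply: itgD; [exact: Lp2_itg|apply: itgZ; exact: sqiM sqi_g (sqi_component Lw)]|exact: itgZ].
Qed.

Lemma lp_norm2_perturb e : lp_norm 2 (perturb e w) ^+ 2 =
  lp_norm 2 w ^+ 2 + 2 * e * \int[mu]_x (g x * component w x) + e ^+ 2 * \int[mu]_x (g x ^+ 2).
Proof.
have [_ g2] := sqi_g; have gc := sqiM sqi_g (sqi_component Lw).
rewrite !lp_norm2 (Rint_ae_eq (Lp2_itg (Lp2_perturb e)) (itg_perturb2 e) (modulus_perturb e w)).
rewrite (RintD (itgD (Lp2_itg Lw) (itgZ (2 * e) gc)) (itgZ _ g2)) (RintD (Lp2_itg Lw) (itgZ (2 * e) gc)).
by rewrite (RintZ _ gc) (RintZ _ g2).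
Qed.

(** The regular part of [perturb e w] is [w] itself, so only the [omega - lam] term and the charge
    term change, and no gradient of the Green's function appears. *)
Lemma Qalpha_perturb e : Q (perturb e w) = Q w + 2 * e * ((omega - lam) * \int[mu]_x (g x * component w x)) +
  e ^+ 2 * ((omega - lam) * \int[mu]_x (g x ^+ 2) + (alpha + theta lam)).
Proof.
rewrite (Qalpha_H1 _ _ _ Hw) {1}/Qalpha /perturb charge_green//; last exact: lam_gt0 hlam.
rewrite regular_part_green -/(perturb e w) lp_norm2_perturb.
rewrite [ComplexField.Normc.normc _ ^+ 2](modulus_sqr (fun=> (e * p) +i* (e * q)) 0) /reu /imu /=.
rewrite !exprMn -mulrDr pq; ring.
Qed.

Hypothesis w4 : itg mu (fun x => modulus w x ^+ 4).
Let g4 : itg mu (fun x => g x ^+ 4) := itg_green_e4 (lam_gt0 hlam).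

Lemma itg_cubic : itg mu (fun x => modulus w x ^+ 2 * (g x * component w x)).
Proof.
apply: (itg_le _ _ (itgD w4 g4)).
  apply: measurable_funM; first exact: Lp2_measurable_modulusX2.
  by apply: measurable_funM; [case: sqi_g|case: (sqi_component Lw)].
move=> x; have := component_le w x; rewrite normrM ger0_norm ?sqr_ge0// normrM.
have E4 : g x ^+ 4 = (`|g x| ^+ 2) ^+ 2 by rewrite real_normK ?num_real// -exprM.
have W4 : modulus w x ^+ 4 = (modulus w x ^+ 2) ^+ 2 by rewrite -exprM.
rewrite E4 W4 -[component w x ^+ 2]real_normK ?num_real//.
have := normr_ge0 (component w x); have := normr_ge0 (g x); have := sqr_ge0 (modulus w x).
move: (modulus w x ^+ 2) `|g x| `|component w x| => s t m s0 t0 m0 ms.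
have h1 := sqr_ge0 (t - m); have h2 := sqr_ge0 (s - t ^+ 2).
have : s * (t * m) <= s * ((t ^+ 2 + s) / 2) by apply: ler_wpM2l => //; lra.
by nra.
Qed.

Lemma itg_perturb4 e : itg mu (fun x => (modulus w x ^+ 2 + 2 * e * (g x * component w x) + e ^+ 2 * g x ^+ 2) ^+ 2).
Proof.
apply: (itg_le _ _ (itgD (itgZ 8 w4) (itgZ (8 * e ^+ 4) g4))).
  by apply: measurable_funX; exact: itg_measurable (itg_perturb2 e).
move=> x; rewrite ger0_norm ?sqr_ge0//.
have W4 : modulus w x ^+ 4 = (modulus w x ^+ 2) ^+ 2 by rewrite -exprM.
have := component_le w x; rewrite W4; move: (modulus w x ^+ 2) (component w x) => s m ms.
rewrite (_ : 2 * e * (g x * m) = 2 * (e * g x) * m); last by ring.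
rewrite (_ : e ^+ 2 * g x ^+ 2 = (e * g x) ^+ 2); last by ring.
rewrite (_ : 8 * e ^+ 4 * g x ^+ 4 = 8 * ((e * g x) ^+ 2) ^+ 2); last by ring.
move: (e * g x) => t.
have h0 : 0 <= s + 2 * t * m + t ^+ 2 by have := sqr_ge0 (t + m); nra.
have h1 : s + 2 * t * m + t ^+ 2 <= 2 * s + 2 * t ^+ 2 by have := sqr_ge0 (t - m); nra.
have h2 : (s + 2 * t * m + t ^+ 2) ^+ 2 <= (2 * s + 2 * t ^+ 2) ^+ 2.
  by rewrite lerXn2r ?nnegrE// (le_trans h0).
apply: (le_trans h2); have := sqr_ge0 (s - t ^+ 2); nra.
Qed.

(** A one-sided expansion: pointwise, the discarded remainder is a square times a nonnegative
    factor. *)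
Lemma lp_norm4_perturb e : lp_norm 4 w ^+ 4 + 4 * e * \int[mu]_x (modulus w x ^+ 2 * (g x * component w x)) <=
  lp_norm 4 (perturb e w) ^+ 4.
Proof.
have E : \forall x \ae mu, modulus (perturb e w) x ^+ 4 =
   (modulus w x ^+ 2 + 2 * e * (g x * component w x) + e ^+ 2 * g x ^+ 2) ^+ 2.
  by apply: ae_plane_imp (modulus_perturb e w) => x <-; rewrite -exprM.
have i4 := itg_ae (measurable_modulus4 (Lp2_perturb e)) (itg_perturb4 e) E.
rewrite !lp_norm4 (Rint_ae_eq i4 (itg_perturb4 e) E) -(RintZ _ itg_cubic) -RintD//; last exact: itgZ itg_cubic.
apply: le_Rintegral => //; [by apply: itgD => //; exact: itgZ itg_cubic|exact: itg_perturb4|move=> x _].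
rewrite (exprM _ 2 2); have := component_le w x; have := sqr_ge0 (modulus w x).
move: (modulus w x ^+ 2) (g x) (component w x) => s t m s0 ms.
rewrite -subr_ge0.
rewrite (_ : _ - _ = (e * t) ^+ 2 * ((2 * m + e * t) ^+ 2 + 2 * s)); last by ring.
by rewrite mulr_ge0 ?sqr_ge0// addr_ge0 ?sqr_ge0// mulr_ge0.
Qed.

End variation.

Section singular_minimizers.
Context {R : realType}.
Local Notation mu := (leb2 R).
Implicit Types (u v w z : R * R -> R[i]).
Variables (omega lam alpha : R).
Hypothesis hlam : omega_ alpha < lam <= omega.
Local Notation g := (green_e lam).
Local Notation Q := (Qalpha alpha omega lam).
Local Notation A := (fun u => lp_norm 4 u ^+ 4).

Lemma lp_norm4_shift y u : itg mu (fun x => modulus u x ^+ 4) -> A (shiftf y u) = A u.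
Proof. by move=> u4 /=; rewrite !lp_norm4; exact: (Rint_shift y u4). Qed.

Variable u : R * R -> R[i].
Hypothesis Hu : H1 u.
Hypothesis nu : ~ ae0 u.
Hypothesis QA : Q u = A u.
(** Minimality on the Nehari set in scale-free form: [Q z ^+ 2 / A z] is four times the energy of
    the rescaled [z], and [Q u] is four times that of [u]. *)
Hypothesis optimal : forall z, H1alpha z -> 0 < A z -> Q u * A z <= Q z ^+ 2.
Let Lu : Lp 2 u := H1_Lp2 Hu.

Lemma Qalpha_gt0 : 0 < Q u.
Proof. by rewrite lt_def (Qalpha_ge0 hlam) andbT; apply/eqP => /(Qalpha_eq0 hlam Lu). Qed.

Lemma itg_modulus4 : itg mu (fun x => modulus u x ^+ 4).
Proof.
apply: Rint_gt0_itg; [exact: measurable_modulus4|by move=> x; exact: modulusX_ge0|].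
by rewrite -lp_norm4 -QA; exact: Qalpha_gt0.
Qed.

Definition residual p q (x : mplane R) : R := ((omega - lam) - modulus u x ^+ 2) * component p q u x.

Lemma residual_green p q (y : R * R) : p ^+ 2 + q ^+ 2 = 1 ->
  \int[mu]_x (residual p q ((x : R * R) + y) * g x) = 0.
Proof.
move=> pq; pose w := shiftf y u.
have Hw : H1 w := H1_shift y Hu.
have Lw := H1_Lp2 Hw.
have w4 : itg mu (fun x => modulus w x ^+ 4) := itg_shift y itg_modulus4.
have Aw : A w = Q u by rewrite lp_norm4_shift ?QA//; exact: itg_modulus4.
(* Here absence of charge matters: on H^1 the form is translation invariant, whereas the point
   interaction stays at the origin. *)
have Qw : Q w = Q u by rewrite !Qalpha_H1// grad2_shift// lp_norm2_shift.
have gc := sqiM (sqi_g hlam) (sqi_component p q Lw).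
have cub := itg_cubic hlam pq Hw w4.
have XL := @first_order R (Q u) ((omega - lam) * \int[mu]_x (g x * component p q w x))
   ((omega - lam) * \int[mu]_x (g x ^+ 2) + (alpha + theta lam))
   (\int[mu]_x (modulus w x ^+ 2 * (g x * component p q w x))) Qalpha_gt0.
transitivity (\int[mu]_x ((omega - lam) * (g x * component p q w x) - modulus w x ^+ 2 * (g x * component p q w x))).
  by apply: eq_Rint => x; rewrite /residual -mulrBl -mulrA (mulrC (component _ _ _ _)).
rewrite (RintB (itgZ _ gc) cub).
rewrite (RintZ _ gc) XL ?subrr// => e He.
have AA := lp_norm4_perturb hlam pq Hw w4 e; rewrite Aw in AA.
have QQ := Qalpha_perturb hlam pq Hw e; rewrite Qw in QQ.
rewrite -QQ; apply: le_trans (optimal _ (lt_le_trans He AA)); last first.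
  exact: (H1alpha_green _ (lam_gt0 hlam) Hw).
by rewrite (ler_pM2l Qalpha_gt0).
Qed.

Lemma residual_ae0 p q : p ^+ 2 + q ^+ 2 = 1 -> \forall x \ae mu, residual p q x = 0.
Proof.
move=> pq; have b0 := omega_sub_lam_ge0 hlam.
apply: (green_orthogonal_ae0 (H := fun x => (omega - lam) * modulus u x ^+ 2 + modulus u x ^+ 4)
  (C := omega - lam + 1) (lam_gt0 hlam)).
- apply: measurable_funM; last by case: (sqi_component p q Lu).
  by apply: measurable_funB => //; exact: Lp2_measurable_modulusX2.
- by apply: itgD; [exact/itgZ/Lp2_itg|exact: itg_modulus4].
(* With [m = |component|] and [r = |t|], [m r <= (m^2 + r^2) / 2] and [m^2 <= |u|^2]; multiplied by
   [(omega - lam) + |u|^2], the mixed product [|u|^2 r^2] is absorbed by fourth powers. *)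
- move=> x t; rewrite /residual.
  have W4 : modulus u x ^+ 4 = (modulus u x ^+ 2) ^+ 2 by rewrite -exprM.
  have E4 : t ^+ 4 = (`|t| ^+ 2) ^+ 2 by rewrite real_normK ?num_real// -exprM.
  have := component_le pq u x; rewrite W4 E4 -[component p q u x ^+ 2]real_normK ?num_real// -[t ^+ 2]real_normK ?num_real//.
  rewrite -mulrA normrM [`|component _ _ _ _ * t|]normrM.
  have : `|omega - lam - modulus u x ^+ 2| <= omega - lam + modulus u x ^+ 2.
    by apply: (le_trans (ler_normB _ _)); rewrite !ger0_norm ?sqr_ge0.
  have := sqr_ge0 (modulus u x); have := normr_ge0 (component p q u x); have := normr_ge0 t.
  move: b0; move: `|omega - lam - modulus u x ^+ 2| (modulus u x ^+ 2) `|component p q u x| `|t| (omega - lam).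
  move=> d s m r b b0 r0 m0 s0 db ms.
  have mr0 : 0 <= m * r by rewrite mulr_ge0.
  have mr : m * r <= (s + r ^+ 2) / 2 by have := sqr_ge0 (m - r); nra.
  apply: (le_trans (ler_wpM2r mr0 db)); rewrite mulrDl.
  have h1 := ler_wpM2l b0 mr; have h2 := ler_wpM2l s0 mr.
  have h3 := mulr_ge0 b0 s0; have h4 := mulr_ge0 b0 (sqr_ge0 r); have h5 := mulr_ge0 b0 (sqr_ge0 (r ^+ 2)).
  have h6 := sqr_ge0 (s - r ^+ 2); have h7 := sqr_ge0 r; have h8 := sqr_ge0 (r ^+ 2).
  have h9 : s * ((s + r ^+ 2) / 2) <= s ^+ 2 + (r ^+ 2) ^+ 2 by nra.
  have h10 : b * ((s + r ^+ 2) / 2) <= b * s + b * r ^+ 2 by lra.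
  rewrite [X in _ <= _ + X]mulrDr !mulrDl !mul1r; lra.
- by move=> y; exact: residual_green.
Qed.

Lemma no_regular_minimizer : False.
Proof.
have p1 : 1 ^+ 2 + 0 ^+ 2 = 1 :> R by rewrite expr1n expr0n addr0.
have p2 : 0 ^+ 2 + 1 ^+ 2 = 1 :> R by rewrite expr1n expr0n add0r.
have E : \forall x \ae mu, modulus u x ^+ 4 = (omega - lam) * modulus u x ^+ 2.
  apply: ae_plane_imp2 (residual_ae0 p1) (residual_ae0 p2) => x.
  rewrite /residual /component !mul1r !mul0r addr0 add0r.
  have -> : modulus u x ^+ 4 = (modulus u x ^+ 2) ^+ 2 by rewrite -exprM.
  rewrite modulus_sqr; move: (reu u x) (imu u x) => r i e1 e2.
  apply/eqP; rewrite -subr_eq0; apply/eqP.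
  transitivity (- ((omega - lam - (r ^+ 2 + i ^+ 2)) * r * r + (omega - lam - (r ^+ 2 + i ^+ 2)) * i * i)).
    ring.
  by rewrite e1 e2 !mul0r addr0 oppr0.
have i2 := itgZ (omega - lam) (Lp2_itg Lu).
(* The fourth power equals [omega - lam] times the squared L^2 norm, so the Nehari identity leaves
   [grad2 u + lam * lp_norm 2 u ^+ 2 = 0]. *)
have := QA; rewrite (Qalpha_H1 _ _ _ Hu) lp_norm4 (Rint_ae_eq itg_modulus4 i2 E) (RintZ _ (Lp2_itg Lu)) -lp_norm2 => H.
apply: nu; apply: lp_norm2_eq0 => //.
have l0 := lam_gt0 hlam; have := grad2_ge0 u => gu.
have : lam * lp_norm 2 u ^+ 2 = 0.
  have := mulr_ge0 (ltW l0) (sqr_ge0 (lp_norm 2 u)); lra.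
by move=> /eqP; rewrite mulf_eq0 gt_eqF//= => /eqP.
Qed.

End singular_minimizers.

Lemma d_minimizer_charge {R : realType} (alpha omega lam : R) (u : R * R -> R[i]) :
  omega_ alpha < lam <= omega -> nehari_S alpha omega lam u ->
  ((S_ alpha omega lam u)%:E <= d_ alpha omega lam)%E -> Defs.charge u <> 0.
Proof.
move=> hlam [Hu nu QA] Su q0.
apply: (no_regular_minimizer hlam (charge0_H1 Hu q0) nu QA) => z Hz Az.
have [Lz _] := Hz.
have nz : ~ ae0 z by move=> z0; move: Az; rewrite ae0_lp_norm4// ltxx.
have Qz : 0 < Qalpha alpha omega lam z.
  by rewrite lt_def (Qalpha_ge0 hlam) andbT; apply/eqP => /(Qalpha_eq0 hlam Lz).
pose t := Num.sqrt (Qalpha alpha omega lam z / lp_norm 4 z ^+ 4).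
have t0 : 0 < t by rewrite sqrtr_gt0 divr_gt0.
have tn : t != 0 by rewrite gt_eqF.
have t2 : t ^+ 2 = Qalpha alpha omega lam z / lp_norm 4 z ^+ 4 by rewrite sqr_sqrtr// divr_ge0// ltW.
have QE : t ^+ 2 * Qalpha alpha omega lam z = t ^+ 4 * lp_norm 4 z ^+ 4.
  by rewrite (exprM t 2 2) t2 expr2 -[RHS]mulrA divfK// gt_eqF.
have Nz : nehari_S alpha omega lam (scalec t z).
  split; [exact: H1alpha_scalec|by move=> /(ae0_scalec tn)|].
  by rewrite (Qalpha_scalec hlam tn Hz) lp_norm4_scalec.
have := le_trans Su (ereal_inf_lbound (ex_intro2 _ _ _ Nz erefl)).
rewrite /S_ lee_fin -QA (Qalpha_scalec hlam tn Hz) lp_norm4_scalec// -QE t2 => H.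
rewrite -ler_pdivlMr//.
have -> : Qalpha alpha omega lam z ^+ 2 / lp_norm 4 z ^+ 4 = Qalpha alpha omega lam z / lp_norm 4 z ^+ 4 * Qalpha alpha omega lam z.
  by rewrite expr2 mulrAC.
move: H; move: (_ / _ * _) (Qalpha _ _ _ u) => a b; lra.
Qed.

Theorem theorem1p6 (R : realType) (alpha omega tomega lam beta : R)
  (u0 v0 : R * R -> R[i])
  (homega : omega_ alpha < omega)
  (htomega : 0 < tomega)
  (hlam : omega_ alpha < lam <= omega)
  (hbeta0 : 0 <= beta)
  (hbeta : (beta%:E < beta_star alpha omega tomega lam)%E)
  (hmin : minimizer alpha omega tomega lam beta (u0, v0)) :
  [/\ scalar_pair (u0, v0),
      ((d0 tomega < d_ alpha omega lam)%E ->
        [/\ ae0 u0, scalar_pair (u0, v0) & regular_pair (u0, v0)]),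
      ((d_ alpha omega lam < d0 tomega)%E ->
        [/\ ae0 v0, scalar_pair (u0, v0) & singular_pair (u0, v0)])
    & (d_ alpha omega lam = d0 tomega -> ae0 u0 \/ ae0 v0)].
Proof.
have scalar : ae0 u0 \/ ae0 v0.
  (* A supremum above [beta] yields some [beta'] above [beta] whose level is that of coupling 0. *)
  have [_ [beta' [_ cb'] <-] bb'] := ereal_sup_gt hbeta.
  exact: (minimizer_scalar htomega hlam hbeta0 bb' cb' hmin).
have [[/= Hu _ _ _] _] := hmin; have [Lu _] := Hu.
split => //.
- move=> dd; have u00 : ae0 u0.
    case: scalar => // v00; have [Nu cE] := scalar_minimizer_S v00 hmin.
    (* Were [v0] null, [u0] would give [d_ <= c_ <= d0], against the assumption; the opposite case
       is symmetric. *)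
    have dc : (d_ alpha omega lam <= c_ alpha omega tomega lam beta)%E.
      by rewrite cE; apply: ereal_inf_lbound; exists u0.
    by have := lt_le_trans dd (le_trans dc (c_le_d0 alpha omega tomega lam beta)); rewrite ltxx.
  by split => //; apply: charge_H1; exact: H1_ae0.
- move=> dd; have v00 : ae0 v0.
    case: scalar => // u00; have [Nv cE] := scalar_minimizer_S0 u00 hmin.
    have dc : (d0 tomega <= c_ alpha omega tomega lam beta)%E.
      by rewrite cE; apply: ereal_inf_lbound; exists v0.
    by have := lt_le_trans dd (le_trans dc (c_le_d alpha omega tomega lam beta)); rewrite ltxx.
  have [Nu cE] := scalar_minimizer_S v00 hmin.
  by split => //; apply: (d_minimizer_charge hlam Nu); rewrite -cE; exact: c_le_d.
Qed.
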